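(* (a) Let $d\ge 2$ and let $h$ be a gauge function such that $h(2t)\le 2^dh(t)$ and $\int_0^1 t^{-1}\sqrt{t^{1-d}|\log(t)|h(t)}\,dt<+\infty$. Then there exists a compact set $A\subset\mathbb{R}^d$ of positive and finite $h$-dimensional measure, i.e. $0<\mathcal{H}^h(A)<\infty$, with the following property: there exists $C>0$ such that for any line $\gamma\subset\mathbb{R}^d$ and any $r>0$, the fibre $A\cap\gamma$ can be covered by $C\,r/h(r)$ intervals of length $r$. (b) If $d=2$ and $k\in\mathbb{N}$, the same holds for all $\gamma\in\mathcal{P}_k$, provided $h$ satisfies a slightly stronger assumption: if $h$ is a gauge function such that $h(2t)\le 4h(t)$ and $\int_0^1 t^{-1}|\log(t)|\sqrt{t^{-1}h(t)}\,dt<+\infty$, then there exists a compact set $A\subset\mathbb{R}^2$ with $0<\mathcal{H}^h(A)<\infty$ and there exists $C>0$ such that for any $\gamma\in\mathcal{P}_k$ and any $r>0$, the fibre $A\cap\gamma$ can be covered by $C\,r/h(r)$ intervals of length $r$.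
   Context: A gauge function is a function $h:(0,\infty)\to(0,\infty)$ that is non-decreasing, continuous and satisfies $\lim_{t\downarrow 0}h(t)=0$. The $h$-dimensional Hausdorff measure is $$\mathcal{H}^h(E)=\lim_{\delta\to 0}\inf\Big\{\sum_{i=1}^\infty h(\mathrm{diam}(E_i)) : E\subset\bigcup_i E_i,\ \mathrm{diam}(E_i)<\delta\Big\}.$$ $\mathcal{P}_k$ is the family of (real) algebraic curves in $\mathbb{R}^2$ of degree at most $k$.
   Formalization: For r > 1 the bound C r/h(r) is replaced by C max(1, r/h(r)), since r/h(r) may tend to 0 while a nonempty fibre needs at least one interval; on algebraic curves, intervals of length r are simple arcs (possibly points) of length at most r, as a curve may have components shorter than r. *)

(* Defs.v *)
From HB Require Import structures.
From mathcomp Require Import all_boot all_order all_algebra.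
From mathcomp Require Import all_classical all_reals all_analysis.
From mathcomp Require mpoly.
Import (canonicals, coercions) mpoly.

Set Implicit Arguments.
Unset Strict Implicit.
Unset Printing Implicit Defensive.

Import Order.TTheory GRing.Theory Num.Theory numFieldNormedType.Exports.

Local Open Scope classical_set_scope.
Local Open Scope ring_scope.

(* R^d is 'rV[R]_d.  Its library norm is the sup norm, so the Euclidean norm
   is defined here; both induce the same topology, hence the same compact sets
   and continuous paths. *)
Definition enorm (R : realType) (d : nat) (x : 'rV[R]_d) : R :=
  Num.sqrt (\sum_(i < d) x 0 i ^+ 2).

(* The point 0 is added so that the empty set has diameter 0 and not -oo. *)
Definition diam (R : realType) (d : nat) (E : set 'rV[R]_d) : \bar R :=
  ereal_sup (0%E |` [set (enorm (x - y))%:E | x in E & y in E]).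

(* A function on (0, oo) is represented by a total function R -> R whose values
   outside (0, oo) are never used. *)
Record gauge_function (R : realType) (h : R -> R) : Prop := {
  gauge_gt0 : forall t : R, 0 < t -> 0 < h t;
  gauge_nondecreasing : forall s t : R, 0 < s -> s <= t -> h s <= h t;
  gauge_continuous : forall t : R, 0 < t -> {for t, continuous h};
  gauge_cvg0 : h t @[t --> 0^'+] --> (0 : R) }.

(* h(diam E), with the convention h(0) = 0 = lim_{t -> 0+} h(t).  It is only
   used for sets of finite diameter. *)
Definition gauge_diam (R : realType) (h : R -> R) (d : nat)
    (E : set 'rV[R]_d) : R :=
  if 0 < fine (diam E) then h (fine (diam E)) else 0.

Definition hausdorff_premeasure (R : realType) (h : R -> R) (d : nat)
    (delta : R) (A : set 'rV[R]_d) : \bar R :=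
  ereal_inf [set (\sum_(0 <= i <oo) (gauge_diam h (E i))%:E)%E |
    E in [set E : (set 'rV[R]_d)^nat |
      A `<=` \bigcup_i E i /\ forall i, (diam (E i) < delta%:E)%E]].

Definition hausdorff_measure (R : realType) (h : R -> R) (d : nat)
    (A : set 'rV[R]_d) : \bar R :=
  lim (hausdorff_premeasure h delta A @[delta --> 0^'+]).

Definition is_line (R : realType) (d : nat) (g : set 'rV[R]_d) : Prop :=
  exists p u : 'rV[R]_d, u != 0 /\ g = range (fun s : R => p + s *: u).

Definition line_interval (R : realType) (d : nat) (g : set 'rV[R]_d) (r : R)
    (J : set 'rV[R]_d) : Prop :=
  J `<=` g /\ exists x y : 'rV[R]_d, enorm (y - x) = r /\
    J = [set x + s *: (y - x) | s in `[0, 1]].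

(* The family P_k: zero sets of nonzero real polynomials in two variables of
   total degree at most k (msize is the total degree plus one). *)
Definition algebraic_curve (R : realType) (k : nat) (g : set 'rV[R]_2) : Prop :=
  exists p : mpoly.mpoly 2 R, [/\ p != 0,
    (mpoly.msize p <= k.+1)%N &
    g = [set x | mpoly.meval (fun i => x 0 i) p = 0]].

Definition path_length (R : realType) (d : nat) (a b : R)
    (f : R -> 'rV[R]_d) : \bar R :=
  ereal_sup [set (\sum_(0 <= n < size s)
      enorm (f (nth b (a :: s) n.+1) - f (nth b (a :: s) n)))%:E |
    s in [set s | itv_partition a b s]].

(* An interval of the curve g is a simple arc contained in g.  Its length is
   only required to be at most r, because g may have components of length less
   than r; the case a = b allows for isolated points of g. *)
Definition curve_interval (R : realType) (d : nat) (g : set 'rV[R]_d) (r : R)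
    (J : set 'rV[R]_d) : Prop :=
  J `<=` g /\ exists (a b : R) (f : R -> 'rV[R]_d),
    [/\ a <= b, {within `[a, b], continuous f},
        {in `[a, b] &, injective f}, J = f @` `[a, b] &
        (path_length a b f <= r%:E)%E].

Definition covered_by_intervals (T : Type) (P : set T -> Prop) (N : nat) (X : set T)
    : Prop :=
  exists J : 'I_N -> set T, (forall i, P (J i)) /\ X `<=` \bigcup_i J i.

(* The quantity r / h(r), except that for r > 1 it is replaced by 1 when it is
   smaller.  This is unavoidable: r / h(r) may tend to 0 as r -> oo, while a
   nonempty fibre cannot be covered by fewer than one interval. *)
Definition fibre_scale (R : realType) (h : R -> R) (r : R) : R :=
  if r <= 1 then r / h r else Num.max 1 (r / h r).

(* Main.v *)
(* The set is a dyadic Cantor set.  At each level every cube is replaced either by all its 2^d children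
   or by a single one, the kind of level being chosen greedily so that the number M_n of cubes of level n
   satisfies M_n h(2^-n) ~ 1.  Whatever the single children are, the limit set then has positive and
   finite h-measure.  For d >= 3 the integral condition gives h(r) = O(r^2), and any choice works since
   r / h(r) is at least of order 1 / r.  For d = 2 the single children are chosen at random.  Let Y_n be
   4^n / M_n times the horizontal (or vertical) extent of a monotone branch of a curve of bounded degree
   inside the squares of level n.  A random step preserves the mean of Y_n, and by Chernoff's bound the
   deviation is at most a constant times sqrt (n Y_n 2^n / M_n), simultaneously for 2^O(n) branches; this
   suffices, since on a grid of mesh 2^-O(n) the branches, described by their Thom codes, form only 2^O(n)
   patterns.  The integral condition makes the deviations summable, so Y_n stays bounded.  Finally a curve
   meeting a square has an extent of order 2^-n close to it, apart from O(1) squares, so it meets at most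
   O(1 + M_n / 2^n) = O(2^-n / h(2^-n)) squares, and it cuts each of them in O(1) short arcs. *)
Require Import Defs.
From mathcomp Require Import all_boot all_order all_algebra.
From mathcomp Require Import all_classical all_reals all_analysis measurable_realfun.
From mathcomp Require Import ring lra zify.
From mathcomp Require Import polyrcf.
From mathcomp Require mpoly.
Import (canonicals, coercions) mpoly.
Import Order.TTheory GRing.Theory Num.Theory numFieldNormedType.Exports.
Local Open Scope classical_set_scope.
Local Open Scope ring_scope.

Set Implicit Arguments.
Unset Strict Implicit.
Unset Printing Implicit Defensive.

(** The obstacle is that one selection must serve infinitely many branches at once. Lengths are
    therefore replaced by counts of points on a grid of mesh 2^-L, with L = [Kc * n.+1] growing with
    the level: only 2^O(n) patterns remain, and the logarithm of their number is the factor n under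
    the square root. Passing to the finer grid of the next level changes an extent by at most 2^-L
    per square, which is summable once [Kc] is at least 3. The admissible deviation depends on the
    extent itself, like its square root, so a bound [Lam] on the extents is propagated by induction
    and has to exceed a sum of deviations of order sqrt [Lam]. Extents are bounded for all branches
    of given bidegree and not only for those of one curve: the final count moves a branch by about
    one square in order to compare a square with its neighbours, and exchanges the coordinates when
    the curve is steep, so the class must be stable under translations and must be treated in both
    orientations. *)

(** * Chernoff's bound and the number of sign vectors *)

Lemma exists_le_mean (R : realType) (E : finType) (e0 : E) (F : E -> R) :
  exists e, F e <= #|E|%:R^-1 * \sum_e' F e'.
Proof.
have E0 : (0 < #|E|)%N by apply/card_gt0P; exists e0.
apply: contrapT => /forallNP H.
have : \sum_(e : E) (#|E|%:R^-1 * \sum_e' F e') < \sum_e F e.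
  apply: ltr_sum => [|e _]; last by rewrite real_ltNge ?num_real//; exact/negP/H.
  by apply/hasP; exists e0 => //; rewrite mem_index_enum.
rewrite sumr_const -[X in X < _]mulr_natr mulrAC mulVf ?mul1r ?ltxx//.
by rewrite pnatr_eq0 -lt0n.
Qed.

(* The method of conditional expectations: the coordinates of [c] are fixed one after the other. *)
Lemma exists_prod_le_mean (R : realType) (T : eqType) (E : finType) (e0 : E) (X : Type)
    (Z : seq T) (V : seq X) (a : X -> R) (g : X -> T -> E -> R) :
  uniq Z -> (forall v, 0 <= a v) -> (forall v z e, 0 <= g v z e) ->
  exists c : T -> E, \sum_(v <- V) a v * \prod_(z <- Z) g v z (c z) <=
    \sum_(v <- V) a v * \prod_(z <- Z) (#|E|%:R^-1 * \sum_e g v z e).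
Proof.
move=> + + g0; elim: Z a => [|z Z IH] a.
  by move=> _ _; exists (fun=> e0); apply: ler_sum => v _; rewrite !big_nil.
move=> /= /andP[zZ uZ] a0.
pose A v := \prod_(z <- Z) (#|E|%:R^-1 * \sum_e g v z e).
have [e he] := exists_le_mean e0 (fun e => \sum_(v <- V) a v * g v z e * A v).
have [|c hc] := IH (fun v => a v * g v z e) uZ; first by move=> v; rewrite mulr_ge0.
exists (fun t => if t == z then e else c t).
have -> : \sum_(v <- V) a v * \prod_(t <- z :: Z) g v t (if t == z then e else c t) =
    \sum_(v <- V) a v * g v z e * \prod_(t <- Z) g v t (c t).
  apply: eq_bigr => v _; rewrite big_cons eqxx mulrA; congr (_ * _).
  apply: eq_big_seq => t tZ; case: eqP => // tz; by rewrite -tz tZ in zZ.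
apply: (le_trans hc); apply: (le_trans he).
rewrite exchange_big /= mulr_sumr le_eqVlt; apply/orP; left; apply/eqP.
apply: eq_bigr => v _; rewrite big_cons -/(A v) -mulr_suml -mulr_sumr; ring.
Qed.

(** From exp(-x) >= 1 - x one gets exp x <= 1 / (1 - x), and (1 + x + 2x^2)(1 - x) = 1 + x^2 (1 -
    2x). *)
Lemma expR_le_quad (R : realType) (x : R) : x <= 2^-1 -> expR x <= 1 + x + 2 * x ^+ 2.
Proof.
move=> x2; have := expR_ge1Dx (- x); rewrite expRN => h.
have x1 : 0 < 1 - x by lra.
have : expR x <= (1 - x)^-1.
  by rewrite -[expR x]invrK lef_pV2 // posrE ?invr_gt0 ?expR_gt0.
move=> /le_trans; apply; rewrite -div1r ler_pdivrMr //.
have : 0 <= x ^+ 2 * (1 - 2 * x) by apply: mulr_ge0; [exact: sqr_ge0|lra].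
by rewrite !expr2; nra.
Qed.

(* Chernoff's bound for the sum of the independent variables [#|E| * v z (c z) - \sum_e v z e],
   with [c z] uniform on [E], and a union bound over the family [v]. *)
Lemma exists_choice_small_deviation (R : realType) (T : eqType) (E : finType) (e0 : E)
    (K : nat) (Z : seq T) (v : 'I_K -> T -> E -> R) (l s B eps : R) :
  let q := #|E|%:R : R in
  uniq Z -> 0 < l -> 0 <= s -> (forall i z e, 0 <= v i z e) -> (forall i z, \sum_e v i z e <= s) ->
  2 * l * q * s <= 1 ->
  K%:R * expR (2 * l ^+ 2 * q ^+ 2 * s * B - l * eps) <= 1 ->
  exists c : T -> E, forall i, \sum_(z <- Z) \sum_e v i z e <= B ->
    \sum_(z <- Z) q * v i z (c z) <= \sum_(z <- Z) \sum_e v i z e + eps.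
Proof.
move=> q uZ l0 s0 v0 vs ls hK.
have q1 : 1 <= q by rewrite /q ler1n; apply/card_gt0P; exists e0.
pose m i z := \sum_e v i z e.
have m0 i z : 0 <= m i z by apply: sumr_ge0.
(* Only the indices of total mean at most [B] take part in the union bound; the others get weight
   0. *)
pose a i : R := if \sum_(z <- Z) m i z <= B then 1 else 0.
pose g i z e := expR (l * (q * v i z e - m i z)).
have a0 i : 0 <= a i by rewrite /a; case: ifP.
have g0 i z e : 0 <= g i z e by exact: expR_ge0.
have [c hc] := exists_prod_le_mean e0 (enum 'I_K) uZ a0 g0.
have prodg (f : T -> R) (r : seq T) :
    \prod_(z <- r) expR (f z) = expR (\sum_(z <- r) f z).
  by elim: r => [|z r IH]; rewrite ?big_nil ?expR0// !big_cons IH expRD.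
(* The linear term has mean zero, and one factor [m i z] of the quadratic term is bounded by [s].
   The exponent becomes linear in [m i z], so that its sum over [Z] is controlled by [B]. *)
have meang i z : q^-1 * \sum_e g i z e <= expR (2 * l ^+ 2 * q ^+ 2 * s * m i z).
  have vm e : v i z e <= m i z.
    by rewrite /m (bigD1 e)//= lerDl sumr_ge0.
  have h e : g i z e <= 1 + l * (q * v i z e - m i z) + 2 * (l * q * m i z) ^+ 2.
    apply: (le_trans (expR_le_quad _)).
      have : l * (q * v i z e - m i z) <= l * q * s.
        rewrite -mulrA ler_pM2l //; have := vm e; have := vs i z; rewrite -/(m i z).
        by have := m0 i z; have := v0 i z e; nra.
      by lra.
    rewrite lerD2l ler_pM2l // -mulrA !exprMn ler_pM2l ?exprn_gt0 //.
    rewrite -exprMn -subr_ge0 subr_sqr mulr_ge0 //.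
      have : 0 <= q * (m i z - v i z e) by rewrite mulr_ge0 ?subr_ge0 // (le_trans ler01).
      by have := m0 i z; lra.
    have : 0 <= q * v i z e by rewrite mulr_ge0 // (le_trans ler01).
    have : 0 <= (q - 1) * m i z by rewrite mulr_ge0 // subr_ge0.
    by lra.
  apply: (@le_trans _ _ (1 + 2 * (l * q * m i z) ^+ 2)); last first.
    apply: (le_trans (expR_ge1Dx _)); rewrite ler_expR !exprMn.
    have -> : 2 * (l ^+ 2 * q ^+ 2 * m i z ^+ 2) = (2 * l ^+ 2 * q ^+ 2 * m i z) * m i z by ring.
    have -> : 2 * l ^+ 2 * q ^+ 2 * s * m i z = (2 * l ^+ 2 * q ^+ 2 * m i z) * s by ring.
    apply: ler_wpM2l; last exact: vs.
    by rewrite !mulr_ge0 ?exprn_ge0 // ltW // (lt_le_trans ltr01).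
  rewrite mulrC ler_pdivrMr ?(lt_le_trans ltr01)//.
  apply: (le_trans (ler_sum _ (fun e _ => h e))).
  rewrite !big_split /= -mulr_sumr sumrB -mulr_sumr -/(m i z) !sumr_const.
  set w := 2 * _ ^+ 2; rewrite -(mulr_natr (m i z)) -(mulr_natr w).
  have -> : #|xpredT : pred E|%:R = q :> R by [].
  by rewrite le_eqVlt; apply/orP; left; apply/eqP; ring.
exists c => i hi; rewrite -lerBlDl -sumrB.
have h1 : \sum_(i <- enum 'I_K) a i * \prod_(z <- Z) g i z (c z) <= K%:R * expR (2 * l ^+ 2 * q ^+ 2 * s * B).
  apply: (le_trans hc).
  apply: (@le_trans _ _ (\sum_(i <- enum 'I_K) expR (2 * l ^+ 2 * q ^+ 2 * s * B))); last first.
    by rewrite big_enum sumr_const card_ord (mulr_natl (expR _)) lexx.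
  apply: ler_sum => j _; rewrite /a; case: ifP => [hj|]; last by rewrite mul0r expR_ge0.
  rewrite mul1r; apply: (@le_trans _ _ (\prod_(z <- Z) expR (2 * l ^+ 2 * q ^+ 2 * s * m j z))).
    apply: ler_prod => z _; by rewrite meang andbT mulr_ge0 ?sumr_ge0 // invr_ge0 (le_trans ler01).
  rewrite prodg ler_expR -mulr_sumr ler_wpM2l //.
  by rewrite !mulr_ge0 ?exprn_ge0 // ltW // (lt_le_trans ltr01).
have h2 : \prod_(z <- Z) g i z (c z) <= K%:R * expR (2 * l ^+ 2 * q ^+ 2 * s * B).
  apply: (le_trans _ h1); rewrite (bigD1_seq i) ?mem_enum ?enum_uniq //= {1}/a hi mul1r lerDl.
  by apply: sumr_ge0 => j _; rewrite mulr_ge0 // prodr_ge0.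
have : \prod_(z <- Z) g i z (c z) <= expR (l * eps).
  apply: (le_trans h2); move: hK; rewrite expRD expRN mulrA ler_pdivrMr ?expR_gt0 // mul1r.
  exact.
by rewrite prodg ler_expR -mulr_sumr ler_pM2l.
Qed.

(* As for the faces of a hyperplane arrangement: a new functional [c] splits a sign vector [t] only
   if [t] is already realized on the kernel of [c], which has smaller dimension. *)
Lemma sign_vectors_card (R : realType) (D : nat) (cs : seq 'cV[R]_D) :
  exists T : seq (seq R), (size T <= (3 * size cs).+1 ^ D)%N /\
    forall u : 'rV[R]_D, [seq Num.sg ((u *m c) 0 0) | c <- cs] \in T.
Proof.
have mono a b m : (a <= b)%N -> (a ^ m <= b ^ m)%N by case: m => // m; rewrite leq_exp2r.
move: {2}(size cs) (erefl (size cs)) => n; elim: n D cs => [|n IH] D [|c cs] //=.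
  by move=> _; exists [:: [::]]; split; [rewrite muln0 exp1n|move=> u; rewrite inE].
case=> szn; have [T1 [s1 h1]] := IH D cs szn.
have [c0|c0] := eqVneq c 0.
  exists [seq 0 :: t | t <- T1]; split=> [|u].
    by rewrite size_map (leq_trans s1) // mono // ltnS leq_mul.
  by rewrite /= c0 mulmx0 mxE sgr0; apply: map_f.
have rc : \rank (kermx c) = D.-1.
  by rewrite mxrank_ker -mxrank_tr rank_rV -(inj_eq trmx_inj) trmxK trmx0 c0 subn1.
have [D0 DD] : exists D', D = D'.+1.
  exists D.-1; rewrite prednK // lt0n; apply: contraNneq c0 => D0.
  by apply/eqP/matrixP => i; have := ltn_ord i; rewrite [X in (_ < X)%N]D0.
pose B := row_base (kermx c).
have [T0 [s0 h0]] := IH _ [seq B *m c' | c' <- cs] (etrans (size_map _ _) szn).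
(* Each sign vector of [cs] is extended by one sign, nonzero if possible. A vector that admits both
   signs 1 and -1 is realized on the kernel of [c], hence is in [T0] and gets all three
   extensions. *)
pose ex (t : seq R) (s : R) := exists u : 'rV[R]_D,
  [seq Num.sg ((u *m c) 0 0) | c <- cs] = t /\ Num.sg ((u *m c) 0 0) = s.
pose ext t : R := if `[< ex t 1 >] then 1 else if `[< ex t (-1) >] then -1 else 0.
exists ([seq ext t :: t | t <- T1] ++ [seq 1 :: t | t <- T0] ++ [seq -1 :: t | t <- T0] ++
   [seq 0 :: t | t <- T0]); split => [|u].
  (* At most (3n+1)^D + 3 (3n+1)^(D-1) vectors, which is below (3n+4)^D. *)
  rewrite !size_cat !size_map /= mulnS.
  move: s1 s0; rewrite size_map rc szn DD /=; set m := (3 * n)%N => s1 s0.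
  have h : (m.+1 ^ D0 <= (3 + m).+1 ^ D0)%N by apply: mono; rewrite ltnS leq_addl.
  move: s1; rewrite !expnS; nia.
have ker (u' : 'rV[R]_D) : (u' *m c) 0 0 = 0 -> [seq Num.sg ((u' *m c) 0 0) | c <- cs] \in T0.
  move=> u0; have /submxP[w ->] : (u' <= B)%MS.
    rewrite eq_row_base; apply/sub_kermxP/matrixP => i j; rewrite !ord1 u0 mxE //.
  rewrite (_ : [seq _ | _ <- cs] = [seq Num.sg ((w *m c') 0 0) | c' <- [seq B *m c' | c' <- cs]]).
    exact: h0.
  by rewrite -map_comp; apply: eq_map => c' /=; rewrite mulmxA.
rewrite /= !mem_cat; set t := [seq _ | _ <- _].
have tT1 := map_f (fun t => ext t :: t) (h1 u); rewrite -/t /= in tT1.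
have [u0|u0|u0] := ltrgt0P ((u *m c) 0 0).
- have e : ext t = 1 by rewrite /ext asboolT //; exists u; rewrite gtr0_sg.
  by rewrite gtr0_sg //; rewrite e in tT1; rewrite tT1.
- have [[u' [tu' su']]|ne] := pselect (ex t 1).
    rewrite ltr0_sg // (map_f (cons (-1))) ?orbT //.
    have u'0 : 0 < (u' *m c) 0 0 by rewrite -sgr_gt0 su'.
    (* Up to a positive factor, the point where the segment from [u] to [u'] crosses the kernel of
       [c]; its signs on [cs] are the common signs of the two ends. *)
    pose a := (u' *m c) 0 0; pose b := - (u *m c) 0 0.
    have b0 : 0 < b by rewrite oppr_gt0.
    have lin c' : ((a *: u + b *: u') *m c') 0 0 = a * (u *m c') 0 0 + b * (u' *m c') 0 0.
      by rewrite mulmxDl -!scalemxAl [LHS]mxE [X in X + _]mxE [X in _ + X]mxE.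
    have := ker (a *: u + b *: u'); rewrite lin mulrC -/a /b mulNr subrr => /(_ erefl).
    rewrite (_ : [seq _ | _ <- cs] = t) //; apply/eq_in_map => c' c'cs; rewrite lin.
    have : Num.sg ((u' *m c') 0 0) = Num.sg ((u *m c') 0 0).
      have := f_equal (fun s => nth 0 s (index c' cs)) tu'.
      by rewrite !(nth_map 0) ?index_mem // nth_index.
    have [h|h|->] := ltrgt0P ((u *m c') 0 0).
    + rewrite (gtr0_sg h) => /eqP; rewrite sgr_cp0 => h'.
      by rewrite gtr0_sg // addr_gt0 ?mulr_gt0.
    + rewrite (ltr0_sg h) => /eqP; rewrite sgr_cp0 => h'; rewrite ltr0_sg //.
      by rewrite -oppr_gt0 opprD -!mulrN addr_gt0 ?mulr_gt0 ?oppr_gt0.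
    + by rewrite sgr0 => /eqP; rewrite sgr_eq0 => /eqP ->; rewrite !mulr0 addr0 sgr0.
  have e : ext t = -1 by rewrite /ext asboolF // asboolT //; exists u; rewrite ltr0_sg.
  by rewrite ltr0_sg //; rewrite e in tT1; rewrite tT1.
- by rewrite u0 sgr0 (map_f (cons 0)) ?orbT // ker.
Qed.

(** * Thom's lemma *)

(** The Thom code of [y] with respect to [q], complete as soon as [size q <= n]. *)
Definition sign_code (R : realType) (n : nat) (q : {poly R}) (y : R) : seq R :=
  [seq Num.sg q^`(i).[y] | i <- iota 0 n].

Lemma sign_codeS (R : realType) n (q : {poly R}) y :
  sign_code n.+1 q y = Num.sg q.[y] :: sign_code n q^`() y.
Proof.
rewrite /sign_code /= -[1%N]addn0 iotaDl -map_comp; congr (_ :: _).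
by apply: eq_map => i; rewrite /comp add1n derivSn.
Qed.

Lemma sign_code_nth (R : realType) n (q : {poly R}) y i : (i < n)%N ->
  nth 0 (sign_code n q y) i = Num.sg q^`(i).[y].
Proof. by move=> ni; rewrite (nth_map 0%N) ?size_iota // nth_iota. Qed.

Lemma size_deriv_leq (A : nzRingType) n (q : {poly A}) : (size q <= n.+1)%N -> (size q^`() <= n)%N.
Proof.
have [->|q0] := eqVneq q 0; first by rewrite deriv0 size_poly0.
by move=> /(leq_trans (lt_size_deriv q0)).
Qed.

Lemma sgr_between (R : realDomainType) (a b c : R) :
  a <= b -> b <= c -> Num.sg a = Num.sg c -> Num.sg b = Num.sg a.
Proof.
case: (ltrgt0P a) => [a0|a0|->] ab bc.
- by rewrite !gtr0_sg // (lt_le_trans a0) // (le_trans ab).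
- rewrite (ltr0_sg a0) => /esym/eqP; rewrite sgr_cp0 => c0.
  by rewrite ltr0_sg // (le_lt_trans bc).
- rewrite sgr0 => /esym/eqP; rewrite sgr_eq0 => /eqP c0; rewrite c0 in bc.
  by have -> : b = 0; [apply/eqP; rewrite eq_le ab bc | rewrite sgr0].
Qed.

Lemma sgr_le (R : realDomainType) (a b : R) : a <= b -> Num.sg a <= Num.sg b.
Proof.
case: (ltrgt0P a) => [a0|a0|->] ab.
- by rewrite !gtr0_sg // (lt_le_trans a0).
- by rewrite (ltr0_sg a0); case: sgrP => _; rewrite ?lerN10 // (le_trans (lerN10 _)) ?ler01.
- by rewrite sgr0 sgr_ge0.
Qed.

Lemma sign_deriv_homo (R : realType) (q : {poly R}) (z y : R) :
  z <= y -> (forall t, z <= t <= y -> Num.sg q^`().[t] = Num.sg q^`().[z]) ->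
  forall t u, z <= t -> t <= u -> u <= y ->
   (0 <= Num.sg q^`().[z] -> q.[t] <= q.[u]) /\ (Num.sg q^`().[z] <= 0 -> q.[u] <= q.[t]).
Proof.
move=> zy h t u zt tu uy; split; rewrite ?sgr_ge0 ?sgr_le0 => hz.
  apply: (@ler_hornerW _ z y) => //; rewrite ?in_itv /= ?zt ?(le_trans tu) ?uy ?andbT ?(le_trans zt) //.
  move=> x; rewrite in_itv /= => /andP[zx xy].
  by rewrite -sgr_ge0 h ?sgr_ge0 // (ltW zx) (ltW xy).
rewrite -lerN2 -!hornerN.
apply: (@ler_hornerW _ z y) => //; rewrite ?in_itv /= ?zt ?(le_trans tu) ?uy ?andbT ?(le_trans zt) //.
move=> x; rewrite in_itv /= => /andP[zx xy].
by rewrite derivN hornerN oppr_ge0 -sgr_le0 h ?sgr_le0 // (ltW zx) (ltW xy).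
Qed.

(** Induction on the degree: the derivative has constant sign on [z, y], so [q] is monotone there,
    and equal signs at the two ends force the same sign in between. *)
Lemma thom (R : realType) (n : nat) (q : {poly R}) (z y : R) :
  (size q <= n)%N -> z <= y -> sign_code n q z = sign_code n q y ->
  forall t, z <= t <= y -> sign_code n q t = sign_code n q z.
Proof.
elim: n q => [|n IH] q sq zy //; rewrite !sign_codeS => -[h0 h1] t tzy.
rewrite sign_codeS.
have sq' : (size q^`() <= n)%N by exact: size_deriv_leq.
have H := IH _ sq' zy h1; rewrite (H t tzy); congr (_ :: _).
have hd s : z <= s <= y -> Num.sg q^`().[s] = Num.sg q^`().[z].
  move=> szy; have := H s szy; case: (n) sq' => [|m] sq' //.
    by move: sq'; rewrite leqn0 size_poly_eq0 => /eqP ->; rewrite !horner0.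
  by rewrite !sign_codeS => -[].
have /andP[zt ty] := tzy.
have [s0|s0] := lerP 0 (Num.sg q^`().[z]).
  apply: sgr_between h0; first by have [/(_ s0)] := sign_deriv_homo zy hd (lexx z) zt ty.
  by have [/(_ s0)] := sign_deriv_homo zy hd zt ty (lexx y).
rewrite h0; apply: sgr_between (esym h0).
  by have [_ /(_ (ltW s0))] := sign_deriv_homo zy hd zt ty (lexx y).
by have [_ /(_ (ltW s0))] := sign_deriv_homo zy hd (lexx z) zt ty.
Qed.

(* Compares two points from the signs of the derivatives: at the last derivative whose signs
   differ, the next one has constant sign in between, so that the former is monotone. *)
Fixpoint code_lt (R : realType) (s t : seq R) : bool :=
  match s, t with
  | s0 :: s', t0 :: t' =>
    if s' == t' then if 0 < head 0 s' then s0 < t0 else t0 < s0 else code_lt s' t'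
  | _, _ => false
  end.

Lemma code_deriv_const (R : realType) n (q : {poly R}) (z y : R) :
  (size q <= n.+1)%N -> z <= y -> sign_code n q^`() z = sign_code n q^`() y ->
  forall t, z <= t <= y -> Num.sg q^`().[t] = Num.sg q^`().[z].
Proof.
move=> sq zy h t tzy.
have sq' : (size q^`() <= n)%N by exact: size_deriv_leq.
have := thom sq' zy h tzy; case: (n) sq' => [|m] sq'.
  by move: sq'; rewrite leqn0 size_poly_eq0 => /eqP ->; rewrite !horner0.
by rewrite !sign_codeS => -[].
Qed.

(** Between two distinct roots the mean value theorem would give a zero of the derivative, which has
    constant nonzero sign there by Thom's lemma. *)
Lemma code_root_eq (R : realType) n (q : {poly R}) (z y : R) :
  (size q <= n)%N -> q.[z] = 0 -> q^`().[z] != 0 -> sign_code n q z = sign_code n q y -> z = y.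
Proof.
case: n => [|n] sq qz q'z.
  by move: sq q'z; rewrite leqn0 size_poly_eq0 => /eqP ->; rewrite deriv0 horner0 eqxx.
rewrite !sign_codeS => -[h0 h1].
have qy : q.[y] = 0 by apply/eqP; rewrite -sgr_eq0 -h0 qz sgr0.
have q'zy : Num.sg q^`().[z] = Num.sg q^`().[y].
  move: h1; case: (n) sq => [|m] sq; last by rewrite !sign_codeS => -[].
  by move: q'z; rewrite (size1_polyC sq) derivC horner0 eqxx.
wlog zy : z y qz qy q'z h0 h1 q'zy / z <= y.
  move=> H; have /orP[zy|yz] := le_total z y; first exact: H.
  apply/esym; apply: (H y z) => //.
  by rewrite -sgr_eq0 -q'zy sgr_eq0.
have hd := code_deriv_const sq zy h1.
apply/eqP; rewrite eq_le zy /=; apply: contraT; rewrite -ltNge => zy'.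
have [c] := poly_mvt q zy'; rewrite in_itv /= => /andP[zc cy].
rewrite qz qy subrr => /esym/eqP.
rewrite mulf_eq0 subr_eq0 (gt_eqF zy').
by rewrite orbF -sgr_eq0 hd ?sgr_eq0 ?(negbTE q'z) // !ltW.
Qed.

(** For distinct codes this is the rule behind [code_lt]; for equal codes the simple root [z] forces
    y = z, and both sides are false. *)
Lemma code_ltP (R : realType) n (q : {poly R}) (z y : R) :
  (size q <= n)%N -> q.[z] = 0 -> q^`().[z] != 0 ->
  code_lt (sign_code n q z) (sign_code n q y) = (z < y).
Proof.
move=> sq qz q'z.
have [e|ne] := eqVneq (sign_code n q z) (sign_code n q y).
  rewrite -(code_root_eq sq qz q'z e) ltxx.
  elim: (n) (q) => [|m IH] p //; rewrite !sign_codeS /= eqxx ltxx if_same //.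
elim: n q sq ne {qz q'z} => [|n IH] q sq //; rewrite !sign_codeS /=.
have [e|ne _] := eqVneq (sign_code n q^`() z) (sign_code n q^`() y); last first.
  by apply: IH ne; exact: size_deriv_leq.
rewrite e eqseq_cons eqxx andbT => h0.
have hhead : head 0 (sign_code n q^`() y) = Num.sg q^`().[y].
  case: (n) sq => [|m] sq; last by rewrite sign_codeS.
  by rewrite (size1_polyC sq) derivC horner0 sgr0.
rewrite hhead.
have [zy|yz|zy] := ltrgtP z y; last by rewrite zy eqxx in h0.
  have hd := code_deriv_const sq (ltW zy) e.
  have [hi lo] := sign_deriv_homo (ltW zy) hd (lexx z) (ltW zy) (lexx y).
  rewrite (hd y) ?lexx ?ltW //; case: ltP => s0.
    by rewrite lt_neqAle h0 sgr_le // hi // ltW.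
  by rewrite lt_neqAle eq_sym h0 sgr_le // lo.
have hd := code_deriv_const sq (ltW yz) (esym e).
have [hi lo] := sign_deriv_homo (ltW yz) hd (lexx y) (ltW yz) (lexx z).
case: ltP => s0; apply/negbTE; rewrite -leNgt sgr_le //.
  by rewrite hi // ltW.
by rewrite lo.
Qed.

(** * Plane algebraic curves *)

(* The outer variable of [P] is [y], its coefficients are polynomials in [x]. *)
Definition ev (R : realType) (P : {poly {poly R}}) (x y : R) : R := P.[y%:P].[x].

(** The two degrees are bounded separately: such a bound passes to factors, derivatives and
    translates, and is symmetric in the variables. *)
Definition bideg (R : realType) (k : nat) (P : {poly {poly R}}) :=
  ((size P <= k.+1) && (sizeY P <= k.+1))%N.

Definition spec (R : realType) (P : {poly {poly R}}) (x : R) : {poly R} :=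
  map_poly (horner_eval x) P.

Lemma spec_horner (R : realType) (P : {poly {poly R}}) x y : (spec P x).[y] = ev P x y.
Proof.
rewrite /ev /spec; have -> : y = horner_eval x y%:P by rewrite /horner_eval hornerC.
by rewrite horner_map /horner_eval !hornerC.
Qed.

Lemma spec_derivn (R : realType) (P : {poly {poly R}}) x i : (spec P x)^`(i) = spec P^`(i) x.
Proof. by rewrite /spec derivn_map. Qed.

Lemma evM (R : realType) (P Q : {poly {poly R}}) x y : ev (P * Q) x y = ev P x y * ev Q x y.
Proof. by rewrite /ev !hornerM. Qed.

Lemma evD (R : realType) (P Q : {poly {poly R}}) x y : ev (P + Q) x y = ev P x y + ev Q x y.
Proof. by rewrite /ev !hornerD. Qed.

Lemma evC (R : realType) (a : {poly R}) x y : ev a%:P x y = a.[x].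
Proof. by rewrite /ev hornerC. Qed.

Lemma ev_swapXY (R : realType) (P : {poly {poly R}}) x y : ev (swapXY P) x y = ev P y x.
Proof. exact: horner2_swapXY. Qed.

Lemma size_mulS (R : realType) (p q : {poly R}) : p != 0 -> q != 0 ->
  (size (p * q)).+1 = (size p + size q)%N.
Proof. by move=> p0 q0; rewrite size_mul // prednK // addn_gt0 size_poly_gt0 p0. Qed.

Lemma sizeX_mul (R : realType) (p q : {poly {poly R}}) : p != 0 -> q != 0 ->
  (size (p * q)).+1 = (size p + size q)%N.
Proof. by move=> p0 q0; rewrite size_mul // prednK // addn_gt0 size_poly_gt0 p0. Qed.

Lemma sizeY_mul (R : realType) (p q : {poly {poly R}}) : p != 0 -> q != 0 ->
  (sizeY (p * q)).+1 = (sizeY p + sizeY q)%N.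
Proof. by move=> p0 q0; rewrite !sizeYE rmorphM sizeX_mul // swapXY_eq0. Qed.

(** * Irreducible factors and elimination *)

Definition ccst (R : realType) (P : {poly {poly R}}) := ((size P <= 1) && (sizeY P <= 1))%N.

(** Irreducibility over the reals in both variables together, where only real constants are units.
    Nonzero constants count as irreducible, so that every nonzero polynomial is a product of such
    factors without a unit in front. *)
Definition irr (R : realType) (P : {poly {poly R}}) :=
  P != 0 /\ forall F G : {poly {poly R}}, P = F * G -> ccst F \/ ccst G.

Lemma bideg_mull (R : realType) k (F G : {poly {poly R}}) :
  F != 0 -> G != 0 -> bideg k (F * G) -> bideg k F /\ bideg k G.
Proof.
move=> F0 G0 /andP[h1 h2]; have := sizeX_mul F0 G0; have := sizeY_mul F0 G0.
have : (0 < size F)%N by rewrite size_poly_gt0.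
have : (0 < size G)%N by rewrite size_poly_gt0.
have : (0 < sizeY F)%N by rewrite lt0n sizeY_eq0.
have : (0 < sizeY G)%N by rewrite lt0n sizeY_eq0.
by move=> *; split; apply/andP; split; lia.
Qed.

Lemma irr_factors (R : realType) k (P : {poly {poly R}}) : P != 0 -> bideg k P ->
  exists fs : seq {poly {poly R}}, [/\ (size fs <= k.+1 + k.+1)%N,
    forall f, f \in fs -> irr f /\ bideg k f &
    P = \prod_(f <- fs) f].
Proof.
move=> P0 kP.
(* [size P + sizeY P - 2] is the sum of the two degrees, additive under products; each nonconstant
   factor uses up at least one unit of it. *)
suff : exists fs : seq {poly {poly R}}, [/\ (size fs <= maxn 1 (size P + sizeY P - 2))%N,
    forall f, f \in fs -> irr f /\ bideg k f & P = \prod_(f <- fs) f].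
  move=> [fs [h1 h2 h3]]; exists fs; split=> //; apply: (leq_trans h1).
  by case/andP: kP; lia.
have [n] := ubnP (size P + sizeY P); elim: n P P0 kP => // n IH P P0 kP Pn.
have [iP|niP] := pselect (irr P).
  exists [:: P]; split; rewrite ?leq_max ?big_seq1 // => f.
  by rewrite inE => /eqP ->.
have [F [G [PFG nF nG]]] : exists F G : {poly {poly R}}, [/\ P = F * G, ~ ccst F & ~ ccst G].
  apply: contrapT => /forallNP H; apply: niP; split => // F G e; apply: contrapT => /not_orP[a b].
  by apply: (H F); exists G.
have F0 : F != 0 by apply: contraNneq P0 => F0; rewrite PFG F0 mul0r.
have G0 : G != 0 by apply: contraNneq P0 => G0; rewrite PFG G0 mulr0.
have [kF kG] : bideg k F /\ bideg k G by apply: bideg_mull => //; rewrite -PFG.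
have sm := sizeX_mul F0 G0; have sYm := sizeY_mul F0 G0; rewrite -PFG in sm sYm.
move: (nF) (nG) => /negP + /negP; rewrite /ccst !negb_and -!ltnNge => gF gG.
have : (0 < size F)%N by rewrite size_poly_gt0.
have : (0 < size G)%N by rewrite size_poly_gt0.
have : (0 < sizeY F)%N by rewrite lt0n sizeY_eq0.
have : (0 < sizeY G)%N by rewrite lt0n sizeY_eq0.
move=> l1 l2 l3 l4.
have [|f1 [a1 b1 c1]] := IH F F0 kF; first lia.
have [|f2 [a2 b2 c2]] := IH G G0 kG; first lia.
exists (f1 ++ f2); split; last by rewrite big_cat /= -c1 -c2.
  rewrite size_cat; lia.
by move=> f; rewrite mem_cat => /orP[/b1|/b2].
Qed.

Definition cdvd (R : realType) (p : {poly R}) (F : {poly {poly R}}) := forall i, p %| F`_i.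

Lemma exists_irreducible_factor (R : realType) (a : {poly R}) : (1 < size a)%N ->
  exists2 p : {poly R}, irreducible_poly p & p %| a.
Proof.
have [n] := ubnP (size a); elim: n a => // n IH a an a1.
have [ia|nia] := pselect (irreducible_poly a); first by exists a.
have [q [q1 qa qna]] : exists q : {poly R}, [/\ size q != 1%N, q %| a & ~~ (q %= a)].
  apply: contrapT => /forallNP H; apply: nia; split => // q q1 qa; apply: contrapT => /negP qna.
  by apply: (H q).
have a0 : a != 0 by rewrite -size_poly_gt0 ltnW.
have q0 : q != 0 by apply: contraNneq a0 => q0; move: qa; rewrite q0 dvd0p.
have sq : (size q < size a)%N.
  by rewrite ltn_neqAle dvdp_leq // andbT; apply: contra qna; rewrite -dvdp_size_eqp.
have [||p ip pq] := IH q; first by rewrite (leq_trans sq).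
  by rewrite ltn_neqAle eq_sym q1 size_poly_gt0.
by exists p => //; exact: dvdp_trans pq qa.
Qed.

Lemma irreducible_cofactor (R : realType) (a : {poly R}) : (1 < size a)%N ->
  exists p b : {poly R}, [/\ irreducible_poly p, (1 < size p)%N, a = p * b,
    b != 0 & (size b < size a)%N].
Proof.
move=> a1; have a0 : a != 0 by rewrite -size_poly_gt0 ltnW.
have [p ip pa] := exists_irreducible_factor a1.
have p1 : (1 < size p)%N by have [h _] := ip; exact: h.
have p0 : p != 0 by rewrite -size_poly_gt0 ltnW.
have [b ab] : exists b : {poly R}, a = p * b by exists (a %/ p); rewrite mulrC divpK.
have b0 : b != 0 by apply: contraNneq a0 => b0; rewrite ab b0 mulr0.
exists p, b; split=> //; have := size_mulS p0 b0; rewrite -ab => h.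
by lia.
Qed.

Lemma irreducible_dvd_mul (R : realType) (p a b : {poly R}) :
  irreducible_poly p -> p %| a * b -> p %| a \/ p %| b.
Proof.
move=> ip pab; have [pa|npa] := boolP (p %| a); first by left.
by right; move: pab; rewrite Gauss_dvdpr // irreducible_poly_coprime.
Qed.

(** Gauss's lemma. If i and j are the least indices of coefficients of [F] and [G] not divisible by
    [p], then in the coefficient of index i + j of the product all terms but one are divisible by
    [p]. *)
Lemma cdvd_mul (R : realType) (p : {poly R}) (F G : {poly {poly R}}) :
  irreducible_poly p -> cdvd p (F * G) -> cdvd p F \/ cdvd p G.
Proof.
move=> ip pFG; apply: contrapT => /not_orP[nF nG].
move/existsNP: nF => [i0 /negP hi]; move/existsNP: nG => [j0 /negP hj].
case: (ex_minnP (ex_intro (fun i => ~~ (p %| F`_i)) i0 hi)) => i pi mi.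
case: (ex_minnP (ex_intro (fun i => ~~ (p %| G`_i)) j0 hj)) => j pj mj.
have := pFG (i + j)%N; rewrite coefM.
have li : (i < (i + j).+1)%N by rewrite ltnS leq_addr.
rewrite (bigD1 (Ordinal li)) //= addKn dvdp_addl; last first.
  apply: (big_ind (fun u => p %| u)) => [|u v|l]; [exact: dvdp0|exact: dvdp_add|].
  rewrite -val_eqE /= => li'; have [ll|ll|ll] := ltngtP l i; last by rewrite ll eqxx in li'.
  - apply: dvdp_mulr; apply: contraT => /mi; lia.
  - by apply: dvdp_mull; apply: contraT => /mj; have := ltn_ord l; lia.
by move=> /(irreducible_dvd_mul ip) []; apply/negP.
Qed.

Lemma cdvdP (R : realType) (p : {poly R}) (F : {poly {poly R}}) :
  cdvd p F -> exists F' : {poly {poly R}}, F = p%:P * F'.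
Proof.
move=> h; exists (\poly_(i < size F) (F`_i %/ p)); apply/polyP => i.
rewrite coefCM coef_poly; case: ltnP => hi; first by rewrite mulrC divpK.
by rewrite nth_default // mulr0.
Qed.

Lemma size_cmul (R : realType) (p : {poly R}) (F : {poly {poly R}}) : p != 0 ->
  size (p%:P * F) = size F.
Proof.
move=> p0; have [->|F0] := eqVneq F 0; first by rewrite mulr0.
by rewrite size_Cmul.
Qed.

Lemma sizeY_polyC (R : realType) (p : {poly R}) : sizeY p%:P = size p.
Proof. by rewrite sizeYE swapXY_polyC size_map_polyC. Qed.

Lemma cdvd_mulC (R : realType) (p : {poly R}) (F : {poly {poly R}}) : cdvd p (p%:P * F).
Proof. by move=> i; rewrite coefCM dvdp_mulr. Qed.

(** Irreducibility persists over the field of fractions in x: by Gauss's lemma the irreducible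
    factors of [a] can be cancelled one by one from [F] or [G], until [a] is a constant. *)
Lemma irr_cofactor (R : realType) (P F G : {poly {poly R}}) (a : {poly R}) :
  irr P -> a != 0 -> a%:P * P = F * G -> (size F <= 1)%N \/ (size G <= 1)%N.
Proof.
move=> iP; have [n] := ubnP (size a); elim: n a F G => // n IH a F G an a0 e.
have [a1|a1] := leqP (size a) 1.
  have ac := size1_polyC a1; set c := a`_0 in ac.
  have c0 : c != 0 by apply: contraNneq a0 => c0; rewrite ac c0.
  have : P = (c^-1%:P%:P * F) * G.
    rewrite -mulrA -e ac mulrA -!polyCM mulVf // mul1r //.
  by move=> /(proj2 iP) [] /andP[] h _; [left|right] => //; rewrite size_cmul ?polyC_eq0 ?invr_eq0 // in h.
have [p [b [ip p1 ab b0 /leq_trans/(_ an) bn]]] := irreducible_cofactor a1.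
have p0 : p != 0 by rewrite -size_poly_gt0 ltnW.
have pFG : cdvd p (F * G) by rewrite -e ab polyCM -mulrA; exact: cdvd_mulC.
have pP0 : p%:P != 0 :> {poly {poly R}} by rewrite polyC_eq0.
have [/cdvdP[F' FF]|/cdvdP[G' GG]] := cdvd_mul ip pFG.
  have : b%:P * P = F' * G.
    by apply: (mulfI pP0); rewrite mulrA -polyCM -ab e FF mulrA.
  by move=> /(IH _ _ _ bn b0); rewrite FF size_cmul.
have : b%:P * P = F * G'.
  by apply: (mulfI pP0); rewrite mulrA -polyCM -ab e GG mulrCA.
by move=> /(IH _ _ _ bn b0); rewrite GG size_cmul.
Qed.

(** Clears the denominator [a]: an irreducible factor of [a] cannot divide all coefficients of [P],
    which is irreducible of positive degree in y, so by Gauss's lemma it divides those of [U] and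
    cancels. *)
Lemma irr_dvd (R : realType) (P U Q : {poly {poly R}}) (a : {poly R}) :
  irr P -> (1 < size P)%N -> a != 0 -> P * U = a%:P * Q -> exists U' : {poly {poly R}}, Q = P * U'.
Proof.
move=> iP P1; have [n] := ubnP (size a); elim: n a U => // n IH a U an a0 e.
have [a1|a1] := leqP (size a) 1.
  have ac := size1_polyC a1; set c := a`_0 in ac.
  have c0 : c != 0 by apply: contraNneq a0 => c0; rewrite ac c0.
  exists (c^-1%:P%:P * U); rewrite mulrCA e ac mulrA -!polyCM mulVf // mul1r //.
have [p [b [ip p1 ab b0 /leq_trans/(_ an) bn]]] := irreducible_cofactor a1.
have p0 : p != 0 by rewrite -size_poly_gt0 ltnW.
have pPU : cdvd p (P * U) by rewrite e ab polyCM -mulrA; exact: cdvd_mulC.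
have pP0 : p%:P != 0 :> {poly {poly R}} by rewrite polyC_eq0.
have [/cdvdP[F' FF]|/cdvdP[U' UU]] := cdvd_mul ip pPU.
  have [/andP[_]|/andP[]] := proj2 iP _ _ FF; first by rewrite sizeY_polyC leqNgt p1.
  by move: P1; rewrite {1}FF size_cmul // ltnNge => /negP + h.
apply: (IH _ U' bn b0); apply: (mulfI pP0).
by rewrite mulrCA -UU e ab polyCM mulrA.
Qed.

(** If the resultant vanished, the gcd over the fractions in x would have positive degree in y,
    hence would equal [P] up to factors depending on x only. Then [P] divides [Q], against the
    smaller degree of [Q] in one of the variables. *)
Lemma irr_resultant (R : realType) (P Q : {poly {poly R}}) :
  irr P -> (1 < size P)%N -> Q != 0 -> ((size Q < size P) || (sizeY Q < sizeY P))%N ->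
  resultant P Q != 0.
Proof.
move=> iP P1 Q0 sPQ; rewrite resultant_eq0 -leqNgt leqNgt; apply/negP => g1.
pose D : {poly {poly R}} := Pdiv.Idomain.gcdp P Q; rewrite -/D in g1.
have P0 : P != 0 by case: iP.
have D0 : D != 0 by rewrite -size_poly_gt0 ltnW.
have mult X : Pdiv.Idomain.dvdp D X ->
    exists (c : {poly R}) (W : {poly {poly R}}), c != 0 /\ c%:P * X = W * D.
  by move=> /Pdiv.Idomain.dvdpP[[c W] /= c0 e]; exists c, W; rewrite mul_polyC.
have [c1 [W1 [c10 e1]]] := mult P (Pdiv.Idomain.dvdp_gcdl P Q).
have [c2 [W2 [c20 e2]]] := mult Q (Pdiv.Idomain.dvdp_gcdr P Q).
have [W1s|] := irr_cofactor iP c10 e1; last by rewrite leqNgt g1.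
have W1c := size1_polyC W1s; set w := W1`_0 in W1c.
have w0 : w != 0.
  apply: contraNneq P0 => w0; move: e1; rewrite W1c w0 mul0r => /eqP.
  by rewrite mulf_eq0 polyC_eq0 (negbTE c10).
have wc2 : w * c2 != 0 by rewrite mulf_neq0.
have [|U QU] := @irr_dvd R P (c1%:P * W2) Q (w * c2) iP P1 wc2.
  by rewrite polyCM -mulrA e2 mulrA [P * _]mulrC e1 W1c mulrAC mulrA.
have U0 : U != 0 by apply: contraNneq Q0 => U0; rewrite QU U0 mulr0.
have := sizeX_mul P0 U0; have := sizeY_mul P0 U0; rewrite -QU.
have : (0 < size U)%N by rewrite size_poly_gt0.
have : (0 < sizeY U)%N by rewrite lt0n sizeY_eq0.
by lia.
Qed.

Lemma size_det_leq (R : realType) (k n : nat) (M : 'M[{poly R}]_n) :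
  (forall i j, size (M i j) <= k.+1)%N -> (size (\det M) <= (n * k).+1)%N.
Proof.
move=> h; apply: (leq_trans (size_sum _ _ _)); apply/bigmax_leqP => s _.
rewrite size_Msign (leq_trans (size_poly_prod_leq _ _)) //.
set S := (\sum_i _)%N; have : (S <= \sum_(i < n) k.+1)%N by apply: leq_sum.
by rewrite sum_nat_const (_ : #|xpredT : pred 'I_n| = n) ?card_ord // => h2; nia.
Qed.

Lemma sizeY_leP (R : realType) n (u : {poly {poly R}}) :
  (sizeY u <= n)%N <-> forall i, (size (u`_i)%R <= n)%N.
Proof.
split=> [h i|h]; first exact: leq_trans (max_size_coefXY u i) h.
by apply/bigmax_leqP => i _.
Qed.

(** The resultant is a determinant of order at most 2k with entries of degree at most k. If [Q] does
    not involve y, it is its own eliminant. *)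
Lemma irr_elim (R : realType) (k : nat) (P Q : {poly {poly R}}) :
  irr P -> (1 < size P)%N -> Q != 0 -> ((size Q < size P) || (sizeY Q < sizeY P))%N ->
  bideg k P -> bideg k Q ->
  exists r : {poly R}, [/\ r != 0, (size r <= (2 * k * k).+1)%N &
    forall x y, ev P x y = 0 -> ev Q x y = 0 -> r.[x] = 0].
Proof.
move=> iP P1 Q0 sPQ /andP[Pk /sizeY_leP PYk] /andP[Qk /sizeY_leP QYk].
have [Q1|Q1] := leqP (size Q) 1.
  exists Q`_0; split.
  - by apply: contraNneq Q0 => Q0; rewrite (size1_polyC Q1) Q0.
  - by apply: (leq_trans (QYk 0%N)); rewrite ltnS; nia.
  - by move=> x y _; rewrite (size1_polyC Q1) evC coefC.
exists (resultant P Q); split; first exact: irr_resultant.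
- have H : forall i j, (size (Sylvester_mx P Q i j) <= k.+1)%N.
    move=> i j; rewrite Sylvester_mxE; have bn (b : bool) (p : {poly R}) :
        (size p <= k.+1)%N -> (size (p *+ b) <= k.+1)%N by case: b => //; rewrite size_poly0.
    by case: (fintype.split i) => l; apply: bn.
  apply: (leq_trans (size_det_leq H)); rewrite ltnS leq_mul2r; apply/orP; right.
  by rewrite mul2n -addnn; apply: leq_add; rewrite -subn1 leq_subLR add1n; [exact: Qk|exact: Pk].
have [[u v] /= _ e] := resultant_in_ideal P1 Q1.
move=> x y P0 Q0'; have : ev (resultant P Q)%:P x y = 0 by rewrite e evD !evM P0 Q0' !mulr0 addr0.
by rewrite evC.
Qed.

Lemma root_list (R : realType) (r : {poly R}) : r != 0 ->
  exists s : seq R, (size s < size r)%N /\ forall x, r.[x] = 0 -> x \in s.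
Proof.
have [n] := ubnP (size r); elim: n r => // n IH r rn r0.
have [[x0 /rootP /factor_theorem[q qr]]|H] := pselect (exists x, r.[x] = 0); last first.
  exists [::]; rewrite size_poly_gt0; split=> // x rx; by case: H; exists x.
have q0 : q != 0 by apply: contraNneq r0 => q0; rewrite qr q0 mul0r.
have sr : size r = (size q).+1 by rewrite qr size_mul ?polyXsubC_eq0 // size_XsubC addn2.
have [|s [ss hs]] := IH q _ q0; first by rewrite -ltnS -sr.
exists (x0 :: s); split; first by rewrite sr /= ltnS.
move=> x; rewrite qr hornerM hornerXsubC inE => /eqP; rewrite mulf_eq0 subr_eq0 => /orP[/eqP/hs -> //|->].
  by rewrite orbT.
by [].
Qed.

(** * Regular abscissas *)

Definition dX (R : realType) (f : {poly {poly R}}) := swapXY (swapXY f)^`().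

Lemma bideg_deriv (R : realType) k (f : {poly {poly R}}) : bideg k f -> bideg k f^`().
Proof.
move=> /andP[h1 /sizeY_leP h2]; apply/andP; split; first exact: leq_trans (size_deriv_leq (leqnSn _)) h1.
apply/sizeY_leP => i; rewrite coef_deriv -mulr_natr -polyC_natr mulrC mul_polyC.
exact: leq_trans (size_scale_leq _ _) (h2 _).
Qed.

Lemma bideg_derivn (R : realType) k (f : {poly {poly R}}) i : bideg k f -> bideg k f^`(i).
Proof. by move=> h; elim: i => // i IH; rewrite derivnS bideg_deriv. Qed.

Lemma bideg_swap (R : realType) k (f : {poly {poly R}}) : bideg k (swapXY f) = bideg k f.
Proof. by rewrite /bideg !sizeYE swapXYK andbC. Qed.

Lemma bideg_dX (R : realType) k (f : {poly {poly R}}) : bideg k f -> bideg k (dX f).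
Proof. by move=> h; rewrite bideg_swap bideg_deriv // bideg_swap. Qed.

Lemma derivn_neq0 (R : realType) (f : {poly {poly R}}) i : (i < size f)%N -> f^`(i) != 0.
Proof.
move=> h; apply/eqP => /(congr1 (fun g : {poly {poly R}} => g`_((size f).-1 - i))).
rewrite coef_derivn coef0 subnKC; last by rewrite -ltnS prednK // (leq_trans _ h).
apply/eqP; rewrite -mulr_natr mulf_eq0 negb_or -/(lead_coef f) lead_coef_eq0.
rewrite -size_poly_gt0 (leq_trans _ h) //= -polyC_natr polyC_eq0 pnatr_eq0 -lt0n ffact_gt0.
by rewrite -ltnS prednK // (leq_trans _ h).
Qed.

(** What makes branches behave near x: the leading coefficient keeps roots from escaping to
    infinity, the nonvanishing y-derivatives keep Thom codes locally constant, and the nonvanishing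
    x-derivative excludes turning points. [dX f = 0] is the case where the curve consists of
    horizontal lines. *)
Definition regular (R : realType) (f : {poly {poly R}}) (x : R) :=
  (lead_coef f).[x] != 0 /\ forall y, ev f x y = 0 ->
    (forall i, (0 < i < size f)%N -> ev f^`(i) x y != 0) /\ (dX f = 0 \/ ev (dX f) x y != 0).

(** The exceptional abscissas are the zeros of the leading coefficient and of the eliminants of [f]
    with its y-derivatives, which have smaller degree in y, and with [dX f], which has smaller
    degree in x: k + 2 lists in all. *)
Lemma irr_regular (R : realType) k (f : {poly {poly R}}) :
  irr f -> (1 < size f)%N -> bideg k f ->
  exists cr : seq R, (size cr <= (k + 2) * (2 * k * k + k).+1)%N /\ forall x, x \notin cr -> regular f x.
Proof.
move=> iP f1 kf; have f0 : f != 0 by case: iP.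
set B := (2 * k * k + k).+1.
have lc0 : lead_coef f != 0 by rewrite lead_coef_eq0.
have [s1 [h1 r1]] := root_list lc0.
have s1B : (size s1 <= B)%N.
  have := leq_trans h1 (max_size_lead_coefXY f); case/andP: kf => _ b; rewrite /B; lia.
have elim (Q : {poly {poly R}}) : Q != 0 -> bideg k Q -> ((size Q < size f) || (sizeY Q < sizeY f))%N ->
    exists s : seq R, (size s <= B)%N /\ forall x y, x \notin s -> ev f x y = 0 -> ev Q x y != 0.
  move=> Q0 kQ sQ; have [r [r0 sr hr]] := irr_elim iP f1 Q0 sQ kf kQ.
  have [s [ss hs]] := root_list r0; exists s; split; first by rewrite /B; lia.
  by move=> x y xs fxy; apply: contra xs => /eqP Qxy; apply/hs/(hr x y).
have [s2 [h2 r2]] : exists s : seq R, (size s <= k * B)%N /\ forall x y, x \notin s ->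
    ev f x y = 0 -> forall i, (0 < i <= k)%N -> (i < size f)%N -> ev f^`(i) x y != 0.
  elim: {1 2}k => [|j [s [ss hs]]].
    exists [::]; split => // x y _ _ i /andP[]; lia.
  have [js|js] := ltnP j.+1 (size f); last first.
    exists s; split; first by rewrite mulSn (leq_trans ss) // leq_addl.
    move=> x y xs fxy i ij isz; apply: hs => //; lia.
  have [||s' [ss' hs']] := elim f^`(j.+1) (derivn_neq0 js).
  - exact: bideg_derivn.
  - apply/orP; left; rewrite derivnS.
    have := lt_size_deriv (derivn_neq0 (ltnW js)); have : (size f^`(j) <= size f)%N; last lia.
    elim: (j) => // l; rewrite derivnS; apply: leq_trans; exact: size_deriv_leq (leqnSn _).
  exists (s' ++ s); split; first by rewrite size_cat mulSn leq_add.
  move=> x y; rewrite mem_cat negb_or => /andP[xs' xs] fxy i /andP[i0]; rewrite leq_eqVlt => /orP[/eqP-> _|ij isz].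
    exact: hs'.
  by apply: hs => //; rewrite i0.
have [s3 [h3 r3]] : exists s : seq R, (size s <= B)%N /\ forall x y, x \notin s ->
    ev f x y = 0 -> dX f = 0 \/ ev (dX f) x y != 0.
  have [d0|d0] := eqVneq (dX f) 0; first by exists [::]; split => // x y _ _; left.
  have [||s [ss hs]] := elim _ d0; first exact: bideg_dX.
    apply/orP; right; rewrite !sizeYE swapXYK lt_size_deriv // swapXY_eq0 //.
  by exists s; split => // x y xs fxy; right; exact: hs.
exists (s1 ++ s2 ++ s3); split.
  rewrite !size_cat; rewrite mulnDl; lia.
move=> x; rewrite !mem_cat !negb_or => /and3P[x1 x2 x3]; split.
  by apply: contra x1 => /eqP; exact: r1.
move=> y fxy; split; last exact: r3.
move=> i /andP[i0 isz]; apply: (r2 _ _ x2 fxy) => //; rewrite i0 /=.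
by have /andP[b _] := kf; rewrite -ltnS (leq_trans isz b).
Qed.

(** Each irreducible factor is treated on its own, so crossings of different factors are not
    exceptional. A factor of degree 0 in y is a union of vertical lines and only contributes its
    roots to [cr]. *)
Lemma curve_structure (R : realType) (k : nat) :
  exists C : nat, forall P : {poly {poly R}}, P != 0 -> bideg k P ->
  exists (cr : seq R) (fs : seq {poly {poly R}}), [/\ (size cr <= C)%N, (size fs <= C)%N,
    forall f, f \in fs -> [/\ (1 < size f)%N, bideg k f & forall x, x \notin cr -> regular f x],
    forall x y, ev P x y = 0 -> x \in cr \/ exists2 f, f \in fs & ev f x y = 0 &
    forall f x y, f \in fs -> ev f x y = 0 -> ev P x y = 0].
Proof.
pose B := ((k + 2) * (2 * k * k + k).+1)%N.
exists ((k.+1 + k.+1) * B.+1)%N => P P0 kP.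
have [fs [sfs ifs Pfs]] := irr_factors P0 kP.
suff : exists (cr : seq R) (gs : seq {poly {poly R}}), [/\ (size cr <= size fs * B)%N,
    (size gs <= size fs)%N,
    forall f, f \in gs -> [/\ (1 < size f)%N, bideg k f & forall x, x \notin cr -> regular f x],
    forall x y, ev (\prod_(f <- fs) f) x y = 0 -> x \in cr \/ exists2 f, f \in gs & ev f x y = 0 &
    forall f x y, f \in gs -> ev f x y = 0 -> ev (\prod_(f <- fs) f) x y = 0].
  move=> [cr [gs [h1 h2 h3 h4 h5]]]; exists cr, gs; rewrite Pfs; split=> //.
    by apply: (leq_trans h1); apply: leq_mul.
  by apply: (leq_trans h2); rewrite (leq_trans sfs) // leq_pmulr.
elim: fs ifs {P P0 kP sfs Pfs} => [|f fs IH] ifs.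
  by exists [::], [::]; split => // x y; rewrite big_nil -polyC1 evC hornerC => /eqP; rewrite oner_eq0.
have [|cr [gs [h1 h2 h3 h4 h5]]] := IH.
  by move=> g gfs; apply: ifs; rewrite inE gfs orbT.
have [iP kf] : irr f /\ bideg k f by apply: ifs; rewrite mem_head.
have [f1|f1] := leqP (size f) 1.
  have f00 : f`_0 != 0.
    by have [f0 _] := iP; apply: contraNneq f0 => f0; rewrite (size1_polyC f1) f0.
  have [s [ss hs]] := root_list f00.
  exists (s ++ cr), gs; split.
  - rewrite size_cat mulSn leq_add //; have /andP[_ /sizeY_leP/(_ 0%N)] := kf; rewrite /B; nia.
  - exact: leqW.
  - move=> g /h3[a b c]; split=> // x; rewrite mem_cat negb_or => /andP[_]; exact: c.
  - move=> x y; rewrite big_cons evM => /eqP; rewrite mulf_eq0 => /orP[/eqP|/eqP/h4[xc|[g]]].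
    + by rewrite (size1_polyC f1) evC => /hs xs; left; rewrite mem_cat xs.
    + by left; rewrite mem_cat xc orbT.
    + by move=> ggs gxy; right; exists g.
  - by move=> g x y ggs gxy; rewrite big_cons evM (h5 _ _ _ ggs gxy) mulr0.
have [s [ss hs]] := irr_regular iP f1 kf.
exists (s ++ cr), (f :: gs); split.
- by rewrite size_cat mulSn leq_add.
- by [].
- move=> g; rewrite inE => /orP[/eqP->|/h3[a b c]]; split => //.
    by move=> x; rewrite mem_cat negb_or => /andP[xs _]; exact: hs.
  by move=> x; rewrite mem_cat negb_or => /andP[_]; exact: c.
- move=> x y; rewrite big_cons evM => /eqP; rewrite mulf_eq0 => /orP[/eqP|/eqP/h4[xc|[g]]].
  + by move=> fxy; right; exists f => //; rewrite mem_head.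
  + by left; rewrite mem_cat xc orbT.
  + by move=> ggs gxy; right; exists g; rewrite // inE ggs orbT.
move=> g x y; rewrite inE big_cons evM => /orP[/eqP->->|ggs gxy]; first by rewrite mul0r.
by rewrite (h5 _ _ _ ggs gxy) mulr0.
Qed.

(** * Branches over an interval of regular abscissas *)

Lemma near_sign (R : realType) (p : {poly R}) (x0 : R) : p.[x0] != 0 ->
  \forall x \near x0, Num.sg p.[x] = Num.sg p.[x0].
Proof.
have cp : p.[x] @[x --> x0] --> p.[x0] by exact: continuous_horner.
case: (ltrgt0P p.[x0]) => // p0 _.
  apply: filterS (cvgr_gt _ cp _ p0) => x px; by rewrite !gtr0_sg.
apply: filterS (cvgr_lt _ cp _ p0) => x px; by rewrite !ltr0_sg.
Qed.

Lemma size_spec (R : realType) (f : {poly {poly R}}) x : (size (spec f x) <= size f)%N.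
Proof. exact: size_poly. Qed.

Lemma derivn_size0 (A : nzRingType) (q : {poly A}) i : (size q <= i)%N -> q^`(i) = 0.
Proof.
move=> h; apply/eqP; rewrite -size_poly_leq0; elim: i q h => [|i IH] q h //.
by rewrite derivSn IH // size_deriv_leq.
Qed.

Lemma eq_sign_code (R : realType) n (p q : {poly R}) (x y : R) :
  (forall i, (i < n)%N -> Num.sg p^`(i).[x] = Num.sg q^`(i).[y]) ->
  sign_code n p x = sign_code n q y.
Proof.
move=> h; apply/eq_in_map => i; rewrite mem_iota add0n => /andP[_]; exact: h.
Qed.

Lemma regular_deriv (R : realType) (f : {poly {poly R}}) (x y : R) i :
  regular f x -> ev f x y = 0 -> ev f^`(i.+1) x y != 0 \/ f^`(i.+1) = 0.
Proof.
move=> [_ h] /h[h1 _]; have [ltif|] := ltnP i.+1 (size f); first by left; exact: h1.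
by right; exact: derivn_size0.
Qed.

(* The signs of the [y]-derivatives at the two ends of a short vertical segment around the root
   persist for nearby [x]; the intermediate value theorem gives a root, Thom's lemma its code. *)
Lemma branch_local (R : realType) k (f : {poly {poly R}}) (x0 y0 e : R) :
  bideg k f -> (1 < size f)%N -> regular f x0 -> ev f x0 y0 = 0 -> 0 < e ->
  \forall x \near x0, exists y, `|y - y0| <= e /\
    sign_code k.+1 (spec f x) y = sign_code k.+1 (spec f x0) y0.
Proof.
move=> /andP[fk _] f1 reg0 fxy0 e0; set q := spec f x0.
have q0 : q.[y0] = 0 by rewrite spec_horner.
have qd i y : q^`(i).[y] = ev f^`(i) x0 y by rewrite spec_derivn spec_horner.
have : \forall t \near y0, forall i : 'I_k, Num.sg q^`(i.+1).[t] = Num.sg q^`(i.+1).[y0].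
  apply: (filter_forall (nbhs_filter y0)) => i; have [h|h] := regular_deriv i reg0 fxy0.
    by apply: near_sign; rewrite qd.
  by near=> t; rewrite !qd h /ev !horner0.
move=> /nbhs_ballP[d /= d0 hd].
pose c := Num.min e (d / 2); have c0 : 0 < c by rewrite lt_min e0 divr_gt0.
have cd : c < d by rewrite gt_min; apply/orP; right; lra.
have ce : c <= e by rewrite ge_min lexx.
have sg_in t i : y0 - c <= t <= y0 + c -> (i < k)%N -> Num.sg q^`(i.+1).[t] = Num.sg q^`(i.+1).[y0].
  move=> /andP[t1 t2] ik; apply: (hd t _ (Ordinal ik)) => /=.
  by rewrite /ball /= distrC ltr_norml; apply/andP; split; lra.
have k0 : (0 < k)%N by rewrite -ltnS (leq_trans f1).
have q'0 : q^`().[y0] != 0.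
  have := qd 1%N y0; rewrite derivn1 => ->.
  by have [_ /(_ _ fxy0)[h _]] := reg0; apply: h.
have sgb : Num.sg q.[y0 + c] = Num.sg q^`().[y0].
  have lt : y0 < y0 + c by rewrite ltrDl.
  have [t] := poly_mvt q lt; rewrite in_itv /= => /andP[t1 t2].
  rewrite q0 subr0 addrAC subrr add0r => ->; rewrite sgrM (gtr0_sg c0) mulr1.
  by have := sg_in t 0%N _ k0; rewrite derivn1 => -> //; apply/andP; split; lra.
have sga : Num.sg q.[y0 - c] = - Num.sg q^`().[y0].
  have lt : y0 - c < y0 by rewrite ltrBlDr ltrDl.
  have [t] := poly_mvt q lt; rewrite in_itv /= => /andP[t1 t2].
  rewrite q0 sub0r opprB addrCA subrr addr0 => /(canRL (@opprK _)) ->.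
  rewrite sgrN sgrM (gtr0_sg c0) mulr1.
  by have := sg_in t 0%N _ k0; rewrite derivn1 => -> //; apply/andP; split; lra.
have near_i t i : y0 - c <= t <= y0 + c -> (i < k)%N ->
    \forall x \near x0, Num.sg (spec f x)^`(i.+1).[t] = Num.sg q^`(i.+1).[y0].
  move=> tc ik; rewrite -(sg_in t) // qd; have [h|h] := regular_deriv i reg0 fxy0.
    have h' : ev f^`(i.+1) x0 t != 0.
      by rewrite -qd -sgr_eq0 sg_in // sgr_eq0 qd.
    apply: filterS (near_sign h') => x; by rewrite spec_derivn spec_horner.
  near=> x; by rewrite spec_derivn spec_horner h /ev !horner0.
have inab : (y0 - c <= y0 - c <= y0 + c) /\ (y0 - c <= y0 + c <= y0 + c).
  by split; apply/andP; split; lra.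
have near_all t : y0 - c <= t <= y0 + c -> \forall x \near x0,
    forall i : 'I_k, Num.sg (spec f x)^`(i.+1).[t] = Num.sg q^`(i.+1).[y0].
  by move=> tc; apply: (filter_forall (nbhs_filter x0)) => i; apply: near_i.
have near0 t : q.[t] != 0 -> \forall x \near x0, Num.sg (spec f x).[t] = Num.sg q.[t].
  rewrite /q spec_horner => qt; apply: filterS (near_sign qt) => x.
  by rewrite spec_horner.
have qa0 : q.[y0 - c] != 0 by rewrite -sgr_eq0 sga oppr_eq0 sgr_eq0.
have qb0 : q.[y0 + c] != 0 by rewrite -sgr_eq0 sgb sgr_eq0.
have := near_all _ inab.1; have := near_all _ inab.2; have := near0 _ qa0; have := near0 _ qb0.
move=> N1 N2 N3 N4; near=> x.
have hb : Num.sg (spec f x).[y0 + c] = Num.sg q.[y0 + c] by near: x.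
have ha : Num.sg (spec f x).[y0 - c] = Num.sg q.[y0 - c] by near: x.
have db : forall i : 'I_k, Num.sg (spec f x)^`(i.+1).[y0 + c] = Num.sg q^`(i.+1).[y0] by near: x.
have da : forall i : 'I_k, Num.sg (spec f x)^`(i.+1).[y0 - c] = Num.sg q^`(i.+1).[y0] by near: x.
have ab : y0 - c <= y0 + c by lra.
have : (spec f x).[y0 - c] * (spec f x).[y0 + c] < 0.
  rewrite -sgr_lt0 sgrM ha hb sga sgb mulNr oppr_lt0 -expr2 exprn_even_gt0 // sgr_eq0 //.
move=> /(poly_ivtoo ab)[y]; rewrite in_itv /= => /andP[y1 y2] /rootP fy.
exists y; split; first by rewrite ler_norml; apply/andP; split; lra.
rewrite !sign_codeS fy q0; congr (_ :: _).
have ca : sign_code k (spec f x)^`() (y0 - c) = sign_code k q^`() y0.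
  by apply: eq_sign_code => i ik; have := da (Ordinal ik); rewrite !derivSn.
have cb : sign_code k (spec f x)^`() (y0 + c) = sign_code k q^`() y0.
  by apply: eq_sign_code => i ik; have := db (Ordinal ik); rewrite !derivSn.
rewrite -ca; apply: (thom _ ab); last by rewrite ltW // ltW.
  by rewrite size_deriv_leq // (leq_trans (size_spec _ _)).
by rewrite ca cb.
Unshelve. all: by end_near.
Qed.

Lemma ev_continuous (R : realType) (P : {poly {poly R}}) :
  continuous (fun p : R * R => ev P p.1 p.2).
Proof.
elim/poly_ind: P => [|P c IH] p.
  rewrite (_ : (fun p => _) = cst 0); first exact: cvg_cst.
  by apply/funext => t; rewrite /ev !horner0.
rewrite (_ : (fun p => _) = fun p : R * R => ev P p.1 p.2 * p.2 + c.[p.1]); last first.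
  by apply/funext => t; rewrite evD evM evC /ev hornerX hornerC.
apply: cvgD; first by apply: cvgM; [exact: IH|exact: cvg_snd].
by apply: (@cvg_comp _ _ _ fst (horner c)); [exact: cvg_fst|exact: continuous_horner].
Qed.

(** Cauchy's bound, uniform in x because the leading coefficient stays away from 0 on the compact
    interval. It provides the compactness in [branch_extend]. *)
Lemma root_bound (R : realType) (f : {poly {poly R}}) (a b : R) : a <= b ->
  (forall x, a <= x <= b -> (lead_coef f).[x] != 0) ->
  exists B : R, forall x y, a <= x <= b -> ev f x y = 0 -> `|y| <= B.
Proof.
move=> ab lc.
have [|m mab hm] := @EVT_min R (fun x => `|(lead_coef f).[x]|) a b ab.
  apply: continuous_in_subspaceT => x _.
  by apply: (@cvg_comp _ _ _ (horner (lead_coef f)) (fun y : R => `|y|)); 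
    [exact: continuous_horner|exact: cvg_norm].
pose c : R := Num.max `|a| `|b|.
pose M i : R := sval (poly_disk_bound f`_i c).
have hM i x : a <= x <= b -> `|(f`_i).[x]| <= M i.
  move=> /andP[ax xb]; rewrite /M; case: (poly_disk_bound _ _) => u /= hu; apply: hu.
  rewrite /c le_max; have [x0|x0] := lerP 0 x; apply/orP; [right|left].
    by rewrite !ger0_norm // (le_trans x0).
  by rewrite !ler0_norm ?lerN2 // ltW // (le_lt_trans ax).
have m0 : 0 < `|(lead_coef f).[m]| by rewrite normr_gt0 lc.
exists (1 + `|(lead_coef f).[m]|^-1 * \sum_(i < size f) M i) => x y xab fxy.
have e0 : horner_eval x (lead_coef f) != 0 by exact: lc.
have szE : size (spec f x) = size f by exact: size_map_poly_id0.
have lcE : lead_coef (spec f x) = (lead_coef f).[x] by exact: lead_coef_map_eq.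
have sp0 : spec f x != 0 by rewrite -lead_coef_eq0 lcE lc.
apply: (le_trans (ltW (cauchy_boundP sp0 (etrans (spec_horner _ _ _) fxy)))).
rewrite /cauchy_bound szE lcE lerD2l; apply: ler_pM; rewrite ?invr_ge0 ?sumr_ge0 //.
  by rewrite lef_pV2 ?posrE ?normr_gt0 ?lc //; apply: hm; rewrite in_itv.
by apply: ler_sum => i _; rewrite coef_map; exact: hM.
Qed.

(* The set of [x] over which there is a root with the given code is open by [branch_local], and
   closed as the projection of a compact set. *)
Lemma branch_extend (R : realType) k (f : {poly {poly R}}) (a b x0 x1 y0 : R) :
  bideg k f -> (1 < size f)%N -> (forall x, a <= x <= b -> regular f x) ->
  a <= x0 <= b -> a <= x1 <= b -> ev f x0 y0 = 0 ->
  exists y1, sign_code k.+1 (spec f x1) y1 = sign_code k.+1 (spec f x0) y0.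
Proof.
move=> fk f1 reg x0ab x1ab fxy0; set s := sign_code k.+1 (spec f x0) y0.
have s0 : nth 0 s 0 = 0 by rewrite sign_code_nth // spec_horner fxy0 sgr0.
have root_s x y : sign_code k.+1 (spec f x) y = s -> ev f x y = 0.
  move=> e; have := sign_code_nth (spec f x) y (ltn0Sn k); rewrite e s0 /= spec_horner.
  by move=> /esym/eqP; rewrite sgr_eq0 => /eqP.
pose E := [set x | a <= x <= b /\ exists y, sign_code k.+1 (spec f x) y = s].
have -> : (exists y1, sign_code k.+1 (spec f x1) y1 = s) = E x1.
  by apply/propext; split => [h|[]].
have ab : a <= b by case/andP: x0ab => h1 h2; exact: le_trans h1 h2.
suff -> : E = `[a, b]%classic by rewrite /= in_itv.
apply: (@segment_connected R a b E).
- by exists x0; split => //; exists y0.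
- exists (interior [set x | exists y, sign_code k.+1 (spec f x) y = s]); first exact: open_interior.
  apply/seteqP; split => x.
    move=> [xab [y sy]]; split; first by rewrite /= in_itv.
    apply: filterS (branch_local fk f1 (reg x xab) (root_s _ _ sy) ltr01) => t [u [_ hu]].
    by exists u; rewrite hu sy.
  by move=> [] /=; rewrite in_itv /= => xab /interior_subset h; split.
have [|B hB] := @root_bound R f a b ab; first by move=> x /reg[].
(* The sign conditions are relaxed to weak inequalities, which are closed; at a root over a regular
   abscissa a derivative is nonzero or identically zero, so the exact code is recovered. *)
pose K := (`[a, b]%classic `*` `[- B, B]%classic) `&`
   [set p : R * R | ev f p.1 p.2 = 0 /\ forall i : 'I_k, 0 <= nth 0 s i.+1 * ev f^`(i.+1) p.1 p.2].
exists (fst @` K).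
  apply: compact_closed; first exact: Rhausdorff.
  apply: continuous_compact; first by apply: continuous_subspaceT => p; exact: cvg_fst.
  apply: compact_closedI; first by apply: compact_setX; exact: segment_compact.
  have -> : [set p : R * R | ev f p.1 p.2 = 0 /\ forall i : 'I_k, 0 <= nth 0 s i.+1 * ev f^`(i.+1) p.1 p.2]
    = (fun p => ev f p.1 p.2) @^-1` [set 0] `&`
      \bigcap_(i : 'I_k) (fun p => nth 0 s i.+1 * ev f^`(i.+1) p.1 p.2) @^-1` [set x | 0 <= x].
    by apply/seteqP; split => p /= [h1 h2]; split => // i; [move=> _; exact: h2|exact: h2].
  apply: closedI.
    by apply: closed_comp; [move=> p _; exact: ev_continuous|exact: closed_eq].
  apply: closed_bigI => i _; apply: closed_comp; last exact: closed_ge.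
  move=> p _; apply: cvgM; [exact: cvg_cst|exact: ev_continuous].
apply/seteqP; split => x.
  move=> [xab [y sy]]; split; first by rewrite /= in_itv.
  exists (x, y) => //; split.
    split => /=; rewrite in_itv //=.
    by rewrite -ler_norml (hB x) // root_s.
  split; first by rewrite /= root_s.
  move=> i; rewrite -sy sign_code_nth ?ltnS ?ltn_ord // spec_derivn spec_horner [ev _ (_, _).1 _]/=.
  by rewrite -normrEsg.
move=> [xab [[x' y] /= [[_ _] [fxy sgn]] xx']]; move: fxy sgn; rewrite {}xx' => fxy sgn.
rewrite /= in_itv /= in xab; split => //; exists y.
rewrite /s !sign_codeS !spec_horner fxy fxy0; congr (_ :: _); apply: eq_sign_code => i ik.
rewrite -!derivSn.
have : 0 <= nth 0 s i.+1 * ev f^`(i.+1) x y by exact: (sgn (Ordinal ik)).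
rewrite /s sign_code_nth //.
rewrite !spec_derivn !spec_horner.
have [h|->] := regular_deriv i (reg _ xab) fxy; last by rewrite /ev !horner0.
have [h'|f0] := regular_deriv i (reg _ x0ab) fxy0; last by rewrite f0 /ev !horner0.
move: h h'; set u := ev _ x y; set v := ev _ x0 y0.
by case: (ltrgt0P u) => // u0 _; case: (ltrgt0P v) => // v0 _;
  rewrite ?(gtr0_sg u0) ?(ltr0_sg u0) ?(gtr0_sg v0) ?(ltr0_sg v0) // ?mul1r ?mulN1r ?oppr_ge0 => h; exfalso; lra.
Qed.

Lemma ev_dX (R : realType) (f : {poly {poly R}}) x y : ev (dX f) x y = (f.[y%:P])^`().[x].
Proof.
rewrite ev_swapXY -spec_horner -derivn1 -(spec_derivn _ _ 1) derivn1 /spec -horner_swapXY swapXYK //.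
Qed.

Definition monotone_on (R : realType) (al be : R) (phi : R -> R) :=
  (forall x y, al < x -> x <= y -> y < be -> phi x <= phi y) \/
  (forall x y, al < x -> x <= y -> y < be -> phi y <= phi x).

(* [phi] selects, over the open interval ]al, be[, the root of [f] with Thom code [s]. *)
Definition branch (R : realType) (k : nat) (f : {poly {poly R}}) (s : seq R) (al be : R)
    (phi : R -> R) :=
  [/\ bideg k f, nth 0 s 0 = 0, nth 0 s 1 != 0,
    forall x, al < x < be -> sign_code k.+1 (spec f x) (phi x) = s &
    monotone_on al be phi].

Lemma branch_ev (R : realType) k (f : {poly {poly R}}) s al be phi x :
  branch k f s al be phi -> al < x < be -> ev f x (phi x) = 0.
Proof.
move=> [_ s0 _ h _] /h e; have := sign_code_nth (spec f x) (phi x) (ltn0Sn k).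
by rewrite e s0 /= spec_horner => /esym/eqP; rewrite sgr_eq0 => /eqP.
Qed.

Lemma sign_code_unique (R : realType) k (f : {poly {poly R}}) x y y' :
  bideg k f -> ev f x y = 0 -> ev f^`() x y != 0 ->
  sign_code k.+1 (spec f x) y = sign_code k.+1 (spec f x) y' -> y = y'.
Proof.
move=> /andP[fk _] h1 h2; apply: code_root_eq.
- exact: leq_trans (size_spec _ _) fk.
- by rewrite spec_horner.
- by rewrite -derivn1 spec_derivn spec_horner.
Qed.

(** Let p(x) = f(x, y0) with y0 the extremal height. By Thom's lemma the y-derivative has constant
    sign between [phi x] and y0, so the side on which the root lies determines the sign of p(x).
    Hence p has a local extremum at x0, and its derivative there is the x-derivative of [f]. *)
Lemma local_extremum_dX (R : realType) k (f : {poly {poly R}}) (a b x0 : R) (phi : R -> R) :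
  bideg k f -> (1 < size f)%N -> a < x0 < b -> regular f x0 ->
  (forall x, a < x < b -> ev f x (phi x) = 0 /\
     sign_code k.+1 (spec f x) (phi x) = sign_code k.+1 (spec f x0) (phi x0)) ->
  (forall x, a < x < b -> phi x <= phi x0) \/ (forall x, a < x < b -> phi x0 <= phi x) ->
  ev (dX f) x0 (phi x0) = 0.
Proof.
move=> fk f1 /andP[ax0 x0b] reg h ext.
have fxy0 : ev f x0 (phi x0) = 0 by apply: (h _ _).1; rewrite ax0.
set y0 := phi x0 in fxy0 h ext *; set p := f.[y0%:P].
have px x : p.[x] = (spec f x).[y0] by rewrite spec_horner.
have : \forall x \near x0, forall i : 'I_k,
    Num.sg (spec f x)^`(i.+1).[y0] = Num.sg (spec f x0)^`(i.+1).[y0].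
  apply: (filter_forall (nbhs_filter x0)) => i; have [hi|hi] := regular_deriv i reg fxy0.
    by apply: filterS (near_sign hi) => x; rewrite !spec_derivn !spec_horner.
  by near=> x; rewrite !spec_derivn !spec_horner hi /ev !horner0.
move=> /nbhs_ballP[d /= d0 hd].
pose a' := Num.max a (x0 - d); pose b' := Num.min b (x0 + d).
have ab' x : a' < x < b' -> a < x < b /\ ball x0 d x.
  rewrite /a' /b' lt_min gt_max => /andP[/andP[h1 h2] /andP[h3 h4]]; split; first by rewrite h1.
  by rewrite /ball /= distrC ltr_norml; apply/andP; split; lra.
have x0ab' : x0 \in `]a', b'[.
  by rewrite in_itv /= /a' /b' lt_min gt_max ax0 x0b /=; apply/andP; split; lra.
have sgn x z : a' < x < b' -> (z = phi x) -> forall u v, u <= v ->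
    (u = z /\ v = y0) \/ (u = y0 /\ v = z) ->
    forall t, u <= t <= v -> Num.sg (spec f x)^`().[t] = Num.sg (spec f x)^`().[u].
  move=> /ab'[xab xd] -> u v uv uvz t tuv; apply: (@code_deriv_const _ k _ u v) => //.
    by have /andP[h1 _] := fk; exact: leq_trans (size_spec _ _) h1.
  have [_] := h x xab; rewrite !sign_codeS => -[_ cx].
  have cy : sign_code k (spec f x)^`() y0 = sign_code k (spec f x0)^`() y0.
    by apply: eq_sign_code => i ik; rewrite -!derivSn; exact: (hd x xd (Ordinal ik)).
  by case: uvz => -[-> ->]; rewrite cx cy.
have deriv0 : ev f^`() x0 y0 != 0.
  by have [_ /(_ _ fxy0)[+ _]] := reg; move=> /(_ 1%N); rewrite derivn1; apply.
have near_sgn x : a' < x < b' -> Num.sg (spec f x)^`().[y0] = Num.sg (ev f^`() x0 y0).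
  move=> /ab'[_ xd]; have k0 : (0 < k)%N by have /andP[h1 _] := fk; rewrite -ltnS (leq_trans f1).
  rewrite -(derivn1 f) -spec_horner -spec_derivn derivn1; exact: (hd x xd (Ordinal k0)).
have phi0 x : a' < x < b' -> (spec f x).[phi x] = 0.
  by move=> /ab'[xab _]; rewrite spec_horner; exact: (h x xab).1.
have cmp x : a' < x < b' -> phi x <= y0 ->
    (0 <= ev f^`() x0 y0 -> 0 <= p.[x]) /\ (ev f^`() x0 y0 <= 0 -> p.[x] <= 0).
  move=> xab' le; have hs := sgn x _ xab' erefl _ _ le (or_introl (conj erefl erefl)).
  have [A B] := sign_deriv_homo le hs (lexx _) le (lexx _).
  have e : Num.sg (spec f x)^`().[phi x] = Num.sg (ev f^`() x0 y0).
    by rewrite -(near_sgn x) // (hs y0) // le lexx.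
  by rewrite e !sgr_ge0 !sgr_le0 phi0 // -px in A B.
have cmp' x : a' < x < b' -> y0 <= phi x ->
    (0 <= ev f^`() x0 y0 -> p.[x] <= 0) /\ (ev f^`() x0 y0 <= 0 -> 0 <= p.[x]).
  move=> xab' le; have hs := sgn x _ xab' erefl _ _ le (or_intror (conj erefl erefl)).
  have [A B] := sign_deriv_homo le hs (lexx _) le (lexx _).
  by rewrite near_sgn // !sgr_ge0 !sgr_le0 phi0 // -px in A B.
have p0 : p.[x0] = 0 by [].
have drv t : t \in `]a', b'[ -> derivable (horner p) t 1 by move=> _; exact: derivable_horner.
have ab'le : a' <= b' by move: x0ab'; rewrite in_itv /= => /andP[u v]; exact: ltW (lt_trans u v).
rewrite ev_dX -/p.
suff H : is_derive x0 1 (horner p) 0.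
  have := is_derive_poly p x0; case: H => _ H [_ <-]; exact: H.
have [pos|neg] := lerP 0 (ev f^`() x0 y0); case: ext => ext.
- apply: (derive1_at_min ab'le drv x0ab') => t; rewrite in_itv /= => tab; rewrite p0.
  by apply: (cmp t tab _).1 => //; apply: ext; have [] := ab' _ tab.
- apply: (derive1_at_max ab'le drv x0ab') => t; rewrite in_itv /= => tab; rewrite p0.
  by apply: (cmp' t tab _).1 => //; apply: ext; have [] := ab' _ tab.
- apply: (derive1_at_max ab'le drv x0ab') => t; rewrite in_itv /= => tab; rewrite p0.
  by apply: (cmp t tab _).2 => //; [apply: ext; have [] := ab' _ tab|exact: ltW].
- apply: (derive1_at_min ab'le drv x0ab') => t; rewrite in_itv /= => tab; rewrite p0.
  by apply: (cmp' t tab _).2 => //; [apply: ext; have [] := ab' _ tab|exact: ltW].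
Unshelve. all: by end_near.
Qed.

Lemma dX0_spec (R : realType) (f : {poly {poly R}}) x x' : dX f = 0 -> spec f x = spec f x'.
Proof.
move=> d0; apply/polyP => i; rewrite !coef_map /=.
have h j : (0 < j)%N -> (f`_i)`_j = 0.
  case: j => // j _; have : (dX f)`_i`_j = 0 by rewrite d0 !coef0.
  rewrite /dX coef_swapXY coef_deriv coefMn coef_swapXY => /eqP.
  by rewrite mulrn_eq0 /= => /eqP.
suff -> : f`_i = ((f`_i)`_0)%:P by rewrite /horner_eval !hornerC.
by apply/polyP => -[|j]; rewrite coefC //= h.
Qed.

(** The root with the given code exists over the whole interval and is unique, and [branch_local]
    makes it continuous. It is injective unless [dX f = 0]: two equal values would produce an
    interior extremum, where [dX f] vanishes. A continuous injective function on an interval is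
    monotone. *)
Lemma branch_exists (R : realType) k (f : {poly {poly R}}) (al be x0 y0 : R) :
  bideg k f -> (1 < size f)%N -> (forall x, al < x < be -> regular f x) ->
  al < x0 < be -> ev f x0 y0 = 0 ->
  exists phi : R -> R, [/\ branch k f (sign_code k.+1 (spec f x0) y0) al be phi, phi x0 = y0 &
    forall x, al < x < be -> {for x, continuous phi}].
Proof.
move=> fk f1 reg x0I fxy0; set s := sign_code k.+1 (spec f x0) y0.
have ex x : exists y, al < x < be -> sign_code k.+1 (spec f x) y = s.
  have [xI|nxI] := boolP (al < x < be); last by exists 0.
  have [||||y hy] := @branch_extend R k f (Num.min x x0) (Num.max x x0) x0 x y0 fk f1.
  - move=> t /andP[t1 t2]; apply: reg; move/andP: xI => [? ?]; move/andP: x0I => [? ?].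
    by rewrite (lt_le_trans _ t1) ?(le_lt_trans t2) // ?lt_min ?gt_max; apply/andP.
  - by rewrite ge_min le_max lexx !orbT.
  - by rewrite ge_min le_max lexx.
  - exact: fxy0.
  by exists y.
have [phi hphi] := choice ex.
have der x y : al < x < be -> ev f x y = 0 -> ev f^`() x y != 0.
  move=> xI fxy; have [_ /(_ _ fxy)[+ _]] := reg x xI.
  by move=> /(_ 1%N); rewrite derivn1; apply.
have k0 : (0 < k)%N by have /andP[h1 _] := fk; rewrite -ltnS (leq_trans f1).
have s0 : nth 0 s 0 = 0 by rewrite sign_code_nth // spec_horner fxy0 sgr0.
have s1 : nth 0 s 1 != 0.
  by rewrite sign_code_nth // spec_derivn spec_horner derivn1 sgr_eq0 der.
have root x : al < x < be -> ev f x (phi x) = 0.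
  move=> xI; have := sign_code_nth (spec f x) (phi x) (ltn0Sn k).
  by rewrite hphi // s0 /= spec_horner => /esym/eqP; rewrite sgr_eq0 => /eqP.
have uniq x y : al < x < be -> sign_code k.+1 (spec f x) y = s -> phi x = y.
  move=> xI hy; apply: (@sign_code_unique _ k f x) => //; [exact: root|exact/der/root|].
  by rewrite hphi.
have cont x : al < x < be -> {for x, continuous phi}.
  move=> xI; apply/cvgrPdist_le => e e0; near=> t.
  have tI : al < t < be.
    near: t; have xI' : x \in `]al, be[ by rewrite in_itv.
    by apply: filterS (near_in_itvoo xI') => t; rewrite in_itv.
  have : exists y, `|y - phi x| <= e /\ sign_code k.+1 (spec f t) y = sign_code k.+1 (spec f x) (phi x).
    by near: t; apply: branch_local => //; [exact: reg|exact: root].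
  by move=> [y [ye]]; rewrite hphi // => /(uniq _ _ tI) ->; rewrite distrC.
exists phi; split => //; last exact: uniq.
split => //.
have [d0|d0] := eqVneq (dX f) 0.
  have cst x : al < x < be -> phi x = y0.
    by move=> xI; apply: uniq => //; rewrite (dX0_spec x x0 d0).
  by left => x y x1 xy y2; rewrite !cst ?(lt_le_trans x1) ?x1 ?(le_lt_trans xy).
have dXn x : al < x < be -> ev (dX f) x (phi x) != 0.
  move=> xI; have [_ /(_ _ (root x xI))[_ []]] := reg x xI => // d00.
  by rewrite d00 eqxx in d0.
have inj x1 x2 : al < x1 -> x1 < x2 -> x2 < be -> phi x1 = phi x2 -> False.
  move=> a1 x12 b2 e12.
  have sub t : x1 <= t <= x2 -> al < t < be.
    by move=> /andP[u v]; rewrite (lt_le_trans a1) //= (le_lt_trans v).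
  have cw : {within `[x1, x2], continuous phi}.
    by apply: continuous_in_subspaceT => t; rewrite inE /= in_itv /= => /sub/cont.
  have nointer c : x1 < c < x2 -> (forall x, x1 < x < x2 -> phi x <= phi c) \/
      (forall x, x1 < x < x2 -> phi c <= phi x) -> False.
    move=> cI ext; have cI' : al < c < be by apply: sub; move/andP: cI => [? ?]; rewrite !ltW.
    have := dXn c cI'; rewrite (@local_extremum_dX _ k f x1 x2) ?eqxx //; first exact: reg.
    move=> x xI; have xI' : al < x < be by apply: sub; move/andP: xI => [? ?]; rewrite !ltW.
    by rewrite !hphi // root.
  have [c1 c1I max] := EVT_max (ltW x12) cw; have [c2 c2I min] := EVT_min (ltW x12) cw.
  rewrite !in_itv /= in c1I c2I.
  have inI x : x1 < x < x2 -> x \in `[x1, x2] by move=> /andP[? ?]; rewrite in_itv /= !ltW.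
  have [c1n|] := boolP (x1 < c1 < x2).
    by apply: (nointer c1 c1n); left => x /inI/max.
  have [c2n|] := boolP (x1 < c2 < x2).
    by move=> _; apply: (nointer c2 c2n); right => x /inI/min.
  (* If both extrema sit at the ends, where the values agree, the function is constant, and any
     interior point is an extremum. *)
  have endp c : x1 <= c <= x2 -> ~~ (x1 < c < x2) -> phi c = phi x1.
    move=> /andP[u v]; rewrite negb_and -!leNgt => /orP[w|w].
      by have -> : c = x1 by apply/eqP; rewrite eq_le u w.
    by have -> : c = x2 by apply/eqP; rewrite eq_le v w.
  move=> /(endp _ c2I) m2 /(endp _ c1I) m1.
  have mI : x1 < (x1 + x2) / 2 < x2 by apply/andP; split; lra.
  apply: (nointer _ mI); left => x /inI xI; rewrite (le_trans (max _ xI)) // m1 -m2.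
  exact/min/inI.
have [|||] := @itv_continuous_inj_mono R phi `]al, be[.
- by apply: continuous_in_subspaceT => t; rewrite inE /= in_itv /= => /cont.
- move=> x y; rewrite !in_itv /= => /andP[x1 x2] /andP[y1 y2] e.
  have [xy|xy|//] := ltgtP x y; [by case: (inj x y)|by case: (inj y x)].
- move=> h; left => x y x1; rewrite le_eqVlt => /orP[/eqP-> //|xy] y2; apply: ltW; apply: h => //.
    by rewrite in_itv /= x1 (lt_trans xy).
  by rewrite in_itv /= y2 (lt_trans x1).
- move=> h; right => x y x1; rewrite le_eqVlt => /orP[/eqP-> //|xy] y2; apply: ltW; apply: h => //.
    by rewrite in_itv /= y2 (lt_trans x1).
  by rewrite in_itv /= x1 (lt_trans xy).
Unshelve. all: by end_near.
Qed.

(** * Sampling the branches *)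

Definition cell_cond (R : realType) (L n : nat) (al be : R) (phi : R -> R) (a b i : nat) : bool :=
  let x := i%:R / 2 ^+ L in
  [&& al < x, x < be, (i %/ 2 ^ (L - n))%N == a, b%:R <= 2 ^+ n * phi x & 2 ^+ n * phi x < b.+1%:R].

(* The horizontal extent, measured on the grid of mesh 2^-L, of the part of the graph of [phi] over
   ]al, be[ lying in the half-open dyadic square of level [n] and index [(a, b)]. *)
Definition cnt (R : realType) (L n : nat) (al be : R) (phi : R -> R) (a b : nat) : R :=
  #|[set i : 'I_(2 ^ L) | cell_cond L n al be phi a b i]%SET|%:R / 2 ^+ L.

Lemma cnt_ge0 (R : realType) (L n : nat) (al be : R) phi a b : 0 <= cnt L n al be phi a b.
Proof. by rewrite divr_ge0 // exprn_ge0. Qed.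

Lemma cell_cond_split (R : realType) (L n : nat) (al be : R) phi a b i : (n < L)%N ->
  (cell_cond L n al be phi a b i : nat) =
  (\sum_(e1 : bool) \sum_(e2 : bool) cell_cond L n.+1 al be phi (a.*2 + e1) (b.*2 + e2) i)%N.
Proof.
move=> nL; rewrite /cell_cond; set x := i%:R / 2 ^+ L; set t := 2 ^+ n * phi x.
have -> : 2 ^+ n.+1 * phi x = 2 * t by rewrite exprS mulrA.
set j := (i %/ 2 ^ (L - n.+1))%N.
have -> : (i %/ 2 ^ (L - n))%N = (j %/ 2)%N.
  by rewrite /j -divnMA -expnSr; congr (_ %/ 2 ^ _)%N; lia.
rewrite !big_bool /= !addn0 !addn1.
have -> : (j %/ 2 == a)%N = (j == a.*2.+1)%N || (j == a.*2)%N by lia.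
have dis : (j == a.*2.+1)%N -> (j == a.*2)%N -> False by lia.
have e0 : b%:R *+ 2 = b.*2%:R :> R by rewrite -mulr_natr -natrM muln2.
have e1 : b.*2.+1%:R = b%:R *+ 2 + 1 :> R by rewrite -natr1 e0.
have e2 : b.*2.+2%:R = b%:R *+ 2 + 2 :> R by rewrite -addn2 natrD e0.
have e3 : b.+1%:R = b%:R + 1 :> R by rewrite -natr1.
rewrite -e0 e1 e2 e3.
case: (al < x) (x < be) => [] [] //=.
case: (ltP (2 * t) (b%:R *+ 2 + 1)) => h1; case: (lerP (b%:R *+ 2) (2 * t)) => h2;
  case: (ltP (2 * t) (b%:R *+ 2 + 2)) => h3; case: (lerP b%:R t) => h4; case: (ltP t (b%:R + 1)) => h5;
  rewrite ?andbT ?andbF ?orbF //=; try (exfalso; lra);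
  by move: dis; case: (j == a.*2.+1)%N; case: (j == a.*2)%N => // /(_ isT isT).
Qed.

Lemma cnt_split (R : realType) (L n : nat) (al be : R) phi a b : (n < L)%N ->
  cnt L n al be phi a b =
  \sum_(e1 : bool) \sum_(e2 : bool) cnt L n.+1 al be phi (a.*2 + e1) (b.*2 + e2).
Proof.
move=> nL; rewrite /cnt.
have cardE m c d : #|[set i : 'I_(2 ^ L) | cell_cond L m al be phi c d i]%SET| =
    (\sum_(i < 2 ^ L) cell_cond L m al be phi c d i)%N.
  by rewrite -sum1_card big_mkcond /=; apply: eq_bigr => i _; rewrite inE; case: cell_cond.
rewrite cardE; under eq_bigr => i _ do rewrite (cell_cond_split _ _ _ _ _ _ nL).
rewrite !big_bool /= -!mulrDl -!natrD; congr (_%:R / _).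
rewrite !cardE -!big_split /=; apply: eq_bigr => i _; rewrite !big_bool //.
Qed.

Lemma cnt_le (R : realType) (L n : nat) (al be : R) phi a b : (n <= L)%N ->
  cnt L n al be phi a b <= (2 ^+ n)^-1.
Proof.
move=> nL; rewrite /cnt ler_pdivrMr ?exprn_gt0 // mulrC -expfB_cond ?pnatr_eq0 ?nL //.
rewrite -natrX ler_nat.
pose g (i : 'I_(2 ^ L)) : 'I_(2 ^ (L - n)) := Ordinal (ltn_pmod i (expn_gt0 2 (L - n))).
have ginj : {in [set i : 'I_(2 ^ L) | cell_cond L n al be phi a b i]%SET &, injective g}.
  move=> i j; rewrite !inE => /and5P[_ _ /eqP ia _ _] /and5P[_ _ /eqP ja _ _] /(congr1 val) /= e.
  by apply: val_inj; rewrite /= (divn_eq i (2 ^ (L - n))) (divn_eq j (2 ^ (L - n))) ia ja e.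
by rewrite -(card_in_imset ginj) -[leqRHS]card_ord max_card.
Qed.

(* The first of the coarse blocks meeting the (convex) set of sampled points is the only one whose
   left end may fail to be sampled. *)
Lemma cnt_refine (R : realType) (L L' n : nat) (al be : R) phi a b :
  monotone_on al be phi -> (n <= L)%N -> (L <= L')%N ->
  cnt L' n al be phi a b <= cnt L n al be phi a b + (2 ^+ L)^-1.
Proof.
move=> mono nL LL'; pose m := (L' - L)%N.
have E' : (2 ^ L' = 2 ^ L * 2 ^ m)%N by rewrite -expnD /m subnKC.
have blk (i : 'I_(2 ^ L')) : (i %/ 2 ^ m < 2 ^ L)%N.
  by rewrite ltn_divLR ?expn_gt0 // -E'.
pose bl i : 'I_(2 ^ L) := Ordinal (blk i).
pose C' : {set 'I_(2 ^ L')} := [set i : 'I_(2 ^ L') | cell_cond L' n al be phi a b i]%SET.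
pose C : {set 'I_(2 ^ L)} := [set i : 'I_(2 ^ L) | cell_cond L n al be phi a b i]%SET.
have key (i i' : 'I_(2 ^ L')) : i \in C' -> i' \in C' -> (bl i < bl i')%N -> bl i' \in C.
  rewrite !inE => /and5P[ai _ _ bi bi'] /and5P[_ i'b /eqP i'a ci ci'] lt.
  set x := i%:R / 2 ^+ L' in ai bi bi'; set x' := i'%:R / 2 ^+ L' in i'b ci ci'.
  pose y : R := (bl i')%:R / 2 ^+ L.
  have yE : y = (bl i' * 2 ^ m)%:R / 2 ^+ L'.
    have -> : (2 : R) ^+ L' = 2 ^+ L * 2 ^+ m by rewrite -exprD subnKC.
    rewrite /y natrM natrX invfM -mulrA; congr (_ * _).
    by rewrite mulrCA mulfV ?mulr1 // expf_neq0.
  have xy : x <= y.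
    rewrite yE /x ler_pM2r ?invr_gt0 ?exprn_gt0 // ler_nat.
    apply: leq_trans (ltnW (ltn_ceil i (expn_gt0 2 m))) _.
    by rewrite leq_mul2r; apply/orP; right.
  have yx' : y <= x'.
    by rewrite yE /x' ler_pM2r ?invr_gt0 ?exprn_gt0 // ler_nat leq_trunc_div.
  rewrite /cell_cond -/y (lt_le_trans ai xy) (le_lt_trans yx' i'b) /=.
  have -> /= : (bl i' %/ 2 ^ (L - n) == a)%N.
    by rewrite /= -divnMA -expnD -i'a; apply/eqP; congr (_ %/ 2 ^ _)%N; rewrite /m; lia.
  have p0 : 0 < 2 ^+ n :> R by rewrite exprn_gt0.
  case: mono => mono.
    have h1 := mono _ _ ai xy (le_lt_trans yx' i'b).
    have h2 := mono _ _ (lt_le_trans ai xy) yx' i'b.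
    by rewrite (le_trans bi) ?(le_lt_trans _ ci') // ler_pM2l.
  have h1 := mono _ _ ai xy (le_lt_trans yx' i'b).
  have h2 := mono _ _ (lt_le_trans ai xy) yx' i'b.
  by rewrite (le_trans ci) ?(le_lt_trans _ bi') // ler_pM2l.
have cT : (#|(bl @: C')%SET| <= #|C| + 1)%N.
  have [->|[i0 i0C]] := set_0Vmem C'; first by rewrite imset0 cards0.
  case: (arg_minnP (fun i : 'I_(2 ^ L') => bl i : nat) i0C) => i1 i1C min.
  apply: (@leq_trans #|(C :|: [set bl i1])%SET|).
    apply: fintype.subset_leq_card; apply/fintype.subsetP => j /imsetP[i iC ->]; rewrite !inE.
    have [->|ne] := eqVneq (bl i) (bl i1); first by rewrite orbT.
    have := key i1 i i1C iC; rewrite inE => -> //.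
    by rewrite ltn_neqAle min // andbT eq_sym.
  by rewrite (leq_trans (leq_card_setU _ _).1) ?cards1.
have cC : (#|C'| <= #|(bl @: C')%SET| * 2 ^ m)%N.
  pose g (i : 'I_(2 ^ L')) : 'I_(2 ^ L) * 'I_(2 ^ m) :=
    (bl i, Ordinal (ltn_pmod i (expn_gt0 2 m))).
  have ginj : injective g.
    move=> i j [] e1 e2; apply: val_inj.
    by rewrite /= (divn_eq i (2 ^ m)) (divn_eq j (2 ^ m)) e1 e2.
  rewrite -(card_imset _ ginj) -[X in (_ * X)%N]card_ord -cardsT -cardsX.
  apply: fintype.subset_leq_card; apply/fintype.subsetP => p /imsetP[i iC ->].
  by rewrite inE /= inE andbT imset_f.
rewrite /cnt -/C -/C' -[X in _ + X]mul1r -mulrDl.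
rewrite ler_pdivrMr ?exprn_gt0 //.
have -> : (2 : R) ^+ L' = 2 ^+ L * (2 ^ m)%:R by rewrite natrX -exprD subnKC.
rewrite mulrA divfK ?expf_neq0 // natr1 -natrM ler_nat (leq_trans cC) //.
by rewrite leq_mul2r; apply/orP; right; move: cT; rewrite addn1.
Qed.

Lemma threshold_up (N : nat) (p : nat -> bool) : (forall i j, (i <= j)%N -> p i -> p j) ->
  exists i0, (i0 <= N)%N /\ forall i, (i < N)%N -> p i = (i0 <= i)%N.
Proof.
move=> up; elim: N => [|N [i0 [i0N h]]]; first by exists 0%N.
have [pN|npN] := boolP (p N).
  exists i0; split; first exact: leqW.
  move=> i; rewrite ltnS leq_eqVlt => /orP[/eqP->|/h //]; by rewrite pN i0N.
exists N.+1; split => // i; rewrite ltnS => iN; rewrite leqNgt ltnS iN /=.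
by apply: contraNF npN; exact: up.
Qed.

(** The value of a y-derivative of [f] at a fixed point is a linear functional of the coefficients
    of [f], so [sign_vectors_card] bounds the number of sign patterns on a grid. *)
Definition coef_row (R : realType) (k : nat) (f : {poly {poly R}}) : 'rV[R]_(k.+1 * k.+1) :=
  mxvec (\matrix_(q < k.+1, p < k.+1) (f`_q)`_p).

Definition eval_col (R : realType) (k : nat) (x y : R) (l : nat) : 'cV[R]_(k.+1 * k.+1) :=
  (mxvec (\matrix_(q < k.+1, p < k.+1) (x ^+ p * ('X^q)^`(l).[y])))^T.

Lemma coef_row_eval (R : realType) (k : nat) (f : {poly {poly R}}) x y l : bideg k f ->
  (coef_row k f *m eval_col k x y l) 0 0 = ev f^`(l) x y.
Proof.
move=> /andP[fk /sizeY_leP fY].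
transitivity (\sum_(q < k.+1) \sum_(p < k.+1) (f`_q)`_p * (x ^+ p * ('X^q)^`(l).[y])).
  rewrite mxE (reindex _ (curry_mxvec_bij _ _)) pair_bigA; apply: eq_bigr => -[q p] _ /=.
  by rewrite [eval_col _ _ _ _ _ _]mxE !mxvecE !mxE.
rewrite -spec_horner -spec_derivn.
have -> : spec f x = \sum_(q < k.+1) (f`_q).[x] *: 'X^q.
  have sk := leq_trans (size_spec f x) fk.
  rewrite -(poly_def k.+1 (fun q => (f`_q).[x])); apply/polyP => i.
  rewrite coef_poly /spec coef_map /=; case: ltnP => // ik.
  by rewrite nth_default ?(leq_trans fk) // /horner_eval horner0.
rewrite linear_sum /= horner_sum; apply: eq_bigr => q _.
rewrite derivnZ hornerZ (horner_coef_wide _ (fY q)) mulr_suml; apply: eq_bigr => p _.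
by rewrite mulrA.
Qed.

Lemma sgr_eq (R : realDomainType) (u v : R) :
  (Num.sg u == 1) = (Num.sg v == 1) -> (Num.sg u == -1) = (Num.sg v == -1) -> Num.sg u = Num.sg v.
Proof.
rewrite !sgr_cp0; have [hu|hu|->] := ltrgt0P u; have [hv|hv|->] := ltrgt0P v => //.
- by rewrite !gtr0_sg.
- by rewrite !ltr0_sg.
Qed.

(* A branch is determined on the grid by its end points, its Thom code, and the signs of [f] and its
   derivatives at the grid points, so that only polynomially many patterns arise. *)
Lemma branch_patterns (R : realType) (k : nat) : exists kap : nat, forall L n : nat,
  exists (K : nat) (V : 'I_K -> nat -> nat -> R), [/\ (K <= 2 ^ (kap * (L + n).+1))%N,
    forall j, (forall a b, V j a b = 0) \/
      exists f s al be phi, branch k f s al be phi /\ V j = cnt L n al be phi &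
    forall f s al be phi, branch k f s al be phi -> exists j, forall a b, (b < 2 ^ n)%N ->
      cnt L n al be phi a b = V j a b].
Proof.
(* The three summands account for the two end points, for the k + 1 signs of the Thom code, and for
   the sign vectors in dimension (k+1)^2. *)
exists (2 + (2 * k.+1 + (k + 6) * (k.+1 * k.+1)))%N => L n.
pose trip : seq (nat * nat * nat) :=
  [seq (p, l) | p <- [seq (i, b) | i <- iota 0 (2 ^ L), b <- iota 0 (2 ^ n).+1], l <- iota 0 k.+1].
pose fn (t : nat * nat * nat) := eval_col k (t.1.1%:R / 2 ^+ L : R) (t.1.2%:R / 2 ^+ n) t.2.
have [T [sT hT]] := sign_vectors_card [seq fn t | t <- trip].
(* The first sampled index, the first index past the interval, the signs in the Thom code (a sign
   being recorded by its comparison with 1 and -1), and the index of the sign vector on the grid. *)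
pose Code := ('I_(2 ^ L).+1 * 'I_(2 ^ L).+1 * {ffun 'I_k.+1 -> bool * bool} * 'I_(size T))%type.
pose is_code (c : Code) (f : {poly {poly R}}) (s : seq R) (al be : R) := [/\
  forall i, (i < 2 ^ L)%N -> (al < i%:R / 2 ^+ L) = (c.1.1.1 <= i)%N,
  forall i, (i < 2 ^ L)%N -> (i%:R / 2 ^+ L < be) = ~~ (c.1.1.2 <= i)%N,
  c.1.2 = [ffun i : 'I_k.+1 => (nth 0 s i == 1, nth 0 s i == -1)] &
  nth [::] T c.2 = [seq Num.sg ((coef_row k f *m fn t) 0 0) | t <- trip]].
(* A realized code is represented by the extents of any branch realizing it, an unrealized one by
   0. *)
pose real_by (c : Code) (v : nat -> nat -> R) := exists f s al be phi,
  [/\ branch k f s al be phi, is_code c f s al be & v = cnt L n al be phi].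
have exV c : exists v, real_by c v \/ (~ (exists v, real_by c v)) /\ (forall a b, v a b = 0).
  have [[v hv]|nv] := pselect (exists v, real_by c v); first by exists v; left.
  by exists (fun _ _ => 0); right.
have [V hV] := choice exV.
exists #|{: Code}|, (fun j => V (enum_val j)); split.
- rewrite !card_prod !card_ord card_ffun card_prod card_bool card_ord.
  set N := (2 ^ L)%N; set D := (k.+1 * k.+1)%N.
  have szt : size trip = (N * (2 ^ n).+1 * k.+1)%N by rewrite !size_allpairs !size_iota.
  have p2 m : (m < 2 ^ m)%N by exact: ltn_expl.
  have N1 : (N.+1 <= 2 ^ L.+1)%N.
    by rewrite expnS mul2n -addnn -addn1 leq_add2l expn_gt0.
  have Nn : ((2 ^ n).+1 <= 2 ^ n.+1)%N.
    by rewrite expnS mul2n -addnn -addn1 leq_add2l expn_gt0.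
  have hB : ((3 * size [seq fn t | t <- trip]).+1 <= 2 ^ ((k + 6) * (L + n).+1))%N.
    rewrite size_map szt; apply: (@leq_trans (4 * (2 ^ L * 2 ^ n.+1 * 2 ^ k.+1))).
      have h : (N * (2 ^ n).+1 * k.+1 <= 2 ^ L * 2 ^ n.+1 * 2 ^ k.+1)%N.
        by rewrite leq_mul // ?leq_mul // ltnW.
      have : (0 < 2 ^ L * 2 ^ n.+1 * 2 ^ k.+1)%N by rewrite !muln_gt0 !expn_gt0.
      by lia.
    by rewrite -[4%N]/(2 ^ 2)%N -!expnD leq_exp2l //; nia.
  have sT' : (size T <= 2 ^ ((k + 6) * D * (L + n).+1))%N.
    by rewrite (leq_trans sT) // mulnAC (expnM _ _ D) leq_exp2r.
  apply: (@leq_trans (2 ^ L.+1 * 2 ^ L.+1 * (2 * 2) ^ k.+1 * 2 ^ ((k + 6) * D * (L + n).+1))).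
    by rewrite !leq_mul.
  by rewrite -[(2 * 2)%N]/(2 ^ 2)%N -expnM -!expnD leq_exp2l // ; nia.
- move=> j; have [[f [s [al [be [phi [h1 _ ->]]]]]]|[_ h]] := hV (enum_val j); last by left.
  by right; exists f, s, al, be, phi.
move=> f s al be phi br.
have L0 : 0 < 2 ^+ L :> R by rewrite exprn_gt0.
have [i0 [i0N hi0]] : exists i0, (i0 <= 2 ^ L)%N /\ forall i, (i < 2 ^ L)%N -> (al < i%:R / 2 ^+ L) = (i0 <= i)%N.
  apply: threshold_up => i j ij /lt_le_trans; apply.
  by rewrite ler_pM2r ?invr_gt0 // ler_nat.
have [i1 [i1N hi1]] : exists i1, (i1 <= 2 ^ L)%N /\ forall i, (i < 2 ^ L)%N -> (be <= i%:R / 2 ^+ L) = (i1 <= i)%N.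
  apply: threshold_up => i j ij /le_trans; apply.
  by rewrite ler_pM2r ?invr_gt0 // ler_nat.
have tT : [seq Num.sg ((coef_row k f *m fn t) 0 0) | t <- trip] \in T.
  by have := hT (coef_row k f); rewrite -map_comp.
pose c : Code := (Ordinal (i0N : (i0 < (2 ^ L).+1)%N), Ordinal (i1N : (i1 < (2 ^ L).+1)%N),
  [ffun i : 'I_k.+1 => (nth 0 s i == 1, nth 0 s i == -1)],
  Ordinal (etrans (index_mem _ _) tT)).
have cc : is_code c f s al be.
  split => //; last by rewrite /= nth_index.
  by move=> i iL; rewrite -hi1 // -ltNge.
exists (enum_rank c) => a b bn; rewrite enum_rankK.
have [[f' [s' [al' [be' [phi' [br' [k1 k2 k3 k4] ->]]]]]]|[[]]] := hV c; last first.
  by exists (cnt L n al be phi); exists f, s, al, be, phi.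
have [c1 c2 c3 c4] := cc.
rewrite /cnt; congr (_%:R / _); apply: eq_card => i; rewrite !inE /cell_cond.
rewrite k1 ?c1 // k2 ?c2 //.
case i0i : (c.1.1.1 <= i)%N => //; case i1i : (c.1.1.2 <= i)%N => //=.
set x : R := i%:R / 2 ^+ L.
have xI : al < x < be by rewrite c1 // c2 // i0i i1i.
have xI' : al' < x < be' by rewrite k1 // k2 // i0i i1i.
have [kf s0 s1 hs _] := br; have [kf' s0' s1' hs' _] := br'.
have ss' : s = s'.
  rewrite -(hs _ xI) -(hs' _ xI'); apply: eq_sign_code => l lk.
  have := f_equal (fun g : {ffun 'I_k.+1 -> bool * bool} => g (Ordinal lk)) (etrans (esym c3) k3).
  rewrite !ffunE /= => -[e1 e2]; move: e1 e2.
  by rewrite -(hs _ xI) -(hs' _ xI') !sign_code_nth //; exact: sgr_eq.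
have sgE c0 l : (c0 <= 2 ^ n)%N -> (l < k.+1)%N ->
    Num.sg (spec f x)^`(l).[c0%:R / 2 ^+ n] = Num.sg (spec f' x)^`(l).[c0%:R / 2 ^+ n].
  move=> c0n lk; rewrite !spec_derivn !spec_horner -!(coef_row_eval _ _ _ kf) -!(coef_row_eval _ _ _ kf').
  have /eq_in_map/(_ ((i : nat, c0), l)) := etrans (esym c4) k4; apply.
  apply: allpairs_f; last by rewrite mem_iota.
  by apply: allpairs_f; rewrite mem_iota ?ltnS //= add0n.
(* The position of the branch relative to a grid height is read off from its Thom code and from the
   signs at the grid point, both of which are shared. *)
have cmp c0 : (c0 <= 2 ^ n)%N -> (2 ^+ n * phi x < c0%:R) = (2 ^+ n * phi' x < c0%:R).
  move=> c0n; have n0 : 0 < 2 ^+ n :> R by rewrite exprn_gt0.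
  have lt g t psi (al1 be1 : R) : branch k g t al1 be1 psi -> al1 < x < be1 ->
      (2 ^+ n * psi x < c0%:R) = code_lt t (sign_code k.+1 (spec g x) (c0%:R / 2 ^+ n)).
    move=> brg xg; have [kg t0 t1 ht _] := brg; rewrite -(ht _ xg) code_ltP.
    - by rewrite ltr_pdivlMr // mulrC.
    - by have /andP[h _] := kg; exact: leq_trans (size_spec _ _) h.
    - by rewrite spec_horner (branch_ev brg).
    - have /andP[h _] := kg; have [k0|k0] := posnP k; last first.
        by move: t1; rewrite -(ht _ xg) sign_code_nth // sgr_eq0 derivn1.
      by move: t1; rewrite -(ht _ xg) nth_default ?eqxx // size_map size_iota k0.
  rewrite (lt _ _ _ _ _ br xI) (lt _ _ _ _ _ br' xI') ss'; congr code_lt.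
  by apply: eq_sign_code => l; exact: sgE.
by rewrite !leNgt !cmp // ltnW.
Qed.

(** * Dyadic Cantor sets *)

Definition idx (d : nat) := {ffun 'I_d -> nat}.

Definition child (d : nat) (z : idx d) (e : {ffun 'I_d -> bool}) : idx d :=
  [ffun i => ((z i).*2 + e i)%N].

Definition refine (d : nat) (full : bool) (c : idx d -> {ffun 'I_d -> bool}) (Z : seq (idx d)) :
    seq (idx d) :=
  if full then [seq child z e | z <- Z, e <- enum {ffun 'I_d -> bool}] else [seq child z (c z) | z <- Z].

(** The selection receives the level built so far: what is a good selection depends on the squares
    already kept. *)
Fixpoint lev (d : nat) (full : nat -> bool)
    (c : nat -> seq (idx d) -> idx d -> {ffun 'I_d -> bool}) (n : nat) : seq (idx d) :=
  if n is n'.+1 then refine (full n') (c n' (lev full c n')) (lev full c n') else [:: [ffun=> 0%N]].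

Definition parent (d : nat) (z : idx d) : idx d := [ffun i => (z i)./2].

Lemma childK (d : nat) (z : idx d) e : parent (child z e) = z.
Proof. by apply/ffunP => i; rewrite !ffunE addnC half_bit_double. Qed.

Lemma child_inj (d : nat) (z z' : idx d) e e' : child z e = child z' e' -> z = z' /\ e = e'.
Proof.
move=> h; split; first by rewrite -(childK z e) h childK.
apply/ffunP => i; have /ffunP/(_ i) := h; rewrite !ffunE => /(congr1 odd).
by rewrite !oddD !odd_double !addFb; case: (e i); case: (e' i).
Qed.

Lemma refine_uniq (d : nat) full (c : idx d -> {ffun 'I_d -> bool}) Z : uniq Z -> uniq (refine full c Z).
Proof.
rewrite /refine => uZ; case: full.
  apply: allpairs_uniq => //; first exact: enum_uniq.
  by move=> [z e] [z' e'] _ _ /= /child_inj[-> ->].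
by rewrite map_inj_in_uniq // => z z' _ _ /child_inj[].
Qed.

Lemma lev_uniq (d : nat) full c n : uniq (@lev d full c n).
Proof. by elim: n => // n IH /=; exact: refine_uniq. Qed.

Lemma mem_refine (d : nat) full (c : idx d -> {ffun 'I_d -> bool}) Z z' :
  z' \in refine full c Z -> parent z' \in Z /\ exists e, z' = child (parent z') e.
Proof.
rewrite /refine; case: full.
  by move=> /allpairsP[[z e] /= [zZ _ ->]]; rewrite childK; split => //; exists e.
by move=> /mapP[z zZ ->]; rewrite childK; split => //; exists (c z).
Qed.

Lemma lev_lt (d : nat) full c n z i : z \in @lev d full c n -> (z i < 2 ^ n)%N.
Proof.
elim: n z => [|n IH] z /=; first by rewrite inE => /eqP ->; rewrite ffunE.
move=> /mem_refine[/IH h [e zE]]; rewrite zE ffunE expnS.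
by move: h; case: (e i); move: (parent z i) => u; lia.
Qed.

Lemma sum_refine (R : realType) (d : nat) full (c : idx d -> {ffun 'I_d -> bool}) Z (F : idx d -> R) :
  \sum_(z <- refine full c Z) F z =
  if full then \sum_(z <- Z) \sum_e F (child z e) else \sum_(z <- Z) F (child z (c z)).
Proof.
rewrite /refine; case: full; last by rewrite big_map.
by rewrite big_allpairs_dep /=; apply: eq_bigr => z _; rewrite big_enum.
Qed.

Lemma size_refine (d : nat) (full : bool) (c : idx d -> {ffun 'I_d -> bool}) Z :
  size (refine full c Z) = (size Z * (if full then 2 ^ d else 1))%N.
Proof.
rewrite /refine; case: full; last by rewrite size_map muln1.
by rewrite size_allpairs -cardE card_ffun card_bool card_ord.
Qed.

Lemma size_lev (d : nat) full c n : size (@lev d full c n) = (\prod_(i < n) (if full i then 2 ^ d else 1))%N.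
Proof. by elim: n => [|n IH] /=; rewrite ?big_ord0 // big_ord_recr /= size_refine IH. Qed.

Lemma sum_child2 (R : realType) (G : nat -> nat -> R) (z : idx 2) :
  \sum_(e : {ffun 'I_2 -> bool}) G (child z e ord0) (child z e ord_max) =
  \sum_(e1 : bool) \sum_(e2 : bool) G ((z ord0).*2 + e1)%N ((z ord_max).*2 + e2)%N.
Proof.
pose h (p : bool * bool) : {ffun 'I_2 -> bool} := [ffun i => if i == ord0 then p.1 else p.2].
rewrite pair_bigA (reindex h) /=.
  by apply: eq_bigr => -[e1 e2] _; rewrite !ffunE.
exists (fun e : {ffun 'I_2 -> bool} => (e ord0, e ord_max)) => [[e1 e2] _|e _]; first by rewrite /h !ffunE.
apply/ffunP => i; rewrite ffunE; case: eqP => [-> //|ne]; congr (e _).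
by apply: val_inj; case: i ne => -[|[|m]] //= im ne; case: ne; apply: val_inj.
Qed.

(** * The random construction *)

(** The number of cubes of level n depends on the kinds of the levels only, so it can be fixed
    before any selection is made. *)
Definition lsize (d : nat) (full : nat -> bool) (n : nat) : nat :=
  (\prod_(i < n) (if full i then 2 ^ d else 1))%N.

(* The mean number of sampled points, for the measure giving mass 4^n to each square of [Z]. *)
Definition extent (R : realType) (L n : nat) (Z : seq (idx 2)) (sw : bool) (al be : R)
    (phi : R -> R) : R :=
  \sum_(z <- Z) if sw then cnt L n al be phi (z ord_max) (z ord0) else cnt L n al be phi (z ord0) (z ord_max).

Lemma extent_children (R : realType) (L n : nat) (Z : seq (idx 2)) (sw : bool) (al be : R) phi :
  (n < L)%N -> extent L n Z sw al be phi =
  \sum_(z <- Z) \sum_e if sw then cnt L n.+1 al be phi (child z e ord_max) (child z e ord0)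
    else cnt L n.+1 al be phi (child z e ord0) (child z e ord_max).
Proof.
move=> nL; apply: eq_bigr => z _; case: sw; last by rewrite sum_child2 cnt_split.
rewrite (sum_child2 (fun a b => cnt L n.+1 al be phi b a)) exchange_big /= cnt_split //.
Qed.

Lemma extent_refine (R : realType) (L L' n : nat) (Z : seq (idx 2)) (sw : bool) (al be : R) phi :
  monotone_on al be phi -> (n <= L)%N -> (L <= L')%N ->
  extent L' n Z sw al be phi <= extent L n Z sw al be phi + (size Z)%:R / 2 ^+ L.
Proof.
move=> mono nL LL'; rewrite -sum1_size natr_sum mulr_suml /extent -big_split.
by apply: ler_sum => z _; rewrite /= div1r; case: sw; exact: cnt_refine.
Qed.

(* [w / 2 ^+ n] bounds the contribution of a single square, and [x] the logarithm of the number of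
   patterns in the union bound. *)
Lemma random_step (R : realType) (k : nat) : exists kap : nat, forall (Kc n : nat) (Z : seq (idx 2)) (w Lam eps : R),
  let x := kap%:R * (Kc.+1 * n.+1)%:R : R in
  (0 < Kc)%N -> uniq Z -> (forall z i, z \in Z -> (z i < 2 ^ n)%N) ->
  0 < w -> 0 < Lam -> 0 < eps -> 2 * x <= Lam * (2 ^+ n / w) -> 128 * x * Lam * (w / 2 ^+ n) <= eps ^+ 2 ->
  exists c : idx 2 -> {ffun 'I_2 -> bool},
    forall sw f s al be phi, branch k f s al be phi ->
      w * extent (Kc * n.+1) n Z sw al be phi <= Lam ->
      4 * w * extent (Kc * n.+1) n.+1 (refine false c Z) sw al be phi <=
      w * extent (Kc * n.+1) n Z sw al be phi + eps.
Proof.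
have [kap hkap] := branch_patterns R k.
exists (kap.*2 + 2)%N => Kc n Z w Lam eps x Kc0 uZ Z2 w0 Lam0 eps0 xLam xeps.
set L := (Kc * n.+1)%N; have nL : (n < L)%N by rewrite /L; nia.
have [K [V [KB V0 hV]]] := hkap L n.+1.
have x0 : 0 < x by rewrite /x mulr_gt0 // ltr0n // ?addn2 // muln_gt0.
have n0 : 0 < 2 ^+ n :> R by rewrite exprn_gt0.
(* The Chernoff parameter: the linear term of the exponent is then 2x and the quadratic one at most
   x, so each pattern fails with probability at most exp(-x). *)
pose l := w * (2 * x / eps).
have l0 : 0 < l by rewrite /l !mulr_gt0 // invr_gt0.
(* Every pattern occurs twice, once for each orientation of the coordinates. *)
pose sp (j : 'I_(K + K)) : bool * 'I_K :=
  match fintype.split j with inl j => (false, j) | inr j => (true, j) end.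
pose v (j : 'I_(K + K)) (z : idx 2) (e : {ffun 'I_2 -> bool}) : R :=
  if (sp j).1 then V (sp j).2 (child z e ord_max) (child z e ord0)
  else V (sp j).2 (child z e ord0) (child z e ord_max).
have v0 j z e : 0 <= v j z e.
  rewrite /v; have [h|[f [s [al [be [phi [_ ->]]]]]]] := V0 (sp j).2; first by rewrite !h if_same.
  by case: ifP => _; exact: cnt_ge0.
have vs j z : \sum_e v j z e <= (2 ^+ n)^-1.
  rewrite /v; have [h|[f [s [al [be [phi [_ ->]]]]]]] := V0 (sp j).2.
    rewrite big1 ?invr_ge0 ?ltW // => e _; by rewrite !h if_same.
  case: (sp j).1.
    rewrite (sum_child2 (fun a b => cnt L n.+1 al be phi b a)) exchange_big /= -cnt_split //.
    by rewrite cnt_le // ltnW.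
  by rewrite sum_child2 -cnt_split // cnt_le // ltnW.
have cardE : #|{ffun 'I_2 -> bool}|%:R = 4 :> R by rewrite card_ffun card_bool card_ord.
have [|||c hc] := @exists_choice_small_deviation R _ _ [ffun=> false] (K + K) Z v l (2 ^+ n)^-1
    (Lam / w) (eps / w) uZ l0 _ v0 vs.
- by rewrite invr_ge0 ltW.
- rewrite cardE /l.
  have -> : 2 * (w * (2 * x / eps)) * 4 / 2 ^+ n = (16 * x * (w / 2 ^+ n)) / eps.
    field. by rewrite !gt_eqF.
  have b0 : 0 < w / 2 ^+ n by rewrite divr_gt0.
  have xb : 2 * x * (w / 2 ^+ n) <= Lam by rewrite -ler_pdivlMr // invf_div.
  rewrite ler_pdivrMr // mul1r -(@ler_pXn2r _ 2) ?nnegrE //; last exact: ltW.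
    apply: le_trans xeps; move: b0 xb; set b := w / 2 ^+ n => b0 xb.
    have -> : (16 * x * b) ^+ 2 = 128 * ((x * b) * (2 * x * b)) by ring.
    have -> : 128 * x * Lam * b = 128 * ((x * b) * Lam) by ring.
    by rewrite ler_pM2l // ler_pM2l // mulr_gt0.
  by rewrite ltW // !mulr_gt0 // invr_gt0.
- rewrite cardE.
  have : 2 * l ^+ 2 * 4 ^+ 2 / 2 ^+ n * (Lam / w) - l * (eps / w) <= - x.
    have -> : 2 * l ^+ 2 * 4 ^+ 2 / 2 ^+ n * (Lam / w) = x * (128 * x * Lam * (w / 2 ^+ n)) / eps ^+ 2.
      rewrite /l; field; by rewrite !gt_eqF.
    have -> : l * (eps / w) = 2 * x by rewrite /l; field; rewrite !gt_eqF.
    have : x * (128 * x * Lam * (w / 2 ^+ n)) / eps ^+ 2 <= x.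
      by rewrite ler_pdivrMr ?exprn_gt0 // ler_pM2l.
    by lra.
  move=> hu; apply: (@le_trans _ _ ((K + K)%:R * expR (- x))).
    by rewrite ler_wpM2l // ler_expR.
  rewrite expRN ler_pdivrMr ?expR_gt0 // mul1r.
  (* The 2K patterns number at most 2^m, with m = x, and 2 <= e. *)
  pose m := ((kap.*2 + 2) * (Kc.+1 * n.+1))%N.
  have -> : x = m%:R by rewrite /x -natrM.
  apply: (@le_trans _ _ (2 ^ m)%:R).
    rewrite ler_nat; apply: (@leq_trans (2 ^ (kap * (L + n.+1).+1).+1)).
      by rewrite expnS mul2n -addnn leq_add.
    by rewrite leq_exp2l // /m /L; clear; nia.
  rewrite -[X in expR X]mulr1 expRM_natl natrX.
  apply: lerXn2r; rewrite ?nnegrE ?expR_ge0 //.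
  by have := expR_ge1Dx (1 : R); lra.
exists c => sw f s al be phi br hLam.
have [j hj] := hV f s al be phi br.
pose i : 'I_(K + K) := if sw then rshift K j else lshift K j.
have spi : sp i = (sw, j).
  by rewrite /sp /i; case: (sw); [rewrite (unsplitK (inr j))|rewrite (unsplitK (inl j))].
have vE z e : z \in Z -> v i z e = if sw then cnt L n.+1 al be phi (child z e ord_max) (child z e ord0)
    else cnt L n.+1 al be phi (child z e ord0) (child z e ord_max).
  move=> zZ; rewrite /v spi /=.
  have lt q : (child z e q < 2 ^ n.+1)%N.
    rewrite ffunE expnS; have := Z2 z q zZ; move: (z q) (e q) (2 ^ n)%N; clear.
    by move=> t [] u /=; lia.
  by case: (sw); rewrite hj.
have sumE : \sum_(z <- Z) \sum_e v i z e = extent L n Z sw al be phi.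
  rewrite extent_children //; apply: eq_big_seq => z zZ; apply: eq_bigr => e _; exact: vE.
have := hc i; rewrite sumE cardE => /(_ _).
have -> : \sum_(z <- Z) 4 * v i z (c z) = 4 * extent L n.+1 (refine false c Z) sw al be phi.
  by rewrite /extent sum_refine mulr_sumr; apply: eq_big_seq => z zZ; rewrite vE.
rewrite ler_pdivlMr // mulrC => /(_ hLam) h.
have -> : w * extent L n Z sw al be phi + eps = w * (extent L n Z sw al be phi + eps / w).
  by rewrite mulrDr mulrCA mulfV ?mulr1 // gt_eqF.
by rewrite [4 * w]mulrC -mulrA ler_pM2l.
Qed.

Lemma sum_half_pow (R : realType) (n : nat) : \sum_(i < n) (2 ^+ i.+1 : R)^-1 <= 1.
Proof.
suff -> : \sum_(i < n) (2 ^+ i.+1 : R)^-1 = 1 - (2 ^+ n)^-1.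
  by rewrite gerBl invr_ge0 exprn_ge0.
elim: n => [|n IH]; first by rewrite big_ord0 expr0 invr1 subrr.
rewrite big_ord_recr /= IH exprS invfM.
by set u := (2 ^+ n)^-1; lra.
Qed.

(** The extent normalized by [w n] starts at most 1 and gains at each step at most a random
    deviation and a grid error. Both are summable, and the running total [bd] stays below [Lam],
    which is the hypothesis needed at the next step. *)
Lemma random_levels (R : realType) (k Kc : nat) (full : nat -> bool) (S : R) : (3 <= Kc)%N ->
  (forall N, \sum_(n < N) Num.sqrt (n.+1%:R * (2 ^+ n / (lsize 2 full n)%:R)) <= S) ->
  exists c Lam, 0 < Lam /\ forall n sw (f : {poly {poly R}}) s al be phi, branch k f s al be phi ->
    4 ^+ n / (lsize 2 full n)%:R * extent (Kc * n.+1) n (lev full c n) sw al be phi <= Lam.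
Proof.
move=> Kc3 hS; have [kap hkap] := random_step R k.
pose M n : R := (lsize 2 full n)%:R; pose w n := 4 ^+ n / M n; pose b n := 2 ^+ n / M n.
have M0 n : 0 < M n by rewrite ltr0n prodn_gt0 // => i; case: (full i).
have w0 n : 0 < w n by rewrite divr_gt0 // exprn_gt0.
have b0 n : 0 < b n by rewrite divr_gt0 // exprn_gt0.
have bw n : w n / 2 ^+ n = b n.
  rewrite /w /b; have -> : (4 : R) ^+ n = 2 ^+ n * 2 ^+ n by rewrite -exprMn; congr (_ ^+ _); lra.
  by rewrite mulrAC mulfK // expf_neq0.
pose q n := Num.sqrt (n.+1%:R * b n).
have q0 n : 0 < q n by rewrite sqrtr_gt0 mulr_gt0.
have q2 n : q n ^+ 2 = n.+1%:R * b n by rewrite sqr_sqrtr // ltW // mulr_gt0.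
have S0 : 0 <= S by have := hS 0%N; rewrite big_ord0.
have qS n : q n <= S.
  apply: le_trans (hS n.+1); rewrite big_ord_recr /= lerDr sumr_ge0 // => i _; exact: sqrtr_ge0.
pose kk : R := kap%:R * Kc.+1%:R + 1.
have kk0 : 0 < kk by rewrite /kk ltr_wpDl // mulr_ge0.
pose r := Num.sqrt (128 * kk).
have r0 : 0 < r by rewrite sqrtr_gt0 mulr_gt0.
have r2 : r ^+ 2 = 128 * kk by rewrite sqr_sqrtr // ltW // mulr_gt0.
(* The deviations are proportional to sqrt [Lam] = m, so [Lam] must satisfy 2 + m r S <= m^2; this
   is how m is chosen. *)
pose m := 2 + r * S; pose Lam := m ^+ 2.
have m2 : 2 <= m by rewrite /m lerDl mulr_ge0 // ltW.
have m0 : 0 < m by lra.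
have Lam0 : 0 < Lam by rewrite exprn_gt0.
have LamE : 2 + m * r * S <= Lam.
  have -> : m * r * S = m * (m - 2) by rewrite /m; ring.
  by rewrite /Lam expr2; nra.
pose x n : R := kap%:R * (Kc.+1 * n.+1)%:R.
have xk n : x n <= kk * n.+1%:R.
  by rewrite /x natrM mulrA ler_pM2r ?ltr0n // /kk lerDl.
have x0 n : 0 <= x n by rewrite /x mulr_ge0.

pose eps n := r * m * q n.
have eps0 n : 0 < eps n by rewrite /eps !mulr_gt0.
(* The level reached depends on the earlier selections, so a good selection is fixed at once for
   every number n and every admissible set. *)
have [|c hc] := choice (_ : forall p : nat * seq (idx 2), exists c : idx 2 -> {ffun 'I_2 -> bool},
    uniq p.2 -> (forall z i, z \in p.2 -> (z i < 2 ^ p.1)%N) ->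
    forall sw f s al be phi, branch k f s al be phi ->
      w p.1 * extent (Kc * p.1.+1) p.1 p.2 sw al be phi <= Lam ->
      4 * w p.1 * extent (Kc * p.1.+1) p.1.+1 (refine false c p.2) sw al be phi <=
      w p.1 * extent (Kc * p.1.+1) p.1 p.2 sw al be phi + eps p.1).
  move=> [n Z] /=; have [[uZ hZ]|nh] := pselect (uniq Z /\ (forall z i, z \in Z -> (z i < 2 ^ n)%N)); last first.
    by exists (fun=> [ffun=> false]) => uZ hZ; case: nh.
  have [||c hc] := hkap Kc n Z (w n) Lam (eps n) (leq_trans (ltn0Sn 2) Kc3) uZ hZ (w0 n) Lam0 (eps0 n).
  - rewrite -[2 ^+ n / w n]invf_div bw ler_pdivlMr // -/(x n).
    have h : 2 * x n * b n <= 2 * (kk * (n.+1%:R * b n)).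
      by rewrite -mulrA ler_pM2l // [kk * _]mulrA ler_pM2r.
    apply: (le_trans h); rewrite -q2.
    have h2 : q n ^+ 2 <= S ^+ 2 by rewrite lerXn2r ?nnegrE // ltW.
    apply: (@le_trans _ _ (2 * (kk * S ^+ 2))); first by rewrite ler_pM2l // ler_pM2l.
    have : r ^+ 2 * S ^+ 2 <= Lam.
      by rewrite -exprMn /Lam lerXn2r ?nnegrE ?mulr_ge0 // ?ltW // /m ltrDr.
    rewrite r2; have : 0 <= kk * S ^+ 2 by rewrite mulr_ge0 ?sqr_ge0 // ltW.
    by lra.
  - rewrite bw -/(x n) /eps !exprMn r2 q2 -/Lam.
    have -> : 128 * x n * Lam * b n = 128 * (x n * (Lam * b n)) by ring.
    have -> : 128 * kk * Lam * (n.+1%:R * b n) = 128 * ((kk * n.+1%:R) * (Lam * b n)) by ring.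
    by apply: ler_wpM2l => //; apply: ler_wpM2r (xk n); rewrite ltW // mulr_gt0.
  by exists c.
pose cc n Z := c (n, Z).
exists cc, Lam; split => // n sw f s al be phi br.
have mono : monotone_on al be phi by case: br.
pose Y n L := w n * extent L n (lev full cc n) sw al be phi.
pose bd n := 1 + \sum_(i < n) (eps i + (2 ^+ i.+1)^-1).
have bdLam j : bd j <= Lam.
  rewrite /bd big_split /= -mulr_sumr.
  have := sum_half_pow R j; have : r * m * \sum_(i < j) q i <= r * m * S.
    by rewrite ler_pM2l ?mulr_gt0 //; exact: hS.
  by have := LamE; rewrite [m * r]mulrC; lra.
suff : Y n (Kc * n.+1)%N <= bd n by move=> h; exact: le_trans h (bdLam n).
elim: n => [|n IH].
  rewrite /Y /bd big_ord0 addr0 /w /M /lsize big_ord0 expr0 divr1 mul1r /extent /= big_seq1.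
  by case: (sw); apply: (le_trans (cnt_le _ _ _ _ _ _)) => //; rewrite expr0 invr1.
have Lpos : (n.+1 <= Kc * n.+1)%N by nia.
have LL : (Kc * n.+1 <= Kc * n.+2)%N by rewrite leq_mul2l leqnSn orbT.
have szM j : (size (lev full cc j))%:R = M j by rewrite size_lev.
(* The grid error is 2^-L per square, that is 4^(n+1) / 2^(Kc (n+1)) after normalization, at most
   2^-(n+1) since [Kc] is at least 3. *)
have st1 : Y n.+1 (Kc * n.+2)%N <= Y n.+1 (Kc * n.+1)%N + (2 ^+ n.+1)^-1.
  apply: (@le_trans _ _ (w n.+1 * (extent (Kc * n.+1) n.+1 (lev full cc n.+1) sw al be phi +
      (size (lev full cc n.+1))%:R / 2 ^+ (Kc * n.+1)))).
    by rewrite ler_pM2l //; exact: extent_refine.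
  rewrite mulrDr lerD2l szM mulrA /w divfK ?gt_eqF //.
  rewrite ler_pdivrMr ?exprn_gt0 // mulrC ler_pdivlMr ?exprn_gt0 //.
  have -> : (4 : R) = 2 ^+ 2 by rewrite expr2; lra.
  rewrite -!exprM -exprD ler_eXn2l ?ltr1n //; nia.
apply: (le_trans st1); rewrite /bd big_ord_recr /= addrA -/(bd n) addrA lerD2r.
suff : Y n.+1 (Kc * n.+1)%N <= Y n (Kc * n.+1)%N + eps n.
  by move=> h; apply: (le_trans h); rewrite lerD2r.
(* At a full step each square is replaced by its four quarters and the weight is unchanged, so the
   normalized extent stays the same. *)
rewrite /Y /=; case fn : (full n).
  have -> : w n.+1 = w n.
    rewrite /w /M /lsize big_ord_recr /= fn exprS natrM.
    have h := M0 n; rewrite /M /lsize in h.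
    by field; rewrite gt_eqF.
  rewrite [X in w n * X](_ : _ = extent (Kc * n.+1) n (lev full cc n) sw al be phi).
    by rewrite lerDl ltW.
  by rewrite [RHS]extent_children // {1}/extent sum_refine.
have -> : w n.+1 = 4 * w n.
  by rewrite /w /M /lsize big_ord_recr /= fn muln1 exprS mulrA.
apply: (hc (n, lev full cc n)) => //=; first exact: lev_uniq.
- by move=> z i; exact: lev_lt.
- exact: br.
- exact: le_trans IH (bdLam n).
Qed.

(** * Covering a curve by finitely many branches, and translations *)

(** The ends come from a finite list, so that only finitely many intervals have to be considered for
    a curve. *)
Lemma bracket (R : realType) (cr : seq R) (b x : R) : - b < x -> x < b -> x \notin cr ->
  exists al be, [/\ al \in [:: - b, b & cr], be \in [:: - b, b & cr], al < x < be &
    forall t, al < t < be -> t \notin cr].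
Proof.
move=> bx xb; elim: cr => [|c cr IH].
  by move=> _; exists (- b), b; split; rewrite ?inE ?eqxx ?orbT // bx.
rewrite inE negb_or => /andP[xc /IH[al [be [hal hbe /andP[ax xb'] h]]]].
have [cx|xc'] := ltP c x.
  exists (Num.max al c), be; split.
  - by case: leP => _; move: hal; rewrite !inE ?eqxx ?orbT // => /or3P[->|->|->]; rewrite ?orbT.
  - by move: hbe; rewrite !inE => /or3P[->|->|->]; rewrite ?orbT.
  - by rewrite gt_max ax cx.
  - move=> t; rewrite gt_max => /andP[/andP[t1 t2] t3].
    by rewrite inE negb_or gt_eqF //= h // t1.
have {}xc' : x < c by rewrite lt_neqAle xc.
exists al, (Num.min be c); split.
- by move: hal; rewrite !inE => /or3P[->|->|->]; rewrite ?orbT.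
- by case: leP => _; move: hbe; rewrite !inE ?eqxx ?orbT // => /or3P[->|->|->]; rewrite ?orbT.
- by rewrite lt_min ax xb' xc'.
- move=> t; rewrite lt_min => /andP[t1 /andP[t2 t3]].
  by rewrite inE negb_or lt_eqF //= h // t1.
Qed.

Definition brdata (R : realType) := (R * R * (R -> R))%type.

Definition good_branch (R : realType) k (P : {poly {poly R}}) (br : brdata R) :=
  [/\ exists f s, branch k f s br.1.1 br.1.2 br.2,
     forall x, br.1.1 < x < br.1.2 -> {for x, continuous br.2} &
     forall x, br.1.1 < x < br.1.2 -> ev P x (br.2 x) = 0].

(** Over each interval free of critical abscissas the branches are those through the roots over its
    midpoint: the branch through any point of the curve reaches the midpoint with the same code. The
    bound counts factors, left ends, right ends and roots. The range ]-4, 4[ leaves room around the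
    unit square for the neighbouring squares. *)
Lemma branch_cover (R : realType) (k : nat) : exists C : nat, forall P : {poly {poly R}},
  P != 0 -> bideg k P -> exists (cr : seq R) (Br : seq (brdata R)),
  [/\ (size cr <= C)%N, (size Br <= C)%N, forall br, br \in Br -> good_branch k P br &
    forall x y, - 4 < x -> x < 4 -> ev P x y = 0 -> x \in cr \/
      exists2 br, br \in Br & br.1.1 < x < br.1.2 /\ br.2 x = y].
Proof.
have [C hC] := curve_structure R k.
exists (C + (C * (C + 2) * (C + 2) * k.+1))%N => P P0 kP.
have [cr [fs [scr sfs hfs cov sub]]] := hC P P0 kP.
pose ends := [:: - (4 : R), 4 & cr].
pose idxs := [seq (p, be) | p <- [seq (f, al) | f <- fs, al <- ends], be <- ends].
have cell p : exists B : seq (brdata R), [/\ (size B <= k.+1)%N, forall br, br \in B -> good_branch k P br &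
    p.1.1 \in fs -> (forall t, p.1.2 < t < p.2 -> t \notin cr) -> forall x y, p.1.2 < x < p.2 ->
    ev p.1.1 x y = 0 -> exists2 br, br \in B & br.1.1 < x < br.1.2 /\ br.2 x = y].
  case: p => -[f al] be /=.
  have [[ffs ncr]|nh] := pselect (f \in fs /\ (forall t, al < t < be -> t \notin cr)); last first.
    by exists [::]; split => // ffs ncr; case: nh.
  have [abe|bea] := ltP al be; last first.
    by exists [::]; split => // _ _ x y /andP[ax xb]; have := lt_le_trans (lt_trans ax xb) bea; rewrite ltxx.
  have [f1 kf reg] := hfs f ffs.
  pose x0 := (al + be) / 2; have x0I : al < x0 < be by apply/andP; split; rewrite /x0; lra.
  have sp0 : spec f x0 != 0.
    have [lc _] := reg x0 (ncr _ x0I).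
    have e0 : horner_eval x0 (lead_coef f) != 0 by exact: lc.
    rewrite -lead_coef_eq0 lead_coef_map_eq //.
  have [ys [sys hys]] := root_list sp0.
  have regI x : al < x < be -> regular f x by move=> /ncr; exact: reg.
  have ex y : exists phi : R -> R, ev f x0 y = 0 ->
      [/\ branch k f (sign_code k.+1 (spec f x0) y) al be phi, phi x0 = y &
      forall x, al < x < be -> {for x, continuous phi}].
    have [h|h] := pselect (ev f x0 y = 0); last by exists id.
    by have [phi hphi] := branch_exists kf f1 regI x0I h; exists phi.
  have [phi hphi] := choice ex.
  exists [seq (al, be, phi y) | y <- ys & ev f x0 y == 0]; split.
  - rewrite size_map size_filter (leq_trans (count_size _ _)) //.
    have /andP[kf1 _] := kf; exact: leq_trans (ltnW sys) (leq_trans (size_spec _ _) kf1).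
  - move=> br /mapP[y]; rewrite mem_filter => /andP[/eqP fy _] ->.
    have [b1 b2 b3] := hphi y fy; split => /=; [by exists f; eexists; exact: b1|exact: b3|].
    by move=> x xI; apply: (sub f) => //; exact: branch_ev b1 xI.
  - move=> _ _ x y xI fxy.
    have [psi [b1 b2 b3]] := branch_exists kf f1 regI xI fxy.
    have fy0 := branch_ev b1 x0I; set y0 := psi x0 in fy0.
    exists (al, be, phi y0); first by rewrite map_f // mem_filter fy0 eqxx hys // spec_horner.
    split => //=; have [c1 c2 c3] := hphi y0 fy0.
    have [_ _ _ cc _] := c1; have [_ _ _ cb _] := b1.
    apply: (@sign_code_unique _ k f x) => //; first exact: branch_ev c1 xI.
      have [_ /(_ _ (branch_ev c1 xI))[+ _]] := regI x xI.
      by move=> /(_ 1%N); rewrite derivn1; apply.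
    by rewrite (cc _ xI) (cb _ x0I).
have [cells hcells] := choice cell.
exists cr, (flatten [seq cells p | p <- idxs]); split.
- by rewrite (leq_trans scr) // leq_addr.
- apply: leq_trans (leq_addl _ _).
  have : (size (flatten [seq cells p | p <- idxs]) <= size idxs * k.+1)%N.
    elim: idxs => //= p l IH; rewrite size_cat mulSn leq_add //; by have [] := hcells p.
  move=> h; apply: (leq_trans h); apply: leq_mul => //.
  by rewrite /idxs !size_allpairs /= addn2; do 2 apply: leq_mul => //.
- by move=> br /flatten_mapP[p _]; have [_ h _] := hcells p; exact: h.
move=> x y x4 x4' Pxy; have [xcr|[f ffs fxy]] := cov x y Pxy; first by left.
have [xcr|xcr] := boolP (x \in cr); first by left.
right; have [al [be [hal hbe xI ncr]]] := bracket x4 x4' xcr.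
have [_ _ /(_ ffs ncr x y xI fxy)[br brc hbr]] := hcells (f, al, be).
exists br => //; apply/flatten_mapP; exists (f, al, be) => //.
apply: allpairs_f => //; exact: allpairs_f.
Qed.

Definition shiftP (R : realType) (u v : R) (f : {poly {poly R}}) : {poly {poly R}} :=
  map_poly (comp_poly ('X + u%:P)) f \Po ('X + v%:P%:P).

Lemma shiftP_spec (R : realType) (u v : R) (f : {poly {poly R}}) x :
  spec (shiftP u v f) x = spec f (x + u) \Po ('X + v%:P).
Proof.
rewrite /spec /shiftP map_comp_poly -map_poly_comp rmorphD /= map_polyX map_polyC /= /horner_eval hornerC.
congr (_ \Po _); apply: eq_map_poly => p /=.
by rewrite /horner_eval horner_comp !hornerE.
Qed.

Lemma derivn_compXD (R : realType) (q : {poly R}) (v : R) i :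
  (q \Po ('X + v%:P))^`(i) = q^`(i) \Po ('X + v%:P).
Proof.
elim: i => // i IH; rewrite !derivnS IH deriv_comp derivD derivX derivC addr0 mulr1 //.
Qed.

Lemma sign_code_shift (R : realType) k (u v : R) (f : {poly {poly R}}) x y :
  sign_code k (spec (shiftP u v f) x) y = sign_code k (spec f (x + u)) (y + v).
Proof.
apply: eq_sign_code => i _; rewrite shiftP_spec derivn_compXD horner_comp !hornerE //.
Qed.

Lemma bideg_shift (R : realType) k (u v : R) (f : {poly {poly R}}) : bideg k f -> bideg k (shiftP u v f).
Proof.
have comp_size (A : idomainType) (q : {poly A}) (a : A) : size (q \Po ('X + a%:P)) = size q.
  by rewrite size_comp_poly2 // size_XaddC.
move=> /andP[h1 /sizeY_leP h2]; apply/andP; split.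
  by rewrite /shiftP comp_size (leq_trans (size_poly _ _)).
apply/sizeY_leP => i; rewrite /shiftP; set g := map_poly _ f.
have hg l : (size (g`_l)%R <= k.+1)%N by rewrite /g coef_map /= comp_size.
rewrite /comp_poly horner_coef coef_sum (leq_trans (size_sum _ _ _)) //; apply/bigmax_leqP => j _.
rewrite (coef_map polyC) /= coefCM.
pose e : {poly R} := (('X + v%:P%:P : {poly {poly R}}) ^+ j)`_i; rewrite -/e.
have se : (size e <= 1)%N.
  rewrite /e exprDn coef_sum; apply: (leq_trans (size_sum _ _ _)); apply/bigmax_leqP => l _.
  rewrite -polyC_exp mulrC -mulrnAl -polyCMn coefCM coefXn -polyC_exp.
  by rewrite -polyCMn; case: (_ == _); rewrite ?mulr1 ?mulr0 ?size_poly0 // size_polyC leq_b1.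
by rewrite (size1_polyC se) mulrC mul_polyC (leq_trans (size_scale_leq _ _)).
Qed.

(** Thom code and bidegree are unchanged by a translation, so bounds valid for all branches apply to
    the translates of a given one. *)
Lemma branch_shift (R : realType) k (f : {poly {poly R}}) s al be phi (u v : R) :
  branch k f s al be phi ->
  branch k (shiftP u v f) s (al - u) (be - u) (fun x => phi (x + u) - v).
Proof.
move=> [kf s0 s1 hs mono]; split => //; first exact: bideg_shift.
  move=> x /andP[x1 x2]; rewrite sign_code_shift subrK hs //.
  by rewrite -ltrBlDr x1 -ltrBrDr.
case: mono => mono; [left|right] => x y x1 xy y2; rewrite lerD2r; apply: mono.
- by rewrite -ltrBlDr.
- by rewrite lerD2r.
- by rewrite -ltrBrDr.
- by rewrite -ltrBlDr.
- by rewrite lerD2r.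
- by rewrite -ltrBrDr.
Qed.

(** * Counting the squares met by a curve *)

Definition shift_br (R : realType) (u v : R) (br : brdata R) : brdata R :=
  (br.1.1 - u, br.1.2 - u, fun x => br.2 (x + u) - v).

Definition cntb (R : realType) (L n : nat) (br : brdata R) (a b : nat) : R :=
  cnt L n br.1.1 br.1.2 br.2 a b.

(** Closed squares, unlike the half-open ones of [cell_cond]: the limit set is only known to lie in
    the closed squares, whereas extents must be exactly additive. *)
Definition incell (R : realType) (n a b : nat) (x y : R) :=
  (a%:R / 2 ^+ n <= x <= a.+1%:R / 2 ^+ n) && (b%:R / 2 ^+ n <= y <= b.+1%:R / 2 ^+ n).

(** Three rows would need three shifts; the fourth is for the upper end of the closed band, as the
    target row is half-open. *)
Lemma row_shift (R : realType) (b : nat) (w : R) : b%:R - 1 <= w -> w <= b%:R + 2 ->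
  exists t : 'I_4, (b%:R <= w - (t%:R - 1)) && (w - (t%:R - 1) < b.+1%:R).
Proof.
move=> h1 h2; rewrite -natr1.
have [w0|w0] := ltP w b%:R; first by exists (@Ordinal 4 0 isT) => /=; apply/andP; split; lra.
have [w1|w1] := ltP w (b%:R + 1); first by exists (@Ordinal 4 1 isT) => /=; apply/andP; split; lra.
have [w2|w2] := ltP w (b%:R + 2); first by exists (@Ordinal 4 2 isT) => /=; apply/andP; split; lra.
by exists (@Ordinal 4 3 isT) => /=; apply/andP; split; lra.
Qed.

(** Let the curve lie in the three rows around row b above every grid point of a translated column,
    up to [M] critical points. Each of the other grid points is then counted by some branch after
    one of four vertical shifts, so the extents add up to almost the full width. *)
Lemma grid_count (R : realType) (L n a b M : nat) (u : R) (cr : seq R) (Br : seq (brdata R)) :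
  (n <= L)%N -> (a < 2 ^ n)%N -> (size cr <= M)%N ->
  (forall j, (j < 2 ^ (L - n))%N -> let x := (a * 2 ^ (L - n) + j)%:R / 2 ^+ L + u in
    x \in cr \/ exists2 br, br \in Br & br.1.1 < x < br.1.2 /\
      ((b%:R - 1) / 2 ^+ n <= br.2 x <= (b%:R + 2) / 2 ^+ n)) ->
  ((2 ^ (L - n))%:R - M%:R) / 2 ^+ L <=
  \sum_(br <- Br) \sum_(t < 4) cntb L n (shift_br u ((t%:R - 1) / 2 ^+ n) br) a b.
Proof.
move=> nL an crM H; set N := (2 ^ (L - n))%N.
have L0 : 0 < 2 ^+ L :> R by rewrite exprn_gt0.
have n0 : 0 < 2 ^+ n :> R by rewrite exprn_gt0.
pose x (j : 'I_N) : R := (a * N + j)%:R / 2 ^+ L + u.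
have xinj : injective x.
  move=> i j /addIr/(mulIf _) e; apply: val_inj; apply/eqP.
  by rewrite -(eqn_add2l (a * N)) -(eqr_nat R) e // invr_eq0 gt_eqF.
pose G : {set 'I_N} := [set j | x j \notin cr]%SET.
have cG : (N <= #|G| + M)%N.
  rewrite -[N in (N <= _)%N]card_ord -(cardsC G) leq_add2l (leq_trans _ crM) //.
  rewrite cardE -(size_map x) uniq_leq_size ?map_inj_uniq ?enum_uniq //.
  by move=> y /mapP[j]; rewrite mem_enum !inE negbK => jc ->.
pose S (br : brdata R) (t : 'I_4) i := cell_cond L n (br.1.1 - u) (br.1.2 - u)
  (fun x => br.2 (x + u) - (t%:R - 1) / 2 ^+ n) a b i.
have step1 : (#|G| <= \sum_(br <- Br) \sum_(t < 4) \sum_(j < N) S br t (a * N + j)%N)%N.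
  under eq_bigr => br _ do rewrite exchange_big.
  rewrite exchange_big /= -sum1_card big_mkcond /=; apply: leq_sum => j _.
  case: ifP => // jG; rewrite inE in jG.
  have [xc|[br brB [/andP[x1 x2] /andP[y1 y2]]]] := H j (ltn_ord j); first by rewrite /x xc in jG.
  have bw1 : b%:R - 1 <= 2 ^+ n * br.2 (x j) by rewrite -ler_pdivrMl // mulrC.
  have bw2 : 2 ^+ n * br.2 (x j) <= b%:R + 2 by rewrite -ler_pdivlMl // mulrC.
  have [t ht] := row_shift bw1 bw2.
  suff St : S br t (a * N + j)%N.
    rewrite (big_rem br) //= (bigD1 t) //= St.
    by rewrite -addnA leq_addr.
  rewrite /S /cell_cond -/N -/N divnMDl ?expn_gt0 // divn_small ?ltn_ord // addn0 eqxx /=.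
  have -> : (a * N + j)%:R / 2 ^+ L = x j - u by rewrite /x addrK.
  rewrite !ltrD2r x1 x2 subrK mulrBr [2 ^+ n * (_ / _)]mulrC divfK ?gt_eqF //.
have step2 br t : (\sum_(j < N) S br t (a * N + j)%N <=
    #|[set i : 'I_(2 ^ L) | S br t i]%SET|)%N.
  have lt (j : 'I_N) : (a * N + j < 2 ^ L)%N.
    have -> : (2 ^ L = 2 ^ n * N)%N by rewrite -expnD subnKC.
    by rewrite (leq_trans (_ : _ < a.+1 * N)%N) ?leq_mul2r ?an ?orbT // mulSn addnC ltn_add2r.
  pose g (j : 'I_N) : 'I_(2 ^ L) := Ordinal (lt j).
  have ginj : injective g by move=> i j /(congr1 val) /= /eqP; rewrite eqn_add2l => /eqP/val_inj.
  rewrite -big_mkcond /= sum1_card -(card_imset _ ginj).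
  apply: fintype.subset_leq_card; apply/fintype.subsetP => i /imsetP[j hj ->].
  by rewrite inE.
have -> : \sum_(br <- Br) \sum_(t < 4) cntb L n (shift_br u ((t%:R - 1) / 2 ^+ n) br) a b =
    (\sum_(br <- Br) \sum_(t < 4) #|[set i : 'I_(2 ^ L) | S br t i]%SET|)%N%:R / 2 ^+ L.
  rewrite natr_sum mulr_suml; apply: eq_bigr => br _.
  by rewrite natr_sum mulr_suml; apply: eq_bigr => t _.
rewrite ler_pM2r ?invr_gt0 // lerBlDr -natrD ler_nat (leq_trans cG) // leq_add2r.
apply: (leq_trans step1); apply: leq_sum => br _; apply: leq_sum => t _; exact: step2.
Qed.

(** The total extent that may be charged to a square: of the branch in the column to the right (sign
    1) or left (sign -1), and of the branches with coordinates exchanged, whence the indices [b a],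
    in the row above or below. *)
Definition hit_sum (R : realType) (L n : nat) (br : brdata R) (Br : seq (brdata R)) (a b : nat) : R :=
  \sum_(sg <- [:: 1; - 1 : R])
   (\sum_(t < 4) cntb L n (shift_br (sg / 2 ^+ n) ((t%:R - 1) / 2 ^+ n) br) a b +
    \sum_(br' <- Br) \sum_(t < 4) cntb L n (shift_br (sg / 2 ^+ n) ((t%:R - 1) / 2 ^+ n) br') b a).

Lemma cntb_ge0 (R : realType) L n (br : brdata R) a b : 0 <= cntb L n br a b.
Proof. exact: cnt_ge0. Qed.

Lemma hit_sum_le (R : realType) (L n : nat) (br : brdata R) (Br : seq (brdata R)) a b (sg : R) :
  sg = 1 \/ sg = -1 ->
  \sum_(t < 4) cntb L n (shift_br (sg / 2 ^+ n) ((t%:R - 1) / 2 ^+ n) br) a b <= hit_sum L n br Br a b /\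
  \sum_(br' <- Br) \sum_(t < 4) cntb L n (shift_br (sg / 2 ^+ n) ((t%:R - 1) / 2 ^+ n) br') b a
    <= hit_sum L n br Br a b.
Proof.
have p1 s : 0 <= \sum_(t < 4) cntb L n (shift_br (s / 2 ^+ n) ((t%:R - 1) / 2 ^+ n) br) a b.
  by apply: sumr_ge0 => t _; exact: cntb_ge0.
have p2 s : 0 <= \sum_(br' <- Br) \sum_(t < 4) cntb L n (shift_br (s / 2 ^+ n) ((t%:R - 1) / 2 ^+ n) br') b a.
  by apply: sumr_ge0 => br' _; apply: sumr_ge0 => t _; exact: cntb_ge0.
rewrite /hit_sum !big_cons big_nil addr0.
have := p1 1; have := p1 (-1); have := p2 1; have := p2 (-1).
by move=> h1 h2 h3 h4 [->|->]; split; lra.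
Qed.

(* A branch meeting a square stays in the 3x3 block around it unless it crosses a neighbouring
   column, or all the heights of a neighbouring row; in the latter case one uses the branches of
   the curve with the coordinates exchanged. *)
Lemma hit_cases (R : realType) k C (P : {poly {poly R}}) (L n a b : nat) (br : brdata R)
    (cr' : seq R) (Br' : seq (brdata R)) (x0 : R) :
  (n <= L)%N -> (2 * C <= 2 ^ (L - n))%N -> (a < 2 ^ n)%N -> (b < 2 ^ n)%N ->
  good_branch k P br -> (size cr' <= C)%N ->
  (forall x y, - 4 < x -> x < 4 -> ev (swapXY P) x y = 0 -> x \in cr' \/
      exists2 br, br \in Br' & br.1.1 < x < br.1.2 /\ br.2 x = y) ->
  br.1.1 < x0 < br.1.2 -> incell n a b x0 (br.2 x0) ->
  (forall x, br.1.1 < x < br.1.2 -> (a%:R - 1) / 2 ^+ n <= x <= (a%:R + 2) / 2 ^+ n /\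
      (b%:R - 1) / 2 ^+ n <= br.2 x <= (b%:R + 2) / 2 ^+ n) \/
  (2 ^+ n)^-1 / 2 <= hit_sum L n br Br' a b.
Proof.
case: br => -[al be] phi /=; rewrite /good_branch /=.
move=> nL NC an bn [_ cont rt] crC cov /andP[x1 x2] /andP[/andP[xa xa'] /andP[yb yb']].
have n0 : 0 < 2 ^+ n :> R by rewrite exprn_gt0.
have L0 : 0 < 2 ^+ L :> R by rewrite exprn_gt0.
set r : R := (2 ^+ n)^-1 in xa xa' yb yb' *.
have r0 : 0 < r by rewrite invr_gt0.
have r1 : r <= 1 by rewrite invf_le1 // exprn_ege1 // ler1n.
have rN : r = (2 ^ (L - n))%:R / 2 ^+ L.
  rewrite /r natrX; apply: (mulIf (lt0r_neq0 L0)); rewrite divfK ?gt_eqF //.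
  by rewrite -[in LHS](subnK nL) exprD mulrCA mulVf ?mulr1 // gt_eqF.
(* At most half of the grid points of a column are lost to critical abscissas, so an extent of half
   a side remains. *)
have half M : (2 * M <= 2 ^ (L - n))%N -> r / 2 <= ((2 ^ (L - n))%:R - M%:R) / 2 ^+ L.
  move=> hM; rewrite rN mulrAC ler_pM2r ?invr_gt0 //.
  have : (2 * M)%:R <= (2 ^ (L - n))%:R :> R by rewrite ler_nat.
  by rewrite natrM; lra.
have gridE c j : (j < 2 ^ (L - n))%N -> c%:R * r <= (c * 2 ^ (L - n) + j)%:R / 2 ^+ L /\
    (c * 2 ^ (L - n) + j)%:R / 2 ^+ L < c%:R * r + r.
  move=> jN; rewrite natrD natrM mulrDl -mulrA -rN ltrD2l; split; first by rewrite lerDl divr_ge0 // ltW.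
  by rewrite [ltRHS]rN ltr_pM2r ?invr_gt0 // ltr_nat.
have ar c : (c < 2 ^ n)%N -> 0 <= c%:R * r /\ c%:R * r + r <= 1.
  move=> cn; split; first by rewrite mulr_ge0 // ltW.
  rewrite -[X in _ + X]mul1r -mulrDl natr1 /r ler_pdivrMr // mul1r -natrX ler_nat //.
have [a0 a1] := ar a an; have [b0 b1] := ar b bn.
rewrite -(natr1 a) -(natr1 b) in xa' yb'.
(* Over the three columns the branch either stays within the three rows or leaves them. In the first
   case it ends within the three columns on both sides, or it crosses a whole neighbouring
   column. *)
have [inrow|] := pselect (forall x, al < x < be -> (a%:R - 1) * r <= x <= (a%:R + 2) * r ->
    (b%:R - 1) * r <= phi x <= (b%:R + 2) * r).
- have [hbe|hbe] := ltP ((a%:R + 2) * r) be.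
    right; apply: (le_trans (half 0%N _)) => //.
    apply: le_trans (hit_sum_le L n (al, be, phi) Br' a b (or_introl erefl)).1.
    have := @grid_count R L n a b 0 (1 / 2 ^+ n) [::] [:: (al, be, phi)] nL an isT.
    rewrite big_seq1; apply => j jN; right; exists (al, be, phi); rewrite ?mem_head //=.
    have [g1 g2] := gridE a j jN; rewrite div1r -/r; split.
      by apply/andP; split; nra.
    by apply: inrow; apply/andP; split; nra.
  have [hal|hal] := ltP al ((a%:R - 1) * r).
    right; apply: (le_trans (half 0%N _)) => //.
    apply: le_trans (hit_sum_le L n (al, be, phi) Br' a b (or_intror erefl)).1.
    have := @grid_count R L n a b 0 (- 1 / 2 ^+ n) [::] [:: (al, be, phi)] nL an isT.
    rewrite big_seq1; apply => j jN; right; exists (al, be, phi); rewrite ?mem_head //=.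
    have [g1 g2] := gridE a j jN; rewrite mulNr div1r -/r; split.
      by apply/andP; split; nra.
    by apply: inrow; apply/andP; split; nra.
  left => x xI; have xw : (a%:R - 1) * r <= x <= (a%:R + 2) * r.
    by move/andP: xI => [u v]; apply/andP; split; [exact: le_trans hal (ltW u)|exact: le_trans (ltW v) hbe].
  by split => //; exact: inrow.
move=> /existsNP[z /not_implyP[/andP[z1 z2] /not_implyP[/andP[za za'] /negP zn]]].
right; apply: (le_trans (half C NC)).
(* The branch has left the three rows at [z]: between [x0] and [z] it takes all heights of a
   neighbouring row, at abscissas within the three columns. *)
have ivt y : Num.min (phi x0) (phi z) <= y <= Num.max (phi x0) (phi z) ->
    exists x, [/\ phi x = y, (a%:R - 1) * r <= x <= (a%:R + 2) * r & al < x < be].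
  move=> hy; have cw u v : al < u -> v < be -> {within `[u, v], continuous phi}.
    move=> u1 v1; apply: continuous_in_subspaceT => x; rewrite inE /= in_itv /= => /andP[ux xv].
    by apply: cont; rewrite (lt_le_trans u1) // (le_lt_trans xv).
  have [xz|zx] := leP x0 z.
    have [x] := IVT xz (cw _ _ x1 z2) hy; rewrite in_itv /= => /andP[c1 c2] e.
    by exists x; split => //; apply/andP; split; nra.
  rewrite minC maxC in hy; have [x] := IVT (ltW zx) (cw _ _ z1 x2) hy.
  rewrite in_itv /= => /andP[c1 c2] e.
  by exists x; split => //; apply/andP; split; nra.
have key sg : sg = 1 \/ sg = - 1 -> (forall y, (b%:R + sg) * r <= y -> y <= (b%:R + sg + 1) * r ->
    Num.min (phi x0) (phi z) <= y <= Num.max (phi x0) (phi z)) ->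
    ((2 ^ (L - n))%:R - C%:R) / 2 ^+ L <= hit_sum L n (al, be, phi) Br' a b.
  move=> hsg hy; apply: le_trans (hit_sum_le L n (al, be, phi) Br' a b hsg).2.
  apply: (@grid_count R L n b a C (sg / 2 ^+ n) cr' Br' nL bn crC) => j jN.
  have [g1 g2] := gridE b j jN; rewrite -/r; set y := _ / 2 ^+ L + sg * r.
  have y1 : (b%:R + sg) * r <= y by rewrite mulrDl lerD2r.
  have y2 : y <= (b%:R + sg + 1) * r by rewrite /y; nra.
  have [x [xy xw xI]] := ivt y (hy y y1 y2).
  have y4 : - 4 < y /\ y < 4.
    by case: hsg => e; rewrite e in y1 y2; split; nra.
  have [|yc|[br brB [h1 h2]]] := cov y x y4.1 y4.2; [by rewrite ev_swapXY -xy rt|by left|].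
  by right; exists br; rewrite // h2; split.
have [zlo|zhi] := ltP (phi z) ((b%:R - 1) * r).
  apply: (key (-1)); first by right.
  by move=> y y1 y2; rewrite ge_min le_max; apply/andP; split; apply/orP; [right|left]; nra.
have zhi' : (b%:R + 2) * r < phi z by rewrite ltNge; apply: contra zn => h; rewrite zhi.
apply: (key 1); first by left.
by move=> y y1 y2; rewrite ge_min le_max; apply/andP; split; apply/orP; [left|right]; nra.
Qed.

Lemma near_count (d m : nat) (Z : seq (idx d)) (c : 'I_d -> nat) : uniq Z ->
  (forall z i, z \in Z -> (c i <= z i + m)%N /\ (z i <= c i + m)%N) -> (size Z <= (2 * m).+1 ^ d)%N.
Proof.
move=> uZ h; pose g (z : idx d) : {ffun 'I_d -> 'I_(2 * m).+1} := [ffun i => inord (z i + m - c i)].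
have ginj : {in Z &, injective g}.
  move=> z z' zZ z'Z e; apply/ffunP => i; have := congr1 (fun q : {ffun 'I_d -> 'I_(2 * m).+1} => nat_of_ord (q i)) e.
  rewrite !ffunE; have [h1 h2] := h z i zZ; have [h3 h4] := h z' i z'Z.
  by rewrite !inordK; move: (z i) (z' i) (c i) h1 h2 h3 h4; clear; lia.
rewrite -(size_map g) -[X in (X ^ _)%N]card_ord -[X in (_ ^ X)%N](card_ord d) -card_ffun cardE.
apply: uniq_leq_size; first by rewrite map_inj_in_uniq.
by move=> q _; rewrite mem_enum.
Qed.

Lemma filter_cover (T U : eqType) (Z : seq T) (l : seq U) (A : pred T) (B : U -> pred T) :
  (forall z, z \in Z -> A z -> exists2 u, u \in l & B u z) ->
  (size (seq.filter A Z) <= \sum_(u <- l) size (seq.filter (B u) Z))%N.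
Proof.
elim: Z => [|z Z IH] h; first by [].
have {}IH := IH (fun z' z'Z => h z' (mem_behead (s := z :: Z) z'Z)).
have -> : (\sum_(u <- l) size (seq.filter (B u) (z :: Z)) =
    \sum_(u <- l) B u z + \sum_(u <- l) size (seq.filter (B u) Z))%N.
  by rewrite -big_split; apply: eq_bigr => u _ /=; case: (B u z).
rewrite /=; case: ifP => Az; last exact: leq_trans IH (leq_addl _ _).
rewrite /= -add1n leq_add //; have [u ul Bu] := h z (mem_head _ _) Az.
by rewrite (big_rem u) //= Bu.
Qed.

Lemma sum_le_size (R : realType) (T : eqType) (l : seq T) (F : T -> R) (B : R) :
  (forall x, x \in l -> F x <= B) -> \sum_(x <- l) F x <= (size l)%:R * B.
Proof.
move=> h; rewrite -sum1_size natr_sum mulr_suml big_seq [leRHS]big_seq.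
by apply: ler_sum => x xl; rewrite mul1r h.
Qed.

(** Two directions, four shifts, and one plus [size Br] branches give the constant; each of these
    families of extents is summed over all squares at once. *)
Lemma sum_hit_sum (R : realType) (L n : nat) (Z : seq (idx 2)) (br : brdata R) (Br : seq (brdata R)) (B : R) :
  (forall u v, extent L n Z false (shift_br u v br).1.1 (shift_br u v br).1.2 (shift_br u v br).2 <= B) ->
  (forall u v br', br' \in Br ->
     extent L n Z true (shift_br u v br').1.1 (shift_br u v br').1.2 (shift_br u v br').2 <= B) ->
  \sum_(z <- Z) hit_sum L n br Br (z ord0) (z ord_max) <= (8 * (size Br).+1)%:R * B.
Proof.
move=> h1 h2; rewrite /hit_sum exchange_big /=.
have c4 (F : 'I_4 -> R) : (forall t, F t <= B) -> \sum_(t < 4) F t <= 4%:R * B.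
  move=> hF; apply: (le_trans (ler_sum _ (fun t _ => hF t))).
  by rewrite sumr_const card_ord mulr_natl.
have each sg : \sum_(z <- Z) (\sum_(t < 4) cntb L n (shift_br (sg / 2 ^+ n) ((t%:R - 1) / 2 ^+ n) br) (z ord0) (z ord_max) +
    \sum_(br' <- Br) \sum_(t < 4) cntb L n (shift_br (sg / 2 ^+ n) ((t%:R - 1) / 2 ^+ n) br') (z ord_max) (z ord0))
    <= (4 * (size Br).+1)%:R * B.
  rewrite big_split /= exchange_big /= [X in _ + X]exchange_big /= mulnS natrD mulrDl lerD //.
    by apply: c4 => t; exact: h1.
  rewrite natrM [4 * _]mulrC -mulrA; apply: sum_le_size => br' br'B.
  by rewrite exchange_big /=; apply: c4 => t; exact: h2.
rewrite !big_cons big_nil addr0.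
have -> : (8 * (size Br).+1)%:R = (4 * (size Br).+1)%:R + (4 * (size Br).+1)%:R :> R.
  by rewrite -natrD; congr _%:R; lia.
by rewrite mulrDl lerD.
Qed.

Definition hit (R : realType) (n : nat) (P : {poly {poly R}}) (z : idx 2) : bool :=
  `[< exists x y, incell n (z ord0) (z ord_max) x y /\ ev P x y = 0 >].

Lemma incell_near (R : realType) (n a b a' b' : nat) (x y x' y' : R) :
  incell n a b x y -> incell n a' b' x' y' ->
  (a%:R - 1) / 2 ^+ n <= x' <= (a%:R + 2) / 2 ^+ n /\
  (b%:R - 1) / 2 ^+ n <= y' <= (b%:R + 2) / 2 ^+ n ->
  [/\ (a <= a' + 2)%N, (a' <= a + 2)%N, (b <= b' + 2)%N & (b' <= b + 2)%N].
Proof.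
have n0 : 0 < 2 ^+ n :> R by rewrite exprn_gt0.
move=> _ /andP[/andP[x1 x2] /andP[y1 y2]] [/andP[x3 x4] /andP[y3 y4]].
have cmp (u v : R) : u / 2 ^+ n <= v / 2 ^+ n -> u <= v by rewrite ler_pM2r // invr_gt0.
have := cmp _ _ (le_trans x1 x4); have := cmp _ _ (le_trans x3 x2).
have := cmp _ _ (le_trans y1 y4); have := cmp _ _ (le_trans y3 y2).
rewrite -(natr1 a') -(natr1 b') => h1 h2 h3 h4.
by split; rewrite -(ler_nat R) natrD; lra.
Qed.

Lemma near_count2 (Z : seq (idx 2)) (z0 : idx 2) : uniq Z ->
  (forall z, z \in Z -> [/\ (z0 ord0 <= z ord0 + 2)%N, (z ord0 <= z0 ord0 + 2)%N,
    (z0 ord_max <= z ord_max + 2)%N & (z ord_max <= z0 ord_max + 2)%N]) -> (size Z <= 25)%N.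
Proof.
move=> uZ h; apply: (@near_count 2 2 Z z0 uZ) => z i /h[h1 h2 h3 h4].
have [->|->] : i = ord0 \/ i = ord_max; last by split.
  by case: i => -[|[|m]] //= im; [left|right]; apply: val_inj.
by split.
Qed.

(** Serves for a vertical line contained in the curve, which becomes this horizontal branch when the
    coordinates are exchanged. *)
Lemma branch_const (R : realType) (k : nat) (c al be : R) : (0 < k)%N ->
  branch k ('X - c%:P%:P) (sign_code k.+1 ('X - c%:P) c) al be (fun=> c).
Proof.
move=> k0.
have sp x : spec ('X - c%:P%:P) x = 'X - c%:P.
  by rewrite /spec rmorphB /= map_polyX map_polyC /= /horner_eval hornerC.
split.
- apply/andP; split; first by rewrite size_XsubC.
  apply/sizeY_leP => i; rewrite coefB coefX coefC.
  case: i => [|[|i]] /=; rewrite ?sub0r ?subr0 ?size_polyN ?size_poly0 ?size_poly1 //.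
  by rewrite (leq_trans (size_polyC_leq1 _)).
- by rewrite sign_code_nth //= hornerXsubC subrr sgr0.
- by rewrite sign_code_nth ?ltnS // derivn1 derivXsubC hornerC sgr1 oner_eq0.
- by move=> x _; rewrite sp.
- by left.
Qed.

(** For each branch, either it lies entirely in the 3x3 block around one square and meets at most 25
    squares, or every square it meets is charged an extent of half a side, while the total extent is
    bounded by hypothesis. Over a critical abscissa the curve contains the whole vertical line or
    has at most k + 1 points. *)
Lemma hits_bound (R : realType) (k : nat) : (0 < k)%N -> exists C Kc : nat, (3 <= Kc)%N /\
  forall (n : nat) (Z : seq (idx 2)) (w Lam : R), uniq Z ->
    (forall z i, z \in Z -> (z i < 2 ^ n)%N) -> 0 < w -> 0 < Lam ->
    (forall sw f s al be phi, branch k f s al be phi ->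
      w * extent (Kc * n.+1) n Z sw al be phi <= Lam) ->
    forall P : {poly {poly R}}, P != 0 -> bideg k P ->
      (size (seq.filter (hit n P) Z))%:R <= C%:R * (1 + 2 ^+ n * (Lam / w)).
Proof.
move=> k0; have [C hC] := branch_cover R k.
pose C3 := (C * (25 + 16 * C.+1) + C * (25 * k.+1 + 4))%N.
(* The summand [C] makes the grid fine enough for [2 * C <= 2 ^ (L - n)], the summand 3 makes the
   grid errors summable. *)
exists C3, (C + 3)%N; split; first by rewrite leq_addl.
move=> n Z w Lam uZ Zn w0 Lam0 hext P P0 kP.
set L := ((C + 3) * n.+1)%N in hext.
have nL : (n <= L)%N by rewrite /L; nia.
have NC : (2 * C <= 2 ^ (L - n))%N.
  apply: (@leq_trans (2 ^ C.+1)); last by rewrite leq_exp2l // /L; nia.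
  by rewrite expnS leq_mul2l /= ltnW // ltn_expl.
have n0 : 0 < 2 ^+ n :> R by rewrite exprn_gt0.
have L0 : 0 < 2 ^+ L :> R by rewrite exprn_gt0.
pose X := 2 ^+ n * (Lam / w).
have X0 : 0 < X by rewrite !mulr_gt0 // invr_gt0.
have hext' sw f s al be phi : branch k f s al be phi -> extent L n Z sw al be phi <= Lam / w.
  by move=> /(hext sw); rewrite ler_pdivlMr // mulrC.
have [cr [Br [scr sBr gBr cov]]] := hC P P0 kP.
have sP0 : swapXY P != 0 by rewrite swapXY_eq0.
have [cr' [Br' [scr' sBr' gBr' cov']]] := hC (swapXY P) sP0 (etrans (bideg_swap _ _) kP).
pose hbr (br : brdata R) (z : idx 2) : bool :=
  `[< exists x, br.1.1 < x < br.1.2 /\ incell n (z ord0) (z ord_max) x (br.2 x) >].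
pose hcr (c : R) (z : idx 2) : bool :=
  `[< exists y, incell n (z ord0) (z ord_max) c y /\ ev P c y = 0 >].
have hbr_le br : br \in Br -> (size (seq.filter (hbr br) Z))%:R <= (25 + 16 * C.+1)%:R * (1 + X).
  move=> brB; have gb := gBr br brB.
  have [[z0 [z0Z [x0 [x0I z0c]] D]]|nD] := pselect (exists z, [/\ z \in Z,
     exists x, br.1.1 < x < br.1.2 /\ incell n (z ord0) (z ord_max) x (br.2 x) &
     forall x, br.1.1 < x < br.1.2 -> ((z ord0)%:R - 1) / 2 ^+ n <= x <= ((z ord0)%:R + 2) / 2 ^+ n /\
      ((z ord_max)%:R - 1) / 2 ^+ n <= br.2 x <= ((z ord_max)%:R + 2) / 2 ^+ n]).
    have : (size (seq.filter (hbr br) Z) <= 25)%N.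
      apply: (@near_count2 _ z0); first exact: filter_uniq.
      move=> z; rewrite mem_filter => /andP[/asboolP[x [xI zc]] _].
      exact: incell_near z0c zc (D x xI).
    rewrite -(ler_nat R) => /le_trans; apply.
    have : 0 <= (16 * C.+1)%:R * (1 + X) by rewrite mulr_ge0 // addr_ge0 // ltW.
    by rewrite natrD mulrDl; lra.
  have each z : z \in seq.filter (hbr br) Z -> (2 ^+ n)^-1 / 2 <= hit_sum L n br Br' (z ord0) (z ord_max).
    rewrite mem_filter => /andP[/asboolP[x [xI zc]] zZ].
    have [D|//] := @hit_cases R k C P L n (z ord0) (z ord_max) br cr' Br' x nL NC (Zn _ _ zZ)
      (Zn _ _ zZ) gb scr' cov' xI zc.
    by case: nD; exists z; split => //; exists x.
  have sumle : \sum_(z <- seq.filter (hbr br) Z) hit_sum L n br Br' (z ord0) (z ord_max) <=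
      (8 * (size Br').+1)%:R * (Lam / w).
    apply: (@le_trans _ _ (\sum_(z <- Z) hit_sum L n br Br' (z ord0) (z ord_max))).
      rewrite big_filter [leRHS](bigID (hbr br)) /= lerDl sumr_ge0 // => z _.
      have [] := hit_sum_le L n br Br' (z ord0) (z ord_max) (or_introl erefl).
      move=> h _; apply: le_trans h; apply: sumr_ge0 => t _; exact: cntb_ge0.
    apply: sum_hit_sum => u v.
      have [[f [s bf]] _ _] := gb; apply: hext'; exact: branch_shift bf.
    move=> br' /gBr'[[f [s bf]] _ _]; apply: hext'; exact: branch_shift bf.
  have : (size (seq.filter (hbr br) Z))%:R * ((2 ^+ n)^-1 / 2) <= (8 * (size Br').+1)%:R * (Lam / w).
    apply: le_trans sumle; rewrite -sum1_size natr_sum mulr_suml big_seq [leRHS]big_seq.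
    by apply: ler_sum => z zf; rewrite [leLHS]mul1r; exact: each.
  rewrite mulrA ler_pdivrMr // ler_pdivrMr // => h; apply: (le_trans h).
  have -> : (8 * (size Br').+1)%:R * (Lam / w) * 2 * 2 ^+ n = (16 * (size Br').+1)%:R * X.
    have -> : (16 * (size Br').+1)%N = (8 * (size Br').+1 * 2)%N by rewrite mulnAC.
    by rewrite (natrM _ _ 2) /X; ring.
  apply: (@le_trans _ _ ((25 + 16 * C.+1)%:R * X)).
    by rewrite ler_pM2r // ler_nat (leq_trans _ (leq_addl _ _)) // leq_mul2l ltnS.
  by rewrite ler_wpM2l // lerDr.
have hcr_le c : c \in cr -> (size (seq.filter (hcr c) Z))%:R <= (25 * k.+1 + 4)%:R * (1 + X).
  move=> _; have [sp0|sp0] := eqVneq (spec P c) 0; last first.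
    have [ys [sys hys]] := root_list sp0.
    have szk : (size ys <= k.+1)%N.
      have /andP[kf1 _] := kP; exact: leq_trans (ltnW sys) (leq_trans (size_spec _ _) kf1).
    pose B (y : R) (z : idx 2) := incell n (z ord0) (z ord_max) c y.
    have cv z : z \in Z -> hcr c z -> exists2 y, y \in ys & B y z.
      by move=> _ /asboolP[y [zc Py]]; exists y => //; apply: hys; rewrite spec_horner.
    have : (size (seq.filter (hcr c) Z) <= 25 * k.+1)%N.
      apply: (leq_trans (filter_cover cv)).
      apply: (@leq_trans (\sum_(y <- ys) 25)); last by rewrite big_const_seq count_predT iter_addn_0 leq_mul2l.
      apply: leq_sum => y _.
      case E : (seq.filter (B y) Z) => [//|z0 Z']; rewrite -E.
      have z0f : z0 \in seq.filter (B y) Z by rewrite E mem_head.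
      rewrite mem_filter in z0f; have /andP[z0c z0Z] := z0f.
      apply: (@near_count2 _ z0); first exact: filter_uniq.
      move=> z; rewrite mem_filter => /andP[zc _]; apply: (incell_near z0c zc).
      move: z0c => /andP[/andP[x1 x2] /andP[y1 y2]].
      have i0 : 0 < (2 ^+ n)^-1 :> R by rewrite invr_gt0.
      rewrite -(natr1 (z0 ord0)) in x2; rewrite -(natr1 (z0 ord_max)) in y2.
      by split; apply/andP; split; nra.
    rewrite -(ler_nat R) => /le_trans; apply.
    rewrite -[leLHS]mulr1; apply: ler_pM => //; first by rewrite ler_nat leq_addr.
    by rewrite lerDl ltW.
  (* The vertical line at c with exchanged coordinates. A square it meets is charged a full side,
     after a horizontal shift that brings the line into the half-open square. *)
  pose br0 : brdata R := (- 4, 4, fun=> c).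
  have each z : z \in seq.filter (hcr c) Z -> (2 ^+ n)^-1 <=
      \sum_(t < 4) cntb L n (shift_br (1 / 2 ^+ n) ((t%:R - 1) / 2 ^+ n) br0) (z ord_max) (z ord0).
    rewrite mem_filter => /andP[/asboolP[y [/andP[/andP[x1 x2] _] _]] zZ].
    have := @grid_count R L n (z ord_max) (z ord0) 0 (1 / 2 ^+ n) [::] [:: br0] nL (Zn _ _ zZ) isT.
    rewrite big_seq1 subr0; move=> H; apply: le_trans (H _).
      rewrite natrX ler_pdivlMr // -[in leLHS](subnK nL) exprD mulrCA mulVf ?mulr1 // gt_eqF //.
    have i0 : 0 < (2 ^+ n)^-1 :> R by rewrite invr_gt0.
    move=> j jN; right; exists br0; rewrite ?mem_head //=; split; last first.
      by rewrite -(natr1 (z ord0)) in x2; apply/andP; split; nra.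
    set g : R := _ / 2 ^+ L.
    have g0 : 0 <= g by rewrite /g divr_ge0 // ltW.
    have g1 : g <= 1.
      rewrite /g ler_pdivrMr // mul1r -natrX ler_nat.
      have -> : (2 ^ L = 2 ^ n * 2 ^ (L - n))%N by rewrite -expnD subnKC.
      apply: (@leq_trans ((z ord_max).+1 * 2 ^ (L - n))).
        by rewrite mulSn addnC leq_add2r ltnW.
      by rewrite leq_mul2r Zn ?orbT.
    have i1 : 1 / 2 ^+ n <= 1 :> R by rewrite div1r invf_le1 // exprn_ege1 // ler1n.
    have i2 : 0 <= 1 / 2 ^+ n :> R by rewrite divr_ge0 // ltW.
    by apply/andP; split; lra.
  have sumle : \sum_(z <- seq.filter (hcr c) Z)
      \sum_(t < 4) cntb L n (shift_br (1 / 2 ^+ n) ((t%:R - 1) / 2 ^+ n) br0) (z ord_max) (z ord0)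
      <= 4%:R * (Lam / w).
    apply: (@le_trans _ _ (\sum_(z <- Z)
      \sum_(t < 4) cntb L n (shift_br (1 / 2 ^+ n) ((t%:R - 1) / 2 ^+ n) br0) (z ord_max) (z ord0))).
      rewrite big_filter [leRHS](bigID (hcr c)) /= lerDl sumr_ge0 // => z _.
      by apply: sumr_ge0 => t _; exact: cntb_ge0.
    rewrite exchange_big /= -[X in X%:R * _](size_enum_ord 4) -big_enum; apply: sum_le_size => t _.
    exact: (@hext' true _ _ _ _ _ (branch_shift _ _ (branch_const c (- 4) 4 k0))).
  have : (size (seq.filter (hcr c) Z))%:R * (2 ^+ n)^-1 <= 4%:R * (Lam / w).
    apply: le_trans sumle; rewrite -sum1_size natr_sum mulr_suml big_seq [leRHS]big_seq.
    by apply: ler_sum => z zf; rewrite [leLHS]mul1r; exact: each.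
  rewrite ler_pdivrMr // => h; apply: (le_trans h).
  have -> : 4%:R * (Lam / w) * 2 ^+ n = 4%:R * X by rewrite /X; ring.
  apply: (@le_trans _ _ ((25 * k.+1 + 4)%:R * X)).
    by rewrite ler_pM2r // ler_nat leq_addl.
  by rewrite ler_wpM2l // lerDr.
have cover : (size (seq.filter (hit n P) Z) <= \sum_(br <- Br) size (seq.filter (hbr br) Z) +
    \sum_(c <- cr) size (seq.filter (hcr c) Z))%N.
  have := @filter_cover _ _ Z ([seq inl br | br <- Br] ++ [seq inr c | c <- cr]) (hit n P)
    (fun u => match u with inl br => hbr br | inr c => hcr c end).
  rewrite big_cat !big_map /=; apply => z zZ /asboolP[x [y [zc Py]]].
  have /andP[/andP[x1 x2] _] := zc.
  have z0 : 0 <= (z ord0)%:R / 2 ^+ n :> R by rewrite divr_ge0 // ltW.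
  have z1 : (z ord0).+1%:R / 2 ^+ n <= 1 :> R by rewrite ler_pdivrMr // mul1r -natrX ler_nat Zn.
  have [||xc|[br brB [h1 h2]]] := cov x y _ _ Py; [lra|lra| |].
    exists (inr x); first by rewrite mem_cat map_f ?orbT.
    by apply/asboolP; exists y.
  exists (inl br); first by rewrite mem_cat map_f.
  by apply/asboolP; exists x; rewrite h2.
rewrite -(ler_nat R) in cover; apply: (le_trans cover); rewrite natrD !natr_sum -/X.
apply: (@le_trans _ _ ((size Br)%:R * ((25 + 16 * C.+1)%:R * (1 + X)) +
   (size cr)%:R * ((25 * k.+1 + 4)%:R * (1 + X)))).
  by apply: lerD; apply: sum_le_size.
have X1 : 0 <= 1 + X by rewrite addr_ge0 // ltW.
rewrite /C3; move: (25 + 16 * C.+1)%N (25 * k.+1 + 4)%N => a b.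
by rewrite natrD mulrDl !natrM -!mulrA; apply: lerD; apply: ler_wpM2r; rewrite ?ler_nat ?mulr_ge0.
Qed.

(** * Arcs *)

(** Each chord is bounded by an increment of [g], and the increments telescope. For a monotone
    graph, [g] is x + psi x or x - psi x. *)
Lemma path_length_le (R : realType) (d : nat) (a b : R) (f : R -> 'rV[R]_d) (g : R -> R) :
  (forall x y, a <= x -> x <= y -> y <= b -> enorm (f y - f x) <= g y - g x) ->
  (path_length a b f <= (g b - g a)%:E)%E.
Proof.
move=> h; apply: ge_ereal_sup => _ [s sp <-]; rewrite lee_fin.
elim: s a h sp => [|x s IH] a h [ps ls].
  by rewrite big_nil -(eqP ls) subrr.
have /itv_partition_cons xs : itv_partition a b (x :: s) by [].
move: ps => /= /andP[ax _]; have xb := itv_partition_le xs.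
rewrite big_nat_recl //=; have -> : g b - g a = (g x - g a) + (g b - g x) by ring.
apply: lerD; first exact: h (lexx a) (ltW ax) xb.
by apply: IH => // y z xy; apply: h; exact: le_trans (ltW ax) xy.
Qed.

(** A branch lives over an open interval, whereas arcs are parametrized by closed ones. By
    monotonicity and boundedness the one-sided limits exist; they are taken as end values, and agree
    with [phi] at an end interior to its domain. *)
Lemma nondecreasing_extension (R : realType) (al be u v m M : R) (phi : R -> R) :
  u < v -> al <= u -> v <= be ->
  (forall x, al < x < be -> {for x, continuous phi}) ->
  (forall x y, al < x -> x <= y -> y < be -> phi x <= phi y) ->
  (forall x, u < x < v -> m <= phi x <= M) ->
  exists psi : R -> R, [/\ {within `[u, v], continuous psi},
    forall x, al < x < be -> u <= x <= v -> psi x = phi x,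
    forall x y, u <= x -> x <= y -> y <= v -> psi x <= psi y &
    forall x, u <= x <= v -> m <= psi x <= M].
Proof.
move=> uv alu vbe cphi mon bnd.
have uvin x : u < x < v -> al < x < be.
  by move=> /andP[ux xv]; rewrite (le_lt_trans alu ux) (lt_le_trans xv vbe).
have bm x : u < x < v -> m <= phi x by move=> /bnd/andP[].
have bM x : u < x < v -> phi x <= M by move=> /bnd/andP[].
have c1 : cvg (phi x @[x --> u^'+]).
  apply: nondecreasing_at_right_is_cvgr.
    near=> w => x y; rewrite !in_itv /= => /andP[ux xw] /andP[uy yw] xy.
    apply: mon => //; first exact: le_lt_trans alu ux.
    apply: lt_le_trans vbe; apply: (lt_trans yw); near: w; exact: nbhs_right_lt.
  near=> w; exists m => _ [x /= + <-]; rewrite in_itv /= => /andP[ux xw].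
  apply: bm; rewrite ux (lt_trans xw) //; near: w; exact: nbhs_right_lt.
have c2 : cvg (phi x @[x --> v^'-]).
  apply: nondecreasing_at_left_is_cvgr.
    near=> w => x y; rewrite !in_itv /= => /andP[wx xv] /andP[wy yv] xy.
    apply: mon => //; last exact: lt_le_trans yv vbe.
    apply: (le_lt_trans alu); apply: lt_trans wx; near: w; exact: nbhs_left_gt.
  near=> w; exists M => _ [x /= + <-]; rewrite in_itv /= => /andP[wx xv].
  apply: bM; rewrite xv andbT (lt_trans _ wx) //; near: w; exact: nbhs_left_gt.
set L1 : R := lim (phi x @[x --> u^'+]) in c1.
set L2 : R := lim (phi x @[x --> v^'-]) in c2.
have b1 x : u < x < v -> L1 <= phi x.
  move=> /andP[ux xv]; apply: (limr_le c1); near=> w; apply: mon.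
  - by apply: (le_lt_trans alu); near: w; exact: nbhs_right_gt.
  - by apply: ltW; near: w; exact: nbhs_right_lt.
  - exact: lt_le_trans xv vbe.
have b2 x : u < x < v -> phi x <= L2.
  move=> /andP[ux xv]; apply: (limr_ge c2); near=> w; apply: mon.
  - exact: le_lt_trans alu ux.
  - by apply: ltW; near: w; exact: nbhs_left_gt.
  - by apply: lt_le_trans vbe; near: w; exact: nbhs_left_lt.
have m1 : m <= L1.
  apply: (limr_ge c1); near=> w; apply: bm; apply/andP; split.
    by near: w; exact: nbhs_right_gt.
  by near: w; exact: nbhs_right_lt.
have m2 : L2 <= M.
  apply: (limr_le c2); near=> w; apply: bM; apply/andP; split.
    by near: w; exact: nbhs_left_gt.
  by near: w; exact: nbhs_left_lt.
have L12 : L1 <= L2.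
  have mid : u < (u + v) / 2 < v by rewrite midf_lt //= midf_lt.
  exact: le_trans (b1 _ mid) (b2 _ mid).
pose psi (x : R) : R := if x <= u then L1 else if v <= x then L2 else phi x.
have psi_in x : u < x < v -> psi x = phi x.
  by move=> /andP[ux xv]; rewrite /psi !leNgt ux xv.
have psi_u : psi u = L1 by rewrite /psi lexx.
have psi_v : psi v = L2 by rewrite /psi leNgt uv lexx.
have psi_bd x : u <= x <= v -> L1 <= psi x <= L2.
  rewrite /psi; case: (leP x u) => [_ _|ux /andP[_ xv]]; first by rewrite lexx.
  by case: (leP v x) => vx; [rewrite L12 lexx|rewrite b1 ?ux // b2 ?ux].
exists psi; split.
- apply/continuous_within_itvP => //; split.
  + move=> x xuv; have xuv' : u < x < v by move: xuv; rewrite in_itv.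
    rewrite /continuous_at psi_in //; apply: cvg_trans (cphi x (uvin x xuv')); apply: near_eq_cvg.
    by apply: filterS (near_in_itvoo xuv) => y; rewrite in_itv => /psi_in.
  + rewrite psi_u; apply: cvg_trans c1; apply: near_eq_cvg; near=> y; apply/esym/psi_in.
    by apply/andP; split; near: y; [exact: nbhs_right_gt|exact: nbhs_right_lt].
  + rewrite psi_v; apply: cvg_trans c2; apply: near_eq_cvg; near=> y; apply/esym/psi_in.
    by apply/andP; split; near: y; [exact: nbhs_left_gt|exact: nbhs_left_lt].
- move=> x xab /andP[]; rewrite le_eqVlt => /orP[/eqP ux _|ux].
    rewrite -ux psi_u; apply/cvg_lim => //; apply: cvg_at_right_filter; apply: cphi.
    by rewrite ux.
  rewrite le_eqVlt => /orP[/eqP xv|xv]; last by rewrite psi_in // ux.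
  rewrite xv psi_v; apply/cvg_lim => //; apply: cvg_at_left_filter; apply: cphi.
  by rewrite -xv.
- move=> x y ux xy yv.
  have /andP[_ hx] : L1 <= psi x <= L2 by apply: psi_bd; rewrite ux (le_trans xy).
  have /andP[hy0 _] : L1 <= psi y <= L2 by apply: psi_bd; rewrite yv (le_trans ux).
  have [yu|uy] := leP y u; first by have -> : x = y by (apply/eqP; rewrite eq_le xy (le_trans yu ux)).
  have [vx|xv] := leP v x; first by have -> : x = y by (apply/eqP; rewrite eq_le xy (le_trans yv vx)).
  have [xu|ux'] := leP x u; first by move: hy0; rewrite {2}/psi xu.
  have [vy|yv'] := leP v y; first by rewrite {2}/psi [y <= u]leNgt uy vy.
  rewrite !psi_in ?ux' ?uy //; apply: mon => //; first exact: le_lt_trans alu ux'.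
  exact: lt_le_trans yv' vbe.
- by move=> x /psi_bd /andP[h1 h2]; rewrite (le_trans m1 h1) (le_trans h2 m2).
Unshelve. all: by end_near. Qed.

Definition pt (R : realType) (x y : R) : 'rV[R]_2 := x *: delta_mx 0 ord0 + y *: delta_mx 0 ord_max.

Lemma pt0 (R : realType) (x y : R) : pt x y 0 ord0 = x.
Proof. by rewrite !mxE /= mulr1 mulr0 addr0. Qed.

Lemma pt1 (R : realType) (x y : R) : pt x y 0 ord_max = y.
Proof. by rewrite !mxE /= mulr1 mulr0 add0r. Qed.

Lemma ptE (R : realType) (z : 'rV[R]_2) : z = pt (z 0 ord0) (z 0 ord_max).
Proof.
apply/rowP => i; have [->|->] : i = ord0 \/ i = ord_max; last by rewrite pt1.
  by case: i => -[|[|m]] //= im; [left|right]; apply: val_inj.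
by rewrite pt0.
Qed.

Lemma enorm_pt_le (R : realType) (x y x' y' : R) : enorm (pt x' y' - pt x y) <= `|x' - x| + `|y' - y|.
Proof.
rewrite /enorm big_ord_recl big_ord1 !mxE /= !mulr1 !mulr0 !addr0 !add0r.
rewrite -ler_sqr ?nnegrE ?sqrtr_ge0 ?addr_ge0 // sqr_sqrtr ?addr_ge0 ?sqr_ge0 //.
rewrite -(real_normK (num_real (x' - x))) -(real_normK (num_real (y' - y))).
move: `|x' - x| `|y' - y| (normr_ge0 (x' - x)) (normr_ge0 (y' - y)) => p q p0 q0; nra.
Qed.

Lemma pt_continuous (R : realType) (A : set R) (f g : R -> R) :
  {within A, continuous f} -> {within A, continuous g} -> {within A, continuous (fun t => pt (f t) (g t))}.
Proof. by move=> cf cg x; apply: cvgD; (apply: cvgZ; last exact: cvg_cst); [exact: cf|exact: cg]. Qed.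

Definition zeros (R : realType) (P : {poly {poly R}}) : set 'rV[R]_2 :=
  [set z | ev P (z 0 ord0) (z 0 ord_max) = 0].

Lemma curve_interval_pt (R : realType) (P : {poly {poly R}}) (x y r : R) : 0 <= r ->
  ev P x y = 0 -> curve_interval (zeros P) r [set pt x y].
Proof.
move=> r0 Pxy; split; first by move=> _ ->; rewrite /zeros /= pt0 pt1.
have i00 (t : R) : t \in `[0, 0] -> t = 0.
  by rewrite in_itv /= => h; apply/eqP; rewrite eq_le andbC.
exists 0, 0, (fun=> pt x y); split => //.
- by move=> t; exact: cvg_cst.
- by move=> t t' /i00 -> /i00 ->.
- rewrite eqEsubset; split; last by move=> _ [t _ <-].
  by move=> _ ->; exists 0 => //=; rewrite in_itv /= lexx.
- apply: (@le_trans _ _ (0 - 0)%:E).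
    apply: (@path_length_le R 2 0 0 (fun=> pt x y) (fun=> 0)) => t t' _ _ _; rewrite !subrr /enorm big1 ?sqrtr0 // => i _.
    by rewrite mxE expr0n.
  by rewrite subrr lee_fin.
Qed.

Lemma curve_interval_vertical (R : realType) (P : {poly {poly R}}) (x m M : R) : m <= M ->
  (forall y, ev P x y = 0) -> curve_interval (zeros P) (M - m) (pt x @` `[m, M]).
Proof.
move=> mM Px; split; first by move=> _ [y _ <-]; rewrite /zeros /= pt0 pt1.
exists m, M, (pt x); split => //.
- by apply: (@pt_continuous R `[m, M] (fun=> x) id); apply: continuous_subspaceT => t; [exact: cvg_cst|exact: cvg_id].
- by move=> t t' _ _ /(congr1 (fun z : 'rV[R]_2 => z 0 ord_max)); rewrite !pt1.
- apply: (@path_length_le _ _ _ _ _ id) => t t' _ tt' _.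
  by apply: le_trans (enorm_pt_le _ _ _ _) _; rewrite subrr normr0 add0r ger0_norm // subr_ge0.
Qed.

Lemma curve_interval_graph (R : realType) (P : {poly {poly R}}) (u v m M : R) (psi : R -> R) :
  u <= v -> {within `[u, v], continuous psi} ->
  ((forall x y, u <= x -> x <= y -> y <= v -> psi x <= psi y) \/
   (forall x y, u <= x -> x <= y -> y <= v -> psi y <= psi x)) ->
  (forall x, u <= x <= v -> m <= psi x <= M) ->
  (forall x, u <= x <= v -> ev P x (psi x) = 0) ->
  curve_interval (zeros P) (v - u + (M - m)) ((fun x => pt x (psi x)) @` `[u, v]).
Proof.
move=> uv cpsi mono bnd Px; split.
  by move=> _ [x /= xuv <-]; rewrite /zeros /= pt0 pt1; apply: Px; rewrite in_itv in xuv.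
exists u, v, (fun x => pt x (psi x)); split => //.
- by apply: (@pt_continuous R `[u, v] id psi) => //; apply: continuous_subspaceT => t; exact: cvg_id.
- by move=> t t' _ _ /(congr1 (fun z : 'rV[R]_2 => z 0 ord0)); rewrite !pt0.
have /andP[mu uM] : m <= psi u <= M by apply: bnd; rewrite lexx.
have /andP[mv vM] : m <= psi v <= M by apply: bnd; rewrite lexx uv.
case: mono => mono.
- apply: (@le_trans _ _ ((v + psi v) - (u + psi u))%:E); last by rewrite lee_fin; lra.
  apply: (@path_length_le _ _ _ _ _ (fun x => x + psi x)) => x y ux xy yv.
  apply: le_trans (enorm_pt_le _ _ _ _) _; have xyp := mono _ _ ux xy yv.
  by rewrite !ger0_norm ?subr_ge0 //; lra.
- apply: (@le_trans _ _ ((v - psi v) - (u - psi u))%:E); last by rewrite lee_fin; lra.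
  apply: (@path_length_le _ _ _ _ _ (fun x => x - psi x)) => x y ux xy yv.
  apply: le_trans (enorm_pt_le _ _ _ _) _; have xyp := mono _ _ ux xy yv.
  by rewrite ger0_norm ?subr_ge0 // ler0_norm ?subr_le0 //; lra.
Qed.

Lemma monotone_extension (R : realType) (al be u v m M : R) (phi : R -> R) :
  u < v -> al <= u -> v <= be ->
  (forall x, al < x < be -> {for x, continuous phi}) -> monotone_on al be phi ->
  (forall x, u < x < v -> m <= phi x <= M) ->
  exists psi : R -> R, [/\ {within `[u, v], continuous psi},
    forall x, al < x < be -> u <= x <= v -> psi x = phi x,
    (forall x y, u <= x -> x <= y -> y <= v -> psi x <= psi y) \/
    (forall x y, u <= x -> x <= y -> y <= v -> psi y <= psi x) &
    forall x, u <= x <= v -> m <= psi x <= M].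
Proof.
move=> uv alu vbe cphi [] mono bnd.
  by have [psi [h1 h2 h3 h4]] := nondecreasing_extension uv alu vbe cphi mono bnd; exists psi; split => //; left.
have [||x xuv|psi [h1 h2 h3 h4]] := @nondecreasing_extension R al be u v (- M) (- m) (fun x => - phi x) uv alu vbe.
- by move=> x /cphi c; apply: cvgN.
- by move=> x y h1 h2 h3; rewrite lerN2; exact: mono.
- by rewrite !lerN2 andbC; exact: bnd.
exists (fun x => - psi x); split => //.
- by move=> x; apply: cvgN; exact: h1.
- by move=> x h h'; rewrite h2 // opprK.
- by right => x y a b c; rewrite lerN2; exact: h3.
- by move=> x /h4; rewrite lerNr [_ <= M]lerNl andbC.
Qed.

Lemma zero_at_ends (R : realType) (P : {poly {poly R}}) (u v : R) (psi : R -> R) : u < v ->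
  {within `[u, v], continuous psi} -> (forall x, u < x < v -> ev P x (psi x) = 0) ->
  forall x, u <= x <= v -> ev P x (psi x) = 0.
Proof.
move=> uv cpsi Px x /andP[]; have [_ cu cv] := (continuous_within_itvP psi uv).1 cpsi.
have lim0 (F : set_system R) (w : R) : ProperFilter F -> F --> w -> psi x @[x --> F] --> psi w ->
    (\forall x \near F, u < x < v) -> ev P w (psi w) = 0.
  move=> FF Fw Fpsi Fuv.
  have h : ev P x (psi x) @[x --> F] --> ev P w (psi w).
    apply: (@cvg_comp _ _ _ (fun x => (x, psi x)) (fun p : R * R => ev P p.1 p.2) _ (nbhs (w, psi w))).
      by apply: (cvg_pair (f := id) (g := psi) Fw Fpsi).
    exact: (@ev_continuous R P (w, psi w)).
  have h0 : ev P x (psi x) @[x --> F] --> (0 : R).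
    apply: (@cvg_trans _ ((fun=> 0 : R) @ F)); last exact: cvg_cst.
    apply: near_eq_cvg.
    by apply: filterS Fuv => y /Px ->.
  exact: (cvg_unique (@norm_hausdorff _ _) h h0).
rewrite le_eqVlt => /orP[/eqP <- _|ux].
  apply: (lim0 (u^'+)) => //; first exact: cvg_within.
  by near=> y; apply/andP; split; near: y; [exact: nbhs_right_gt|exact: nbhs_right_lt].
rewrite le_eqVlt => /orP[/eqP ->|xv]; last by apply: Px; rewrite ux.
apply: (lim0 (v^'-)) => //; first exact: cvg_within.
by near=> y; apply/andP; split; near: y; [exact: nbhs_left_gt|exact: nbhs_left_lt].
Unshelve. all: by end_near. Qed.

(** By monotonicity the abscissas at which the branch is in the box form an interval. The graph over
    its closure is one arc, still on the curve by continuity, and its length is at most width plus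
    height. *)
Lemma branch_arc (R : realType) (k : nat) (P : {poly {poly R}}) (br : brdata R) (m M m' M' : R) :
  good_branch k P br -> m <= M -> m' <= M' ->
  exists2 N : nat, (N <= 1)%N &
    covered_by_intervals (curve_interval (zeros P) (M - m + (M' - m'))) N
      [set z | exists x, [/\ br.1.1 < x < br.1.2, m <= x <= M, m' <= br.2 x <= M' & z = pt x (br.2 x)]].
Proof.
move: br => [[al be] phi] [[f [s bf]] cphi Pphi] mM mM'; rewrite /= in bf cphi Pphi *.
pose I := [set x : R | [/\ al < x < be, m <= x <= M & m' <= phi x <= M']].
set X := [set z | _].
have [[x0 Ix0]|nI] := pselect (exists x, I x); last first.
  exists 0%N => //; exists (fun=> set0); split; first by case.
  by move=> z [x [h1 h2 h3 _]]; case: nI; exists x.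
exists 1%N => //.
have one J : curve_interval (zeros P) (M - m + (M' - m')) J -> X `<=` J ->
    covered_by_intervals (curve_interval (zeros P) (M - m + (M' - m'))) 1 X.
  by move=> cJ XJ; exists (fun=> J); split => // z /XJ; exists ord0.
have mono : monotone_on al be phi by case: bf.
have hsI : has_sup I by split; [exists x0|exists M => x [_ /andP[]]].
have hiI : has_inf I by split; [exists x0|exists m => x [_ /andP[]]].
set u := inf I; set v := sup I.
have Iuv x : I x -> u <= x <= v.
  by move=> Ix; rewrite (ge_inf hiI.2 Ix) (ub_le_sup hsI.2 Ix).
have um : m <= u by apply: lb_le_inf; [exists x0|move=> x [_ /andP[]]].
have vM : v <= M by apply: ge_sup; [exists x0|move=> x [_ /andP[]]].
have alu : al <= u by apply: lb_le_inf; [exists x0|move=> x [/andP[/ltW]]].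
have vbe : v <= be by apply: ge_sup; [exists x0|move=> x [/andP[_ /ltW]]].
have uv : u <= v by have /andP[h1 h2] := Iuv _ Ix0; exact: le_trans h1 h2.
have r0 : 0 <= M - m + (M' - m') by rewrite addr_ge0 // subr_ge0.
move: uv; rewrite le_eqVlt => /orP[/eqP uv|uv].
  have Iu x : I x -> x = x0.
    by move=> /Iuv; have := Iuv _ Ix0; rewrite -uv => /andP[h1 h2] /andP[h3 h4]; apply/eqP; rewrite eq_le (le_trans h4 h1) (le_trans h2 h3).
  apply: (one [set pt x0 (phi x0)]).
    by apply: curve_interval_pt => //; case: Ix0 => h _ _; exact: Pphi.
  by move=> z [x [h1 h2 h3 ->]]; rewrite (Iu x).
have inI x : u < x < v -> I x.
  move=> /andP[ux xv]; have [a Ia ax] := inf_lt (ex_intro _ x0 Ix0) ux.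
  have [b Ib xb] := sup_gt (ex_intro _ x0 Ix0) xv.
  have [/andP[a1 a2] /andP[a3 a4] /andP[a5 a6]] := Ia.
  have [/andP[b1 b2] /andP[b3 b4] /andP[b5 b6]] := Ib.
  have h1 : al < x < be by rewrite (lt_trans a1 ax) (lt_trans xb b2).
  split => //; first by rewrite (le_trans a3 (ltW ax)) (le_trans (ltW xb) b4).
  case: mono => mono; have := mono _ _ a1 (ltW ax) (lt_trans xb b2); have := mono _ _ (lt_trans a1 ax) (ltW xb) b2.
    by move=> h h'; rewrite (le_trans a5 h') (le_trans h b6).
  by move=> h h'; rewrite (le_trans b5 h) (le_trans h' a6).
have [|psi [cpsi psiE mpsi bpsi]] := monotone_extension uv alu vbe cphi mono (m := m') (M := M').
  by move=> x /inI[].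
have Ppsi : forall x, u <= x <= v -> ev P x (psi x) = 0.
  apply: zero_at_ends => // x xuv; have [h _ _] := inI x xuv.
  rewrite psiE //; first exact: Pphi.
  by move: xuv => /andP[h1 h2]; rewrite !ltW.
have [J1 [a [b [g [ab cg ig Jg lg]]]]] := curve_interval_graph (ltW uv) cpsi mpsi bpsi Ppsi.
apply: (one ((fun x => pt x (psi x)) @` `[u, v])).
  split => //; exists a, b, g; split => //; apply: le_trans lg _.
  by rewrite lee_fin lerD2r; lra.
move=> z [x [h1 h2 h3 ->]]; have xuv : u <= x <= v by apply: Iuv.
by exists x; rewrite /= ?in_itv //= psiE.
Qed.

Lemma covered_bigcup (T : Type) (Q : set T -> Prop) (I : eqType) (l : seq I) (X : I -> set T) (B : nat) :
  (forall i, i \in l -> exists2 N, (N <= B)%N & covered_by_intervals Q N (X i)) ->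
  exists2 N, (N <= B * size l)%N & covered_by_intervals Q N [set x | exists2 i, i \in l & X i x].
Proof.
elim: l => [_|i l IH h].
  by exists 0%N; rewrite ?muln0 //; exists (fun=> set0); split => [[]|x [i]].
have [N1 N1B [J1 [Q1 c1]]] := h i (mem_head _ _).
have [N2 N2B [J2 [Q2 c2]]] := IH (fun j jl => h j (mem_behead (s := i :: l) jl)).
exists (N1 + N2)%N; first by rewrite mulnS leq_add.
exists (fun j => match fintype.split j with inl a => J1 a | inr b => J2 b end); split.
  by move=> j; case: fintype.split.
move=> x [j]; rewrite inE => /orP[/eqP ->|jl] Xx.
  have [a _ Ja] := c1 x Xx; exists (lshift N2 a) => //.
  by rewrite -[lshift N2 a]/(unsplit (inl a)) unsplitK.
have [|b _ Jb] := c2 x; first by exists j.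
exists (rshift N1 b) => //.
by rewrite -[rshift N1 b]/(unsplit (inr b)) unsplitK.
Qed.

Lemma covered_sub (T : Type) (Q Q' : set T -> Prop) (N : nat) (X Y : set T) :
  (forall J, Q J -> Q' J) -> X `<=` Y -> covered_by_intervals Q N Y -> covered_by_intervals Q' N X.
Proof.
move=> QQ XY [J [QJ YJ]]; exists J; split; first by move=> i; exact: QQ.
exact: subset_trans XY YJ.
Qed.

Lemma curve_interval_le (R : realType) (d : nat) (g : set 'rV[R]_d) (r r' : R) J :
  r <= r' -> curve_interval g r J -> curve_interval g r' J.
Proof.
move=> rr [Jg [a [b [f [h1 h2 h3 h4 h5]]]]]; split => //; exists a, b, f; split => //.
by apply: le_trans h5 _; rewrite lee_fin.
Qed.

Definition in_cell (R : realType) (n : nat) (z : idx 2) : set 'rV[R]_2 :=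
  [set w | incell n (z ord0) (z ord_max) (w 0 ord0) (w 0 ord_max)].

(** Each branch contributes at most one arc in the square, and each critical abscissa one vertical
    segment or at most k + 1 points. *)
Lemma cell_arcs (R : realType) (k : nat) : exists C : nat, forall (P : {poly {poly R}}) n (z : idx 2),
  P != 0 -> bideg k P -> (forall i, (z i < 2 ^ n)%N) ->
  exists2 N, (N <= C)%N &
    covered_by_intervals (curve_interval (zeros P) (2 / 2 ^+ n)) N (zeros P `&` in_cell n z).
Proof.
have [C hC] := branch_cover R k.
exists (k.+1 * (C + C))%N => P n z P0 kP zn.
have [cr [Br [scr sBr gBr cov]]] := hC P P0 kP.
have n0 : 0 < 2 ^+ n :> R by rewrite exprn_gt0.
set a := z ord0; set b := z ord_max.
have ab (c : nat) : c%:R / 2 ^+ n <= c.+1%:R / 2 ^+ n :> R.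
  by rewrite ler_pM2r ?invr_gt0 // ler_nat.
have len (c c' : nat) : c.+1%:R / 2 ^+ n - c%:R / 2 ^+ n + (c'.+1%:R / 2 ^+ n - c'%:R / 2 ^+ n) = 2 / 2 ^+ n :> R.
  by rewrite -!mulrBl -!natr1 -mulrDl; congr (_ / _); ring.
pose X (u : brdata R + R) : set 'rV[R]_2 := match u with
  | inl br => [set w | exists x, [/\ br.1.1 < x < br.1.2, a%:R / 2 ^+ n <= x <= a.+1%:R / 2 ^+ n,
      b%:R / 2 ^+ n <= br.2 x <= b.+1%:R / 2 ^+ n & w = pt x (br.2 x)]]
  | inr c => [set w | exists y, [/\ w = pt c y, incell n a b c y & ev P c y = 0]] end.
have [] := @covered_bigcup _ (curve_interval (zeros P) (2 / 2 ^+ n)) _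
    ([seq inl br | br <- Br] ++ [seq inr c | c <- cr]) X k.+1.
  move=> u; rewrite mem_cat => /orP[/mapP[br brB ->]|/mapP[c _ ->]].
    have [N N1 cN] := branch_arc (gBr _ brB) (ab a) (ab b).
    by exists N; [exact: leq_trans N1 _|rewrite -(len a b)].
  have [sp0|sp0] := eqVneq (spec P c) 0.
    exists 1%N => //; exists (fun=> pt c @` `[b%:R / 2 ^+ n, b.+1%:R / 2 ^+ n]); split.
      move=> _; apply: curve_interval_le (curve_interval_vertical (ab b) _).
        by rewrite -(len a b) lerDr subr_ge0.
      by move=> y; rewrite -spec_horner sp0 horner0.
    move=> w [y [-> /andP[_ yb] _]]; exists ord0 => //; exists y.
  have [ys [sys hys]] := root_list sp0.
  have szk : (size ys <= k.+1)%N.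
    have /andP[kf1 _] := kP; exact: leq_trans (ltnW sys) (leq_trans (size_spec _ _) kf1).
  have [] := @covered_bigcup _ (curve_interval (zeros P) (2 / 2 ^+ n)) _ ys
    (fun y => [set w | w = pt c y /\ ev P c y = 0]) 1.
    move=> y _; have [Py|Py] := eqVneq (ev P c y) 0.
      exists 1%N => //; exists (fun=> [set pt c y]); split; last by move=> w [-> _]; exists ord0.
      by move=> _; apply: curve_interval_pt => //; rewrite divr_ge0 // ltW.
    by exists 0%N => //; exists (fun=> set0); split => [[]|w [_ h]] //; rewrite h eqxx in Py.
  move=> N; rewrite mul1n => Nle cN; exists N; first exact: leq_trans Nle szk.
  apply: covered_sub cN => // w [y [-> _ Py]]; exists y => //.
  by apply: hys; rewrite spec_horner.
move=> N; rewrite size_cat !size_map => Nle cN; exists N.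
  by apply: leq_trans Nle _; rewrite leq_mul2l leq_add ?orbT.
apply: covered_sub cN => // w [Pw cw].
have /andP[/andP[x1 x2] _] := cw.
have z0 : 0 <= a%:R / 2 ^+ n :> R by rewrite divr_ge0 // ltW.
have z1 : a.+1%:R / 2 ^+ n <= 1 :> R by rewrite ler_pdivrMr // mul1r -natrX ler_nat zn.
have [||xc|[br brB [h1 h2]]] := cov _ _ _ _ Pw; [lra|lra| |].
  exists (inr (w 0 ord0)); first by rewrite mem_cat map_f ?orbT.
  by exists (w 0 ord_max); split => //; exact: ptE.
exists (inl br); first by rewrite mem_cat map_f.
exists (w 0 ord0); rewrite h2; move: cw => /andP[cw1 cw2]; split => //; exact: ptE.
Qed.

Lemma curve_cover (R : realType) (k : nat) : exists C : nat, forall (P : {poly {poly R}}) n (Z : seq (idx 2)),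
  P != 0 -> bideg k P -> (forall z i, z \in Z -> (z i < 2 ^ n)%N) ->
  exists2 N, (N <= C * size (seq.filter (hit n P) Z))%N &
    covered_by_intervals (curve_interval (zeros P) (2 / 2 ^+ n)) N
      (zeros P `&` [set w | exists2 z, z \in Z & in_cell n z w]).
Proof.
have [C hC] := cell_arcs R k; exists C => P n Z P0 kP Zn.
have [] := @covered_bigcup _ (curve_interval (zeros P) (2 / 2 ^+ n)) _ (seq.filter (hit n P) Z)
  (fun z => zeros P `&` in_cell n z) C.
  by move=> z; rewrite mem_filter => /andP[_ zZ]; apply: hC => // i; exact: Zn.
move=> N Nle cN; exists N => //; apply: covered_sub cN => // w [Pw [z zZ zw]]; exists z => //.
by rewrite mem_filter zZ andbT; apply/asboolP; exists (w 0 ord0), (w 0 ord_max).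
Qed.

(** * Lines, and equations in the two variables *)

Lemma enormZ (R : realType) (d : nat) (a : R) (x : 'rV[R]_d) : enorm (a *: x) = `|a| * enorm x.
Proof.
rewrite /enorm -sqrtr_sqr -sqrtrM ?sqr_ge0 //; congr Num.sqrt.
by rewrite mulr_sumr; apply: eq_bigr => i _; rewrite mxE exprMn.
Qed.

Lemma le_enorm (R : realType) (d : nat) (x : 'rV[R]_d) i : `|x 0 i| <= enorm x.
Proof.
rewrite /enorm -sqrtr_sqr ler_sqrt ?sumr_ge0 // => [|j _]; last exact: sqr_ge0.
by rewrite (bigD1 i) //= lerDl sumr_ge0 // => j _; exact: sqr_ge0.
Qed.

Lemma enorm_eq0 (R : realType) (d : nat) (x : 'rV[R]_d) : enorm x = 0 -> x = 0.
Proof.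
move=> x0; apply/rowP => i; rewrite mxE; apply/eqP; rewrite -normr_le0 -x0; exact: le_enorm.
Qed.

Lemma enorm_le_sum (R : realType) (d : nat) (x : 'rV[R]_d) : enorm x <= \sum_(i < d) `|x 0 i|.
Proof.
have s0 : 0 <= \sum_(i < d) `|x 0 i| by exact: sumr_ge0.
rewrite -(ger0_norm s0) -sqrtr_sqr /enorm ler_sqrt ?sqr_ge0 //.
suff [] : \sum_(i < d) x 0 i ^+ 2 <= (\sum_(i < d) `|x 0 i|) ^+ 2 /\ 0 <= \sum_(i < d) `|x 0 i| by [].
apply: (big_ind2 (fun a b : R => a <= b ^+ 2 /\ 0 <= b)); first by rewrite expr0n.
  by move=> a b a' b' [h1 h2] [h3 h4]; split; nra.
by move=> i _; rewrite real_normK ?num_real.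
Qed.

Lemma line_unit (R : realType) (d : nat) (g : set 'rV[R]_d) : is_line g ->
  exists p v : 'rV[R]_d, enorm v = 1 /\ g = range (fun s : R => p + s *: v).
Proof.
move=> [p [u [u0 ->]]]; have e0 : 0 < enorm u.
  rewrite lt_neqAle sqrtr_ge0 andbT eq_sym; apply: contraNneq u0 => /enorm_eq0 ->; exact: eqxx.
exists p, ((enorm u)^-1 *: u); split.
  by rewrite enormZ gtr0_norm ?invr_gt0 // mulVf // gt_eqF.
rewrite eqEsubset; split => _ [s _ <-].
  by exists (s * enorm u) => //; rewrite scalerA mulfK // gt_eqF.
by exists (s / enorm u) => //; rewrite scalerA.
Qed.

(** With the line parametrized by arc length, consecutive intervals of length exactly [r] are laid
    from the infimum of the parameters of [X]. One more than [N] is taken because the far end of the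
    range may be attained. *)
Lemma line_cover (R : realType) (d : nat) (g X : set 'rV[R]_d) (r : R) (N : nat) :
  is_line g -> 0 < r -> X `<=` g ->
  (forall x y, X x -> X y -> enorm (x - y) <= N%:R * r) ->
  exists2 N', (N' <= N.+1)%N & covered_by_intervals (line_interval g r) N' X.
Proof.
move=> /line_unit[p [v [v1 gE]]] r0 Xg bX.
pose S : set R := [set s | X (p + s *: v)].
have [[s1 Ss1]|nS] := pselect (exists s, S s); last first.
  exists 0%N => //; exists (fun=> set0); split => [[]//|x Xx].
  have := Xg x Xx; rewrite gE => -[s _ sx]; case: nS; exists s; by rewrite /S /= sx.
have dS s t : S s -> S t -> `|s - t| <= N%:R * r.
  move=> Ss St; apply: le_trans (bX _ _ Ss St).
  by rewrite opprD addrACA subrr add0r -scalerBl enormZ v1 mulr1.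
have lS : has_lbound S.
  by exists (s1 - N%:R * r) => s Ss; have := dS _ _ Ss1 Ss; rewrite ler_norml => /andP[_]; lra.
set s0 := inf S.
have S0 s : S s -> s0 <= s <= s0 + N%:R * r.
  move=> Ss; rewrite (ge_inf lS Ss) /= -lerBlDr; apply: lb_le_inf; first by exists s1.
  by move=> t St; have := dS _ _ Ss St; rewrite ler_norml => /andP[_]; lra.
pose x (j : nat) : 'rV[R]_d := p + (s0 + j%:R * r) *: v.
exists N.+1 => //; exists (fun j : 'I_N.+1 => [set x j + t *: (x j.+1 - x j) | t in `[0, 1]]).
have xB (j : nat) : x j.+1 - x j = r *: v.
  by rewrite /x opprD addrACA subrr add0r -scalerBl -natr1; congr (_ *: _); ring.
split.
  move=> j; split.
    move=> _ [t _ <-]; rewrite xB gE; exists (s0 + j%:R * r + t * r) => //.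
    by rewrite scalerA /x -[in RHS]addrA -scalerDl.
  by exists (x j), (x j.+1); split => //; rewrite xB enormZ v1 mulr1 gtr0_norm.
move=> y Xy; have := Xg y Xy; rewrite gE => -[s _ sy].
have /S0/andP[s1' s2'] : S s by rewrite /S /= sy.
pose q := (s - s0) / r.
have q0 : 0 <= q by rewrite divr_ge0 ?subr_ge0 // ltW.
have qN : q <= N%:R by rewrite ler_pdivrMr // lerBlDl.
have /andP[t1 t2] := truncn_itv q0.
have tN : (Num.trunc q < N.+1)%N by rewrite ltnS -(ler_nat R) (le_trans t1).
exists (Ordinal tN) => //=; exists (q - (Num.trunc q)%:R).
  by rewrite /= in_itv /= subr_ge0 t1 lerBlDl natr1 ltW.
rewrite -sy xB scalerA /x -[in LHS]addrA -scalerDl; congr (_ + _ *: _).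
have -> : s = s0 + q * r by rewrite /q divfK ?gt_eqF // addrC subrK.
ring.
Qed.

Lemma line_zeros (R : realType) (g : set 'rV[R]_2) : is_line g ->
  exists P : {poly {poly R}}, [/\ P != 0, bideg 1 P & g `<=` zeros P].
Proof.
move=> [p [u [u0 ->]]].
set a := u 0 ord0; set b := u 0 ord_max; set p0 := p 0 ord0; set p1 := p 0 ord_max.
pose P : {poly {poly R}} := (b *: ('X - p0%:P))%:P - a%:P *: ('X - p1%:P%:P).
have evP x y : ev P x y = b * (x - p0) - a * (y - p1) by rewrite /ev !hornerE.
exists P; split.
- apply: contraNneq u0 => P0; rewrite [u]ptE -/a -/b.
  have := evP (p0 + 1) p1; have := evP p0 (p1 + 1).
  rewrite P0 /ev !horner0 !(addrC _ 1) !addrK !subrr !mulr0 !mulr1 subr0 sub0r => /esym/eqP.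
  by rewrite oppr_eq0 => /eqP -> /esym ->; rewrite /pt !scale0r addr0.
- apply/andP; split.
    rewrite (leq_trans (size_polyD _ _)) // geq_max size_polyN (leq_trans (size_polyC_leq1 _)) //=.
    by rewrite (leq_trans (size_scale_leq _ _)) // size_XsubC.
  apply/sizeY_leP => i; rewrite coefB coefC coefZ coefB coefX coefC.
  rewrite (leq_trans (size_polyD _ _)) // geq_max size_polyN; apply/andP; split.
    by case: ifP => _; rewrite ?size_poly0 // (leq_trans (size_scale_leq _ _)) // size_XsubC.
  rewrite mul_polyC (leq_trans (size_scale_leq _ _)) // -polyC_natr; case: ifP => _.
    by rewrite -polyCB (leq_trans (size_polyC_leq1 _)).
  by rewrite subr0 (leq_trans (size_polyC_leq1 _)).
- move=> _ [s _ <-]; rewrite /zeros /= evP !mxE -/a -/b -/p0 -/p1; ring.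
Qed.

(** Variable 0 becomes the inner variable x and variable 1 the outer variable y, in agreement with
    [ev]. *)
Definition mpoly_bipoly (R : realType) (p : mpoly.mpoly 2 R) : {poly {poly R}} :=
  \sum_(m <- mpoly.msupp p)
    (mpoly.mcoeff m p *: 'X^(mpoly.fun_of_multinom m ord0))%:P * 'X^(mpoly.fun_of_multinom m ord_max).

Lemma ev_mpoly (R : realType) (p : mpoly.mpoly 2 R) (x : 'rV[R]_2) :
  ev (mpoly_bipoly p) (x 0 ord0) (x 0 ord_max) = mpoly.meval (fun i => x 0 i) p.
Proof.
rewrite mpoly.mevalE /ev /mpoly_bipoly horner_sum horner_sum; apply: eq_bigr => m _.
rewrite !hornerE big_ord_recl big_ord1 mulrA; congr (_ * _ * _ ^+ _).
  by congr (x 0 _); apply: val_inj.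
by congr (mpoly.fun_of_multinom m _); apply: val_inj.
Qed.

Lemma coef_mpoly (R : realType) (p : mpoly.mpoly 2 R) (i j : nat) :
  ((mpoly_bipoly p)`_j)`_i = \sum_(m <- mpoly.msupp p) mpoly.mcoeff m p *
    ((mpoly.fun_of_multinom m ord0 == i) && (mpoly.fun_of_multinom m ord_max == j))%:R.
Proof.
rewrite /mpoly_bipoly !coef_sum; apply: eq_bigr => m _.
rewrite coefCM coefXn mulr_natr eq_sym [in RHS]andbC; case: eqP => _ /=; last by rewrite mulr0n coef0 mulr0.
by rewrite mulr1n coefZ coefXn eq_sym.
Qed.

Lemma curve_zeros (R : realType) (k : nat) (g : set 'rV[R]_2) : algebraic_curve k g ->
  exists P : {poly {poly R}}, [/\ P != 0, bideg k P & g = zeros P].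
Proof.
move=> [p [p0 pk ->]]; exists (mpoly_bipoly p).
have deg m i : m \in mpoly.msupp p -> (mpoly.fun_of_multinom m i <= k)%N.
  move=> /mpoly.msize_mdeg_lt; rewrite mpoly.mdegE (bigD1 i) //= => h.
  have := leq_trans h pk; rewrite ltnS; exact: leq_trans (leq_addr _ _).
split.
- have [m ms] : exists m, m \in mpoly.msupp p.
    case E : (mpoly.msupp p) => [|m s]; last by exists m; rewrite mem_head.
    by move/eqP: E; rewrite mpoly.msupp_eq0 (negbTE p0).
  apply/eqP => P0; have := coef_mpoly p (mpoly.fun_of_multinom m ord0) (mpoly.fun_of_multinom m ord_max).
  rewrite P0 !coef0 (big_rem m) //= !eqxx mulr1 big_seq big1 => [/esym/eqP|m' m'r].
    by rewrite addr0 => h; rewrite mpoly.mcoeff_msupp h in ms.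
  case: andP => [[/eqP h0 /eqP h1]|_]; last by rewrite mulr0.
  move: m'r; have -> : m' = m; last by rewrite mem_rem_uniqF // mpoly.msupp_uniq.
  apply/mpoly.mnmP => i; have [->|->] : i = ord0 \/ i = ord_max; last by rewrite h1.
    by case: i => -[|[|q]] //= im; [left|right]; apply: val_inj.
  by rewrite h0.
- apply/andP; split.
    apply/leq_sizeP => j kj; apply/polyP => i; rewrite coef_mpoly coef0 big_seq big1 // => m ms.
    by rewrite andbC (_ : (_ == j) = false) ?mulr0 //; apply/eqP => h; have := deg m ord_max ms; rewrite h leqNgt kj.
  apply/sizeY_leP => j; apply/leq_sizeP => i ki; rewrite coef_mpoly big_seq big1 // => m ms.
  by rewrite (_ : (_ == i) = false) ?mulr0 //; apply/eqP => h; have := deg m ord0 ms; rewrite h leqNgt ki.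
- by rewrite eqEsubset; split => x; rewrite /zeros /= ev_mpoly.
Qed.

(** * The Hausdorff measure of a dyadic Cantor set *)

Definition cube (R : realType) (d n : nat) (z : idx d) : set 'rV[R]_d :=
  [set x | forall i, (z i)%:R / 2 ^+ n <= x 0 i <= (z i).+1%:R / 2 ^+ n].

Definition cantor (R : realType) (d : nat) (full : nat -> bool) c : set 'rV[R]_d :=
  [set x | forall n, exists2 z, z \in lev full c n & cube n z x].

Lemma lsizeE (d : nat) full c n : size (@lev d full c n) = lsize d full n.
Proof. exact: size_lev. Qed.

Lemma lsize_gt0 (d : nat) full n : (0 < lsize d full n)%N.
Proof. by rewrite prodn_gt0 // => i; case: (full i); rewrite ?expn_gt0. Qed.

Lemma lsizeS (d : nat) full n : lsize d full n.+1 = (lsize d full n * (if full n then 2 ^ d else 1))%N.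
Proof. by rewrite /lsize big_ord_recr. Qed.

Lemma parent_cube (R : realType) (d n : nat) (z : idx d) (x : 'rV[R]_d) : cube n.+1 z x -> cube n (parent z) x.
Proof.
move=> zx i; have /andP[h1 h2] := zx i; rewrite /parent ffunE.
have n0 : 0 < 2 ^+ n :> R by rewrite exprn_gt0.
rewrite exprS ler_pdivrMr ?mulr_gt0 // in h1; rewrite exprS ler_pdivlMr ?mulr_gt0 // in h2.
have e1 : ((z i)./2.*2 <= z i)%N by rewrite -[X in (_ <= X)%N](odd_double_half (z i)) leq_addl.
have e2 : ((z i).+1 <= (z i)./2.+1.*2)%N by rewrite -[X in (X.+1 <= _)%N](odd_double_half (z i)); case: (odd _); rewrite doubleS ?add1n ?add0n.
rewrite -(ler_nat R) -muln2 natrM in e1; rewrite -(ler_nat R) -muln2 natrM in e2.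
by rewrite ler_pdivrMr // ler_pdivlMr //; apply/andP; split; lra.
Qed.

Lemma anc_lev (d : nat) full c k m z : z \in @lev d full c (k + m) -> iter k (@parent d) z \in lev full c m.
Proof.
elim: k z => // k IH z; rewrite addSn iterSr => /mem_refine[h _]; exact: IH.
Qed.

Lemma anc_cube (R : realType) (d k m : nat) (z : idx d) (x : 'rV[R]_d) :
  cube (k + m) z x -> cube m (iter k (@parent d) z) x.
Proof. by elim: k z => // k IH z; rewrite addSn iterSr => /parent_cube; exact: IH. Qed.

(** All cubes of level m have the same number of descendants of level k + m, the ratio of the sizes:
    the natural measure on the construction is uniform. *)
Lemma sum_anc (R : realType) (d : nat) full c k m (F : idx d -> R) :
  \sum_(z <- lev full c (k + m)) F (iter k (@parent d) z) =
  (lsize d full (k + m))%:R / (lsize d full m)%:R * \sum_(z <- lev full c m) F z.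
Proof.
have m0 : (lsize d full m)%:R != 0 :> R by rewrite pnatr_eq0 -lt0n lsize_gt0.
elim: k => [|k IH]; first by rewrite divff // mul1r.
rewrite addSn [lev _ _ _.+1]/= (sum_refine _ _ _ (fun z => F (iter k.+1 (@parent d) z))) lsizeS.
have e z (b : {ffun 'I_d -> bool}) : F (iter k.+1 (@parent d) (child z b)) = F (iter k (@parent d) z).
  by rewrite iterSr childK.
case: ifP => _.
  rewrite (eq_bigr (fun z => F (iter k (@parent d) z) *+ 2 ^ d)) => [|z _]; last first.
    by rewrite (eq_bigr (fun=> F (iter k (@parent d) z))) // sumr_const card_ffun card_bool card_ord.
  by rewrite sumrMnl IH -mulr_natr natrM; ring.
by rewrite (eq_bigr (fun z => F (iter k (@parent d) z))) // IH muln1.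
Qed.

(** Every cube has a child at the next level, so a nested chain descends from [z]; the suprema of
    the left ends give its common point. Cubes can thus be counted through points of the limit
    set. *)
Lemma cube_inhabited (R : realType) (d : nat) full c n z : z \in @lev d full c n ->
  exists2 x : 'rV[R]_d, cube n z x & cantor full c x.
Proof.
move=> zn.
have step m (y : idx d) : y \in lev full c m -> exists2 y', y' \in lev full c m.+1 & parent y' = y.
  move=> ym /=; rewrite /refine; case: ifP => _.
    exists (child y [ffun=> false]); last exact: childK.
    by apply/allpairsP; exists (y, [ffun=> false]); rewrite mem_enum.
  by exists (child y (c m (lev full c m) y)); [exact: map_f|exact: childK].
pose nxt m (y : idx d) : idx d := if pselect (exists2 y', y' \in lev full c m.+1 & parent y' = y) is left h
  then projT1 (cid2 h) else y.
have nxtP m y : y \in lev full c m -> nxt m y \in lev full c m.+1 /\ parent (nxt m y) = y.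
  by move=> /step h; rewrite /nxt; case: pselect => // h'; case: cid2.
pose zs := fix zs k := if k is k'.+1 then nxt (k' + n)%N (zs k') else z.
have zsP k : zs k \in lev full c (k + n) by elim: k => // k /nxtP[].
have zsS k : parent (zs k.+1) = zs k by have [] := nxtP _ _ (zsP k).
have n0 (m : nat) : 0 < 2 ^+ m :> R by rewrite exprn_gt0.
pose a i k : R := (zs k i)%:R / 2 ^+ (k + n); pose b i k : R := (zs k i).+1%:R / 2 ^+ (k + n).
have ab1 i k : a i k <= a i k.+1 /\ b i k.+1 <= b i k.
  have := @parent_cube R d (k + n) (zs k.+1) (\row_j a j k.+1).
  have := @parent_cube R d (k + n) (zs k.+1) (\row_j b j k.+1).
  have ab j : a j k.+1 <= b j k.+1 by rewrite ler_pM2r ?invr_gt0 // ler_nat.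
  move=> hb ha; have /andP[h1 _] : a i k <= a i k.+1 <= b i k.
    have := ha _ i; rewrite zsS mxE; apply => j; rewrite mxE -addSn -/(a j k.+1) -/(b j k.+1) lexx ab //.
  have /andP[_ h2] : a i k <= b i k.+1 <= b i k.
    have := hb _ i; rewrite zsS mxE; apply => j; rewrite mxE -addSn -/(a j k.+1) -/(b j k.+1) lexx ab //.
  by [].
have ab i k l : a i k <= b i l.
  have am : {homo a i : p q / (p <= q)%N >-> p <= q} by apply/nondecreasing_seqP => p; case: (ab1 i p).
  have bm : {homo b i : p q / (p <= q)%N >-> q <= p} by apply/nonincreasing_seqP => p; case: (ab1 i p).
  apply: le_trans (am _ _ (leq_maxl k l)) _; apply: le_trans (bm _ _ (leq_maxr k l)).
  by rewrite ler_pM2r ?invr_gt0 // ler_nat.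
pose x : 'rV[R]_d := \row_i sup (range (a i)).
have xc k : cube (k + n) (zs k) x.
  move=> i; rewrite mxE; apply/andP; split.
    by apply: ub_le_sup; [exists (b i 0%N) => _ [l _ <-]|exists k].
  by apply: ge_sup; [exists (a i 0%N), 0%N|move=> _ [l _ <-]; exact: ab].
exists x; first exact: (xc 0%N).
move=> m; have [mn|nm] := leqP m n.
  exists (iter (n - m) (@parent d) z); first by apply: anc_lev; rewrite subnK.
  by apply: anc_cube; rewrite subnK //; exact: (xc 0%N).
by rewrite -(subnK (ltnW nm)); exists (zs (m - n)%N); [exact: zsP|exact: xc].
Qed.

Lemma compact_cantor (R : realType) (d : nat) full c : compact (@cantor R d full c).
Proof.
have cc n (z : idx d) : compact (@cube R d n z).
  apply: (@rV_compact R d (fun i => [set` `[(z i)%:R / 2 ^+ n, (z i).+1%:R / 2 ^+ n]])) => i.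
  exact: segment_compact.
pose L n : set 'rV[R]_d := [set x | exists2 z, z \in lev full c n & cube n z x].
have clL n : closed (L n).
  rewrite (_ : L n = \bigcup_(z in [set` lev full c n]) cube n z); last first.
    by rewrite eqEsubset; split => x [z h1 h2]; exists z.
  apply: closed_bigcup; first exact: finite_seq.
  move=> z _; apply: compact_closed; [exact: norm_hausdorff|exact: cc].
rewrite (_ : cantor full c = cube 0 [ffun=> 0%N] `&` \bigcap_n L n); last first.
  rewrite eqEsubset; split => x.
    by move=> h; split => [|n _]; [have [z] := h 0%N; rewrite inE => /eqP ->|exact: h].
  by move=> [_ h] n; exact: h.
by apply: compact_closedI => //; exact: closed_bigI.
Qed.

(** The premeasure increases as [delta] decreases, so the limit is a supremum; the bound 1 on
    [delta] is an arbitrary cutoff. *)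
Lemma hausdorff_measureE (R : realType) (h : R -> R) (d : nat) (A : set 'rV[R]_d) :
  hausdorff_measure h A = ereal_sup ((fun delta => hausdorff_premeasure h delta A) @` `]0, 1[).
Proof.
apply/cvg_lim => //; apply: nonincreasing_at_right_cvge; first by rewrite bnd_simp.
move=> s t _ _ st; apply: ereal_inf_le_tmp => _ [E [AE dE] <-]; exists E => //; split => // i.
exact: lt_le_trans (dE i) _.
Qed.

Lemma diam_ge0 (R : realType) (d : nat) (E : set 'rV[R]_d) : (0 <= diam E)%E.
Proof. by apply: ereal_sup_ubound; left. Qed.

Lemma diam_le (R : realType) (d : nat) (E : set 'rV[R]_d) (r : R) : 0 <= r ->
  (forall x y, E x -> E y -> enorm (x - y) <= r) -> (diam E <= r%:E)%E.
Proof.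
move=> r0 h; apply: ge_ereal_sup => _ [->|[x Ex [y Ey <-]]]; first by rewrite lee_fin.
by rewrite lee_fin h.
Qed.

Lemma le_diam (R : realType) (d : nat) (E : set 'rV[R]_d) (x y : 'rV[R]_d) : E x -> E y ->
  ((enorm (x - y))%:E <= diam E)%E.
Proof. by move=> Ex Ey; apply: ereal_sup_ubound; right; exists x => //; exists y. Qed.

Lemma gauge_diam_ge0 (R : realType) (h : R -> R) (d : nat) (E : set 'rV[R]_d) :
  gauge_function h -> 0 <= gauge_diam h E.
Proof. by move=> [h0 _ _ _]; rewrite /gauge_diam; case: ifP => // /h0/ltW. Qed.

Lemma gauge_diam_le (R : realType) (h : R -> R) (d : nat) (E : set 'rV[R]_d) (r : R) :
  gauge_function h -> 0 < r -> (diam E <= r%:E)%E -> gauge_diam h E <= h r.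
Proof.
move=> [h0 hm _ _] r0 dE; rewrite /gauge_diam; case: ifP => [d0|_]; last exact/ltW/h0.
apply: hm => //; have := diam_ge0 E; move: dE; by case: (diam E) => [t| |].
Qed.

Lemma gauge_doublings (R : realType) (h : R -> R) (K t : R) (n : nat) : 0 <= K -> 0 < t ->
  (forall t, 0 < t -> h (2 * t) <= K * h t) -> h (2 ^+ n * t) <= K ^+ n * h t.
Proof.
move=> K0 t0 hd; elim: n => [|n IH]; first by rewrite !mul1r.
rewrite !exprS -!mulrA; apply: le_trans (hd _ _) _; first by rewrite mulr_gt0 ?exprn_gt0.
by rewrite ler_wpM2l.
Qed.

Lemma exists_exp2V_lt (R : realType) (e : R) : 0 < e -> exists n : nat, 2 ^- n < e.
Proof.
move=> e0; have [n _ hn] := near_infty_natSinv_expn_lt (PosNum e0).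
by exists n; have := hn n (leqnn n); rewrite /= div1r.
Qed.

(** The cubes of a level n are used as a cover. Their diameter is at most d 2^-n <= 2^d 2^-n, and d
    doublings bound the gauge of each by (2^d)^d h(2^-n). *)
Lemma hausdorff_cantor_lty (R : realType) (h : R -> R) (d : nat) full c (c2 : R) : gauge_function h ->
  (forall t, 0 < t -> h (2 * t) <= 2 ^+ d * h t) ->
  (forall n, (lsize d full n)%:R * h (2 ^- n) <= c2) ->
  (hausdorff_measure h (@cantor R d full c) < +oo)%E.
Proof.
move=> gh hd hM; rewrite hausdorff_measureE.
apply: (@le_lt_trans _ _ ((2 ^+ d) ^+ d * c2)%:E); last exact: ltry.
apply: ge_ereal_sup => _ [delta + <-]; rewrite /= in_itv /= => /andP[delta0 _].
have n0 (m : nat) : 0 < 2 ^+ m :> R by rewrite exprn_gt0.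
have [n ndelta] : exists n : nat, 2 ^+ d * 2 ^- n < delta.
  have [n hn] := exists_exp2V_lt (divr_gt0 delta0 (n0 d)).
  by exists n; move: hn; rewrite ltr_pdivlMr // mulrC.
have r0 : 0 < 2 ^+ d * 2 ^- n :> R by rewrite mulr_gt0 ?invr_gt0.
pose E i : set 'rV[R]_d := if (i < lsize d full n)%N then cube n (nth [ffun=> 0%N] (lev full c n) i) else set0.
have dE i : (diam (E i) <= (2 ^+ d * 2 ^- n)%:E)%E.
  apply: diam_le; first exact: ltW.
  move=> x y; rewrite /E; case: ifP => // _ Ex Ey; apply: le_trans (enorm_le_sum _) _.
  apply: (@le_trans _ _ (\sum_(j < d) 2 ^- n)).
    apply: ler_sum => j _; have /andP[x1 x2] := Ex j; have /andP[y1 y2] := Ey j.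
    rewrite -natr1 mulrDl mul1r in x2 y2; rewrite !mxE ler_norml; apply/andP; split; lra.
  rewrite sumr_const card_ord -[_ *+ d]mulr_natl ler_pM2r ?invr_gt0 // -natrX ler_nat ltnW // ltn_expl //.
apply: (@le_trans _ _ (\sum_(0 <= i <oo) (gauge_diam h (E i))%:E)%E).
  apply: ereal_inf_lbound; exists E => //; split.
    move=> x /(_ n)[z zn zx]; exists (index z (lev full c n)) => //.
    by rewrite /E -(lsizeE full c) index_mem zn nth_index.
  by move=> i; apply: le_lt_trans (dE i) _; rewrite lte_fin.
apply: lime_le; first by apply: is_cvg_nneseries => i _ _; rewrite lee_fin gauge_diam_ge0.
near=> N; rewrite sumEFin lee_fin.
apply: (@le_trans _ _ (\sum_(0 <= i < N) (if (i < lsize d full n)%N then (2 ^+ d) ^+ d * h (2 ^- n) else 0))).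
  apply: ler_sum => i _; case: ifP => iM.
    apply: (@le_trans _ _ (h (2 ^+ d * 2 ^- n))); first exact: gauge_diam_le.
    by apply: gauge_doublings; rewrite // ?exprn_ge0 // invr_gt0.
  rewrite /E iM /gauge_diam (_ : diam set0 = 0%E) ?ltxx //.
  by apply/eqP; rewrite eq_le diam_ge0 diam_le.
rewrite -big_mkcond /= big_const_seq iter_addr addr0.
have B0 : 0 <= (2 ^+ d) ^+ d * h (2 ^- n).
  by rewrite mulr_ge0 ?exprn_ge0 // ltW // (gauge_gt0 gh) // invr_gt0.
apply: (@le_trans _ _ ((lsize d full n)%:R * ((2 ^+ d) ^+ d * h (2 ^- n)))).
  rewrite [leRHS]mulr_natl; apply: ler_wpMn2l => //; rewrite -size_filter -[X in (_ <= X)%N](size_iota 0).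
  apply: uniq_leq_size; first by rewrite filter_uniq // iota_uniq.
  by move=> i; rewrite mem_filter mem_iota => /andP[].
by rewrite mulrCA ler_wpM2l // exprn_ge0 // exprn_ge0.
Unshelve. all: by end_near. Qed.

Lemma gauge_small (R : realType) (h : R -> R) (e : R) : gauge_function h -> 0 < e ->
  exists n : nat, h (2 ^- n) <= e.
Proof.
move=> gh e0; have /cvgrPdist_lt/(_ e e0)/nbhs_ballP[e' /= e'0 H] := gauge_cvg0 gh.
have [n hn] := exists_exp2V_lt e'0; have n0 : 0 < 2 ^- n :> R by rewrite invr_gt0 exprn_gt0.
exists n; have := H (2 ^- n); rewrite /ball /= sub0r normrN gtr0_norm // => /(_ hn n0).
by rewrite sub0r normrN gtr0_norm ?(gauge_gt0 gh) // => /ltW.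
Qed.

Lemma dyadic_scale (R : realType) (D : R) : 0 < D -> D < 1 -> exists m : nat, 2 ^- m.+1 <= D < 2 ^- m.
Proof.
move=> D0 D1; have ex : exists n : nat, 2 ^- n <= D by have [n /ltW] := exists_exp2V_lt D0; exists n.
case: (ex_minnP ex) => -[|m] hm minm; first by move: hm; rewrite expr0 invr1 leNgt D1.
by exists m; rewrite hm /= ltNge; apply/negP => /minm; rewrite ltnn.
Qed.

(* The mass distribution principle in a finite form: after reduction to a finite cover, the cubes of a
   high level [N] are counted through their ancestors of the scale of each covering set. *)
Lemma hausdorff_cantor_gt0 (R : realType) (h : R -> R) (d : nat) full c (c1 : R) : gauge_function h ->
  (forall t, 0 < t -> h (2 * t) <= 2 ^+ d * h t) -> 0 < c1 ->
  (forall n, c1 <= (lsize d full n)%:R * h (2 ^- n)) ->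
  (0 < hausdorff_measure h (@cantor R d full c))%E.
Proof.
move=> gh hd c10 hM; set A := cantor full c; set K5 : R := (5 ^ d)%:R.
have K50 : 0 < K5 by rewrite ltr0n expn_gt0.
have d0 : 0 < 2 ^+ d :> R by rewrite exprn_gt0.
have n0 (m : nat) : 0 < 2 ^+ m :> R by rewrite exprn_gt0.
(* Half of the lower bound [c1 / K5] pays for slacks e / 2^(i+1), which stand in for the gauge of
   sets of zero diameter or missing [A]. *)
pose e := c1 / K5 / 2; have e0 : 0 < e by rewrite !divr_gt0.
apply: (@lt_le_trans _ _ (e / 2 ^+ d)%:E); first by rewrite lte_fin divr_gt0.
rewrite hausdorff_measureE; apply: le_trans (ereal_sup_ubound _); last first.
  exists (2^-1 : R) => //=; rewrite in_itv /= invr_gt0 ltr0n /= invf_lt1 // ltr1n //.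
apply: le_ereal_inf_tmp => _ [E [AE dE] <-].
have E1 i : (diam (E i) < 1%:E)%E by apply: lt_trans (dE i) _; rewrite lte_fin invf_lt1 // ltr1n.
(* The triple is a scale m comparable to the diameter of [E i], an open set around its trace on [A],
   and a marked cube of level m. Points of the open set are within 2^-m of the marked cube in each
   coordinate, so cubes of level m meeting it differ from the marked one by at most 2 in each
   index. *)
have scale i : exists t : nat * set 'rV[R]_d * idx d, [/\ open t.1.2, E i `&` A `<=` t.1.2,
    h (2 ^- t.1.1) <= 2 ^+ d * gauge_diam h (E i) + e / 2 ^+ i.+1 &
    forall x z j, t.1.2 x -> cube t.1.1 z x -> (t.2 j <= z j + 2)%N /\ (z j <= t.2 j + 2)%N].
  have ei : 0 < e / 2 ^+ i.+1 by rewrite divr_gt0.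
  have [m0 hm0] := gauge_small gh ei.
  have g0 := gauge_diam_ge0 (E i) gh.
  have [[p [Ep Ap]]|nE] := pselect (exists p, (E i `&` A) p); last first.
    exists (m0, set0, [ffun=> 0%N]); split => [|x Ex||] //.
      by case: nE; exists x.
    by apply: le_trans hm0 _; rewrite lerDr mulr_ge0 // ltW.
  have dfin : diam (E i) = (fine (diam (E i)))%:E.
    by rewrite fineK // ge0_fin_numE ?diam_ge0 // (lt_trans (E1 i)) // ltry.
  set D := fine (diam (E i)) in dfin.
  have D0 : 0 <= D by rewrite -lee_fin -dfin diam_ge0.
  have D1 : D < 1 by rewrite -lte_fin -dfin.
  have [m [Dm hm]] : exists m, D < 2 ^- m /\ h (2 ^- m) <= 2 ^+ d * gauge_diam h (E i) + e / 2 ^+ i.+1.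
    move: D0; rewrite le_eqVlt => /orP[/eqP D0|D0].
      exists m0; rewrite -D0 invr_gt0; split => //.
      by apply: le_trans hm0 _; rewrite lerDr mulr_ge0 // ltW.
    have [m /andP[m1 m2]] := dyadic_scale D0 D1; exists m; split => //.
    apply: (@le_trans _ _ (2 ^+ d * h (2 ^- m.+1))).
      apply: le_trans (hd _ _); last by rewrite invr_gt0.
      by rewrite exprS invfM mulrA divff // mul1r.
    rewrite -[leLHS]addr0 lerD ?(ltW ei) // ler_wpM2l ?(ltW d0) // /gauge_diam -/D D0.
    by apply: (gauge_nondecreasing gh) => //; rewrite invr_gt0.
  have [y _ yp] := Ap m.
  exists (m, ball p (2 ^- m), y); split => //=.
  - by apply: ball_open; rewrite invr_gt0.
  - move=> x [Ex _]; split; first by rewrite invr_gt0.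
    move=> a j; rewrite (ord1 a); apply: le_lt_trans Dm.
    rewrite -lee_fin -dfin; apply: le_trans (le_diam Ep Ex); rewrite lee_fin.
    by have := le_enorm (p - x) j; rewrite !mxE.
  - move=> x z j [_ /(_ ord0 j) px] zx; move: px; rewrite /ball /= ltr_norml => /andP[px1 px2].
    have /andP[z1 z2] := zx j; have /andP[y1 y2] := yp j.
    have cmp (u v : R) : u / 2 ^+ m <= v / 2 ^+ m -> u <= v by rewrite ler_pM2r // invr_gt0.
    rewrite -natr1 mulrDl mul1r in z2 y2.
    have h1 : (y j)%:R / 2 ^+ m <= ((z j)%:R + 2) / 2 ^+ m :> R by rewrite mulrDl; lra.
    have h2 : (z j)%:R / 2 ^+ m <= ((y j)%:R + 2) / 2 ^+ m :> R by rewrite mulrDl; lra.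
    by split; rewrite -(ler_nat R) natrD; exact: cmp.
have [t ht] := choice scale.
have : cover_compact A by rewrite -compact_cover; exact: compact_cantor.
move=> /(_ nat setT (fun i => (t i).1.2)) [].
- by move=> i _; have [] := ht i.
- by move=> x Ax; have [i _ Ei] := AE x Ax; exists i => //; have [_ h2 _ _] := ht i; exact: h2.
move=> D _ AD; pose l : seq nat := finmap.enum_fset D; pose K := (\max_(i <- l) i).+1.
have DK i : i \in l -> (i < K)%N by move=> il; rewrite ltnS (big_rem i) //= leq_maxl.
pose N := \max_(i < K) (t i).1.1.
have mN (i : 'I_K) : ((t i).1.1 <= N)%N by exact: leq_bigmax.
pose nr (i : nat) (y : idx d) := [forall j, ((t i).2 j <= y j + 2)%N && (y j <= (t i).2 j + 2)%N].
have M0 n : 0 < (lsize d full n)%:R :> R by rewrite ltr0n lsize_gt0.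
(* Each cube of level [N] contains a point of [A], so its ancestor at the scale of some covering set
   is near the marked cube of that set. At most 5^d cubes are near it, all with the same number of
   descendants. *)
have count : (lsize d full N)%:R <= \sum_(i < K) (lsize d full N)%:R * (K5 / (lsize d full (t i).1.1)%:R) :> R.
  have sz : (lsize d full N)%:R = \sum_(z <- lev full c N) 1 :> R.
    by rewrite -(lsizeE full c) -sum1_size natr_sum.
  rewrite {1}sz; apply: (@le_trans _ _ (\sum_(z <- lev full c N) \sum_(i < K) (nr i (iter (N - (t i).1.1) (@parent d) z))%:R)).
    rewrite big_seq [leRHS]big_seq; apply: ler_sum => z zN.
    have [x zx Ax] := cube_inhabited R zN; have [i /= iD Ui] := AD x Ax.
    rewrite (bigD1 (Ordinal (DK i iD))) //= -[leLHS]addr0 lerD ?sumr_ge0 // ler1n lt0b.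
    apply/forallP => j; have [_ _ _ h4] := ht i; apply/andP; apply: (h4 x) => //.
    by apply: anc_cube; rewrite subnK //; exact: (mN (Ordinal (DK i iD))).
  rewrite exchange_big /=; apply: ler_sum => i _.
  have := sum_anc full c (N - (t i).1.1) (t i).1.1 (fun y => (nr i y)%:R : R).
  rewrite subnK // => ->; rewrite -mulrA ler_wpM2l //.
  rewrite mulrC ler_wpM2r ?invr_ge0 // -natr_sum ler_nat.
  rewrite -big_mkcond sum1_count -size_filter.
  apply: (@near_count d 2 _ (t i).2); first by rewrite filter_uniq // lev_uniq.
  by move=> z j; rewrite mem_filter => /andP[/forallP/(_ j)/andP[]].
rewrite -mulr_sumr -[leLHS]mulr1 ler_pM2l // -mulr_sumr in count.
have count2 : c1 / K5 <= \sum_(i < K) h (2 ^- (t i).1.1).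
  rewrite ler_pdivrMr // mulrC.
  apply: (@le_trans _ _ (K5 * \sum_(i < K) c1 / (lsize d full (t i).1.1)%:R)).
    by rewrite -mulr_sumr mulrCA -[leLHS]mulr1 ler_pM2l.
  by rewrite ler_wpM2l ?(ltW K50) //; apply: ler_sum => i _; rewrite ler_pdivrMr // mulrC hM.
have count3 : c1 / K5 <= 2 ^+ d * \sum_(i < K) gauge_diam h (E i) + e.
  apply: le_trans count2 _.
  apply: (@le_trans _ _ (\sum_(i < K) (2 ^+ d * gauge_diam h (E i) + e / 2 ^+ i.+1))).
    by apply: ler_sum => i _; have [] := ht i.
  rewrite big_split /= -!mulr_sumr lerD2l -[leRHS]mulr1 ler_pM2l //.
  exact: sum_half_pow.
apply: (@le_trans _ _ (\sum_(0 <= i < K) (gauge_diam h (E i))%:E)%E); last first.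
  by apply: nneseries_lim_ge => i _ _; rewrite lee_fin gauge_diam_ge0.
rewrite sumEFin lee_fin big_mkord ler_pdivrMr // mulrC.
have e2 : c1 / K5 = e + e by rewrite /e; move: (c1 / K5) => q; lra.
by move: count3; rewrite e2 lerD2r.
Qed.

(** * The integral condition *)

(** The interval ]2^-(n+1), 2^-n[ has length 2^-(n+1), so [a n] is the integral over it of a
    constant below [f]. *)
Lemma sum_le_integral (R : realType) (f : R -> R) (a : nat -> R) :
  measurable_fun (`]0, 1[ : set R) f -> (forall t, 0 < t < 1 -> 0 <= f t) -> (forall n, 0 <= a n) ->
  (forall n t, 2 ^- n.+1 < t < 2 ^- n -> 2 ^+ n.+1 * a n <= f t) ->
  (\int[lebesgue_measure]_(t in `]0%R, 1%R[) (f t)%:E < +oo)%E ->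
  exists B : R, forall N, \sum_(n < N) a n <= B.
Proof.
move=> mf f0 a0 af fin.
pose D : set R := `]0, 1[%classic; pose I n : set R := `]2 ^- n.+1, 2 ^- n[%classic.
have n0 (m : nat) : 0 < 2 ^+ m :> R by rewrite exprn_gt0.
have ID n : I n `<=` D.
  move=> t; rewrite /I /D /= !in_itv /= => /andP[h1 h2]; rewrite (lt_trans _ h1) ?invr_gt0 //=.
  by apply: lt_le_trans h2 _; rewrite invf_le1 // exprn_ege1 // ler1n.
pose F n (t : R) : \bar R := ((2 ^+ n.+1 * a n)%:E * (\1_(I n) t)%:E)%E.
have mF n : measurable_fun D (F n).
  apply: measurable_funeM; apply/measurable_EFinP; apply: measurable_indic; exact: measurable_itv.
have F0 n t : D t -> (0 <= F n t)%E.
  by move=> _; rewrite mule_ge0 // lee_fin ?mulr_ge0 // ltW.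
have intF n : (\int[lebesgue_measure]_(t in D) F n t = (a n)%:E)%E.
  rewrite /F ge0_integralZl_EFin //; last 3 first.
  - exact: measurable_itv.
  - by apply/measurable_EFinP; apply: measurable_indic; exact: measurable_itv.
  - by rewrite mulr_ge0 // ltW.
  rewrite integral_indic; [|exact: measurable_itv|exact: measurable_itv].
  rewrite setIidl //= /I lebesgue_measure_itv /= lte_fin.
  have -> : 2 ^- n.+1 < 2 ^- n :> R by rewrite ltf_pV2 ?posrE // exprS ltr_pMl ?ltr1n.
  rewrite -EFinB -EFinM; congr EFin.
  have -> : 2 ^- n.+1 = 2 ^- n / 2 :> R by rewrite exprS invfM mulrC.
  by rewrite exprS; have := n0 n; move: (2 ^+ n) => q q0; field; rewrite gt_eqF.
have le N : ((\sum_(n < N) a n)%:E <= \int[lebesgue_measure]_(t in D) (f t)%:E)%E.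
  rewrite -sumEFin -(big_mkord xpredT (fun n => (a n)%:E)) (eq_bigr _ (fun n _ => esym (intF n))).
  rewrite -ge0_integral_sum //; last exact: measurable_itv.
  apply: ge0_le_integral.
  - exact: measurable_itv.
  - by move=> t Dt; rewrite sume_ge0 // => n _; exact: F0.
  - by apply: emeasurable_sum => n; exact: mF.
  - exact/measurable_EFinP.
  move=> t Dt; rewrite /F (eq_bigr (fun n => (2 ^+ n.+1 * a n * \1_(I n) t)%:E)) => [|n _]; last by rewrite EFinM.
  rewrite sumEFin lee_fin.
  have Dt' : 0 < t < 1 by move: Dt; rewrite /D /= in_itv.
  have [[m [mN tm]]|nI] := pselect (exists m, (m < N)%N /\ I m t); last first.
    rewrite big1_seq ?f0 // => n; rewrite mem_index_iota /= => nN.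
    by rewrite indicE memNset ?mulr0 // => tn; case: nI; exists n.
  have tm' : 2 ^- m.+1 < t < 2 ^- m by move: tm; rewrite /I /= in_itv.
  rewrite big_mkord (bigD1 (Ordinal mN)) //= indicE mem_set // mulr1 big1 ?addr0; first exact: af.
  move=> n nm; rewrite indicE memNset ?mulr0 // /I /= in_itv /= => /andP[h1 h2]; move/andP: tm' => [h3 h4].
  have lp (p q : nat) : 2 ^- p < 2 ^- q :> R -> (q < p)%N.
    by rewrite ltf_pV2 ?posrE // ltr_eXn2l ?ltr1n.
  have := lp _ _ (lt_trans h1 h4); have := lp _ _ (lt_trans h3 h2); rewrite !ltnS => k1 k2.
  by move: nm; rewrite -val_eqE /= eqn_leq k1 k2.
exists (fine (\int[lebesgue_measure]_(t in D) (f t)%:E)) => N.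
rewrite -lee_fin fineK; first exact: le.
by rewrite ge0_fin_numE //; apply: integral_ge0 => t Dt; rewrite lee_fin f0.
Qed.

Lemma measurable_fun01 (R : realType) (f : R -> R) : (forall t, 0 < t < 1 -> {for t, continuous f}) ->
  measurable_fun (`]0, 1[ : set R) f.
Proof.
move=> cf; apply: open_continuous_measurable_fun; first exact: interval_open.
by move=> t /set_mem; rewrite /= in_itv /=; exact: cf.
Qed.

Lemma sum_le_integral_dyadic (R : realType) (f : R -> R) (s : nat -> R) (c : R) :
  (forall t, 0 < t < 1 -> {for t, continuous f}) -> (forall t, 0 < t < 1 -> 0 <= f t) ->
  0 < c -> (forall n, 0 <= s n) -> (forall n t, 2 ^- n.+1 < t < 2 ^- n -> 2 ^+ n * (c * s n) <= f t) ->
  (\int[lebesgue_measure]_(t in `]0%R, 1%R[) (f t)%:E < +oo)%E ->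
  exists B : R, forall N, \sum_(n < N) s n <= B.
Proof.
move=> cf f0 c0 s0 sf fin.
have [|n|n t tn|B hB] := @sum_le_integral R f (fun n => c / 2 * s n) _ f0 _ _ fin.
- exact: measurable_fun01.
- by rewrite mulr_ge0 // divr_ge0 // ltW.
- apply: le_trans (sf n t tn); rewrite exprS; have := exprn_gt0 n (@ltr0Sn R 1).
  by move: (2 ^+ n) (s n) => q r q0; nra.
exists (B / (c / 2)) => N; rewrite ler_pdivlMr ?divr_gt0 // mulrC mulr_sumr; exact: hB.
Qed.

Lemma ln_dyadic (R : realType) (n : nat) (t : R) : 0 < t -> t < 2 ^- n -> n%:R * ln 2 <= `|ln t|.
Proof.
move=> t0 tn; have n0 : 0 < 2 ^+ n :> R by rewrite exprn_gt0.
have : ln t <= - (n%:R * ln 2).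
  by rewrite mulr_natl -lnXn // -lnV ?posrE // ler_ln ?posrE ?invr_gt0 // ltW.
rewrite lerNr => /le_trans; apply; rewrite -normrN; exact: ler_norm.
Qed.

Lemma inv_dyadic (R : realType) (n : nat) (t : R) : 0 < t -> t < 2 ^- n -> 2 ^+ n <= t^-1.
Proof.
move=> t0 tn; rewrite -[leLHS]invrK lef_pV2 ?posrE ?invr_gt0 ?exprn_gt0 //; exact: ltW.
Qed.

Lemma cvg_normr_ln (R : realType) (t : R) : 0 < t -> {for t, continuous (fun t => `|ln t| : R)}.
Proof.
by move=> t0; apply: cvg_norm; exact: continuous_ln.
Qed.

(** Here [d] is the dimension minus one. On ]2^-(n+1), 2^-n[ one has t^-d >= 2^(nd), |ln t| >= n ln
    2 and h(t) >= h(2^-(n+1)). *)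
Lemma dyadic_sum_a (R : realType) (d : nat) (h : R -> R) : gauge_function h ->
  (\int[lebesgue_measure]_(t in `]0%R, 1%R[)
     (t^-1 * Num.sqrt (t ^ (1 - d.+1%:Z) * `|ln t| * h t))%:E < +oo)%E ->
  exists B : R, forall N, \sum_(n < N) Num.sqrt (n%:R * 2 ^+ (n * d) * h (2 ^- n.+1)) <= B.
Proof.
move=> gh; have l2 : 0 < ln 2 :> R by rewrite ln_gt0 // ltr1n.
have -> : (1 - d.+1%:Z = - d%:Z)%Z by lia.
apply: (@sum_le_integral_dyadic R _ (fun n => Num.sqrt (n%:R * 2 ^+ (n * d) * h (2 ^- n.+1))) (Num.sqrt (ln 2))).
- move=> t /andP[t0 _]; apply: cvgM; first by apply: cvgV; [rewrite gt_eqF|exact: cvg_id].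
  apply: (@cvg_comp _ _ _ (fun t => t ^ (- d%:Z) * `|ln t| * h t) Num.sqrt); last exact: sqrt_continuous.
  apply: cvgM; last exact: gauge_continuous.
  apply: cvgM; last exact: cvg_normr_ln.
  rewrite (_ : (fun t => _) = fun t : R => (t ^+ d)^-1); last by apply/funext => x; rewrite -exprnN.
  rewrite -exprnN; apply: cvgV; first by rewrite expf_neq0 // gt_eqF.
  exact: exprn_continuous.
- by move=> t /andP[t0 _]; rewrite mulr_ge0 // ?invr_ge0 ?sqrtr_ge0 // ltW.
- by rewrite sqrtr_gt0.
- by move=> n; exact: sqrtr_ge0.
move=> n t /andP[tn1 tn]; have i0 : 0 < 2 ^- n.+1 :> R by rewrite invr_gt0 exprn_gt0.
have t0 : 0 < t := lt_trans i0 tn1.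
apply: ler_pM; rewrite ?exprn_ge0 ?mulr_ge0 ?sqrtr_ge0 //; first exact: inv_dyadic.
rewrite -sqrtrM ?(ltW l2) //; apply: ler_wsqrtr.
have -> : ln 2 * (n%:R * 2 ^+ (n * d) * h (2 ^- n.+1)) = 2 ^+ (n * d) * (n%:R * ln 2) * h (2 ^- n.+1) by ring.
have h0 : 0 <= h (2 ^- n.+1) by rewrite ltW // (gauge_gt0 gh).
apply: ler_pM => //; first by rewrite !mulr_ge0 ?exprn_ge0 // ltW.
  apply: ler_pM; rewrite ?exprn_ge0 ?mulr_ge0 ?(ltW l2) //; last exact: ln_dyadic.
  rewrite -exprnN -exprVn exprM; apply: lerXn2r; rewrite ?nnegrE ?exprn_ge0 ?invr_ge0 ?(ltW t0) //.
  exact: inv_dyadic.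
by apply: (gauge_nondecreasing gh) => //; exact: ltW.
Qed.

(** The logarithm now stands outside the root and gives a factor n, which dominates sqrt n: the
    series is the one of [dyadic_sum_a] for the plane, written with [n * 1] to match. *)
Lemma dyadic_sum_b (R : realType) (h : R -> R) : gauge_function h ->
  (\int[lebesgue_measure]_(t in `]0%R, 1%R[) (t^-1 * `|ln t| * Num.sqrt (t^-1 * h t))%:E < +oo)%E ->
  exists B : R, forall N, \sum_(n < N) Num.sqrt (n%:R * 2 ^+ (n * 1) * h (2 ^- n.+1)) <= B.
Proof.
move=> gh; have l2 : 0 < ln 2 :> R by rewrite ln_gt0 // ltr1n.
apply: (@sum_le_integral_dyadic R _ (fun n => Num.sqrt (n%:R * 2 ^+ (n * 1) * h (2 ^- n.+1))) (ln 2)) => //.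
- move=> t /andP[t0 _]; apply: cvgM; first apply: cvgM.
  + by apply: cvgV; [rewrite gt_eqF|exact: cvg_id].
  + exact: cvg_normr_ln.
  apply: (@cvg_comp _ _ _ (fun t => t^-1 * h t) Num.sqrt); last exact: sqrt_continuous.
  apply: cvgM; last exact: gauge_continuous.
  by apply: cvgV; [rewrite gt_eqF|exact: cvg_id].
- by move=> t /andP[t0 _]; rewrite !mulr_ge0 // ?invr_ge0 ?sqrtr_ge0 // ltW.
move=> n t /andP[tn1 tn]; have i0 : 0 < 2 ^- n.+1 :> R by rewrite invr_gt0 exprn_gt0.
have t0 : 0 < t := lt_trans i0 tn1.
have h0 : 0 <= h (2 ^- n.+1) by rewrite ltW // (gauge_gt0 gh).
rewrite muln1 -mulrA sqrtrM // mulrA -mulrA.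
have sn : Num.sqrt n%:R <= n%:R :> R.
  rewrite -[leRHS]ger0_norm // -sqrtr_sqr; apply: ler_wsqrtr.
  by rewrite -natrX ler_nat; case: n {tn1 tn i0 h0} => // n; rewrite expnS expn1 leq_pmull.
apply: (@le_trans _ _ (2 ^+ n * ((n%:R * ln 2) * Num.sqrt (2 ^+ n * h (2 ^- n.+1))))).
  rewrite [ln 2 * _]mulrC -!mulrA [Num.sqrt (2 ^+ n * _) * _]mulrC ler_wpM2l ?exprn_ge0 //.
  by rewrite ler_wpM2r // mulr_ge0 ?sqrtr_ge0 // ltW.
rewrite mulrA; apply: ler_pM; rewrite ?sqrtr_ge0 ?mulr_ge0 ?exprn_ge0 ?(ltW l2) //.
  by apply: ler_pM; rewrite ?exprn_ge0 ?mulr_ge0 ?(ltW l2) //; [exact: inv_dyadic|exact: ln_dyadic].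
apply: ler_wsqrtr; apply: ler_pM; rewrite ?exprn_ge0 //; first exact: inv_dyadic.
by apply: (gauge_nondecreasing gh) => //; exact: ltW.
Qed.

(** * Fibres *)

Fixpoint greedy_size (R : realType) (d : nat) (H : nat -> R) (n : nat) : nat :=
  if n is m.+1 then
    (greedy_size d H m * (if ((greedy_size d H m)%:R <= H 0%N / H m.+1)%R then 2 ^ d else 1))%N
  else 1%N.

(** A full step is made when M H(n+1) <= H(0), so M H grows to at most 2^d H(0); it does not
    decrease, as H loses at most the factor 2^d. Otherwise M H(n+1) > H(0), and M H does not
    increase. *)
Lemma greedy_levels (R : realType) (d : nat) (H : nat -> R) :
  (forall n, 0 < H n) -> (forall n, H n.+1 <= H n) -> (forall n, H n <= 2 ^+ d * H n.+1) ->
  exists full : nat -> bool, forall n,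
    H 0%N / 2 ^+ d <= (lsize d full n)%:R * H n <= 2 ^+ d * H 0%N.
Proof.
move=> H0 Hm Hd; pose full n := (greedy_size d H n)%:R <= H 0%N / H n.+1.
exists full => n; have -> : lsize d full n = greedy_size d H n.
  by elim: n => [|n IH]; rewrite ?lsizeS ?IH // /lsize big_ord0.
have d1 : 1 <= 2 ^+ d :> R by rewrite exprn_ege1 // ler1n.
have d0 : 0 < 2 ^+ d :> R by rewrite exprn_gt0.
elim: n => [|n /andP[h1 h2]] /=.
  by rewrite mul1r ler_pdivrMr // mulrC !ler_peMl // ltW.
move: h1 h2; set M := greedy_size d H n; rewrite ler_pdivrMr // => h1 h2.
have M0 : 0 <= M%:R :> R by [].
have := H0 n; have := H0 n.+1; have := Hm n; have := Hd n; have := H0 0%N.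
move: h1 h2; rewrite ler_pdivrMr // natrM; case: ifP; rewrite ler_pdivlMr //.
  rewrite natrX => + h1 h2 *; move: M%:R M0 h1 h2 => m m0 h1 h2 h3; apply/andP; split; nra.
move=> /negbT; rewrite -ltNge mulr1 => + h1 h2 *; move: M%:R M0 h1 h2 => m m0 h1 h2 h3; apply/andP; split; nra.
Qed.

Lemma gauge_levels (R : realType) (d : nat) (h : R -> R) : gauge_function h ->
  (forall t, 0 < t -> h (2 * t) <= 2 ^+ d * h t) ->
  exists full : nat -> bool, forall n,
    h 1 / 2 ^+ d <= (lsize d full n)%:R * h (2 ^- n) <= 2 ^+ d * h 1.
Proof.
move=> gh hd; have n0 (m : nat) : 0 < 2 ^- m :> R by rewrite invr_gt0 exprn_gt0.
have half n : 2 * 2 ^- n.+1 = 2 ^- n :> R by rewrite exprS invfM mulrA divff // mul1r.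
have [|n|n|full hf] := @greedy_levels R d (fun n => h (2 ^- n)).
- by move=> n; exact: (gauge_gt0 gh).
- apply: (gauge_nondecreasing gh) => //; rewrite -[leRHS]half; have := n0 n.+1; lra.
- by rewrite -(half n); exact: hd.
by exists full => n; have := hf n; rewrite expr0 invr1.
Qed.

Lemma planar_hits (R : realType) (k : nat) (h : R -> R) : (0 < k)%N -> gauge_function h ->
  (forall t, 0 < t -> h (2 * t) <= 2 ^+ 2 * h t) ->
  (exists B : R, forall N, \sum_(n < N) Num.sqrt (n%:R * 2 ^+ (n * 1) * h (2 ^- n.+1)) <= B) ->
  exists full c, [/\ (0 < hausdorff_measure h (@cantor R 2 full c))%E,
    (hausdorff_measure h (@cantor R 2 full c) < +oo)%E &
    exists2 C : R, 0 < C & forall P : {poly {poly R}}, P != 0 -> bideg k P -> forall r, 0 < r ->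
      exists n : nat, 2 / 2 ^+ n <= r /\
        (size (seq.filter (hit n P) (lev full c n)))%:R <= C * fibre_scale h r].
Proof.
move=> k0 gh hd [B hB]; have [full hf] := gauge_levels gh hd.
set M := fun n => (lsize 2 full n)%:R : R; set c1 := h 1 / 2 ^+ 2; set c2 := 2 ^+ 2 * h 1.
have h1 : 0 < h 1 by rewrite (gauge_gt0 gh).
have c10 : 0 < c1 by rewrite divr_gt0 // exprn_gt0.
have M0 n : 0 < M n by rewrite ltr0n lsize_gt0.
have n0 (m : nat) : 0 < 2 ^+ m :> R by rewrite exprn_gt0.
have i0 (m : nat) : 0 < 2 ^- m :> R by rewrite invr_gt0.
have H0 n : 0 < h (2 ^- n) by exact: (gauge_gt0 gh).
have half n : 2 * 2 ^- n.+1 = 2 ^- n :> R by rewrite exprS invfM mulrA divff // mul1r.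
have B0 : 0 <= B by have := hB 0%N; rewrite big_ord0.
(* The factor 8 is 2 from n + 2 <= 2 (n + 1) and 4 from one doubling of [h]; the term of index 0
   equals 1 and is counted apart. *)
pose q := Num.sqrt (8 / c1); have q0 : 0 <= q by exact: sqrtr_ge0.
have hS N : \sum_(n < N) Num.sqrt (n.+1%:R * (2 ^+ n / M n)) <= 1 + q * B.
  apply: (@le_trans _ _ (\sum_(n < N) ((nat_of_ord n == 0%N)%:R + q * Num.sqrt (n%:R * 2 ^+ (n * 1) * h (2 ^- n.+1))))).
    apply: ler_sum => -[n nN] _ /=; case: n {nN} => [|n].
      by rewrite /M /lsize big_ord0 expr0 divr1 !mul1r sqrtr1 mul0r mul0r sqrtr0 mulr0 addr0.
    rewrite /= add0r -sqrtrM; last by rewrite divr_ge0 // ltW.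
    apply: ler_wsqrtr; rewrite muln1.
    have /andP[f1 _] := hf n.+1; rewrite -/c1 -/(M n.+1) in f1.
    have f2 := hd _ (i0 n.+2); rewrite half in f2.
    have f3 : (M n.+1)^-1 <= 4 * h (2 ^- n.+2) / c1.
      rewrite ler_pdivlMr // ler_pdivrMl //; apply: le_trans f1 _; rewrite ler_pM2l //.
      by apply: le_trans f2 _; rewrite -natrX.
    have f4 : n.+2%:R <= 2 * n.+1%:R :> R by rewrite -natrM ler_nat; lia.
    apply: (@le_trans _ _ ((2 * n.+1%:R) * (2 ^+ n.+1 * (4 * h (2 ^- n.+2) / c1)))).
      by apply: ler_pM => //; [rewrite divr_ge0 // ltW|rewrite ler_pM2l].
    by rewrite le_eqVlt; apply/orP; left; apply/eqP; ring.
  rewrite big_split /=; apply: lerD; last first.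
    rewrite -mulr_sumr; apply: ler_wpM2l => //; exact: hB.
  by case: N => [|N]; rewrite ?big_ord0 // big_ord_recl big1 ?addr0 //= => i _.
set S := 1 + q * B in hS.
have S0 : 0 < S by rewrite ltr_pwDl // mulr_ge0.
(* Thus M_n / 2^n is bounded below, and the squares met in bounded number are absorbed into the main
   term. *)
have bS n : 2 ^+ n <= S ^+ 2 * M n.
  have := hS n.+1; rewrite big_ord_recr /= => hn.
  have s0 : 0 <= n.+1%:R * (2 ^+ n / M n) by rewrite mulr_ge0 // divr_ge0 // ltW.
  have : Num.sqrt (n.+1%:R * (2 ^+ n / M n)) <= S.
    by apply: le_trans hn; rewrite lerDr sumr_ge0 // => i _; exact: sqrtr_ge0.
  move=> hq; have hb : n.+1%:R * (2 ^+ n / M n) <= S ^+ 2.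
    by rewrite -(sqr_sqrtr s0) ler_sqr // nnegrE ?sqrtr_ge0 // ltW.
  rewrite -ler_pdivrMr //; apply: le_trans hb; rewrite ler_peMl //; last by rewrite ler1n.
  by rewrite divr_ge0 // ltW.
have [C [Kc [Kc3 hits]]] := hits_bound R k0.
have [c [Lam [Lam0 hext]]] := random_levels k Kc3 hS.
exists full, c; split.
- by apply: (hausdorff_cantor_gt0 c gh hd c10) => n; have /andP[] := hf n.
- by apply: (hausdorff_cantor_lty c (c2 := c2) gh hd) => n; have /andP[] := hf n.
pose X : R := C.+1%:R * (S ^+ 2 + Lam) * c2.
have c20 : 0 < c2 by rewrite mulr_gt0 // exprn_gt0.
have SL0 : 0 < S ^+ 2 + Lam by rewrite addr_gt0 ?exprn_gt0.
have X0 : 0 < X by rewrite !mulr_gt0.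
have hitn (P : {poly {poly R}}) n : P != 0 -> bideg k P ->
    (size (seq.filter (hit n P) (lev full c n)))%:R <= X * (2 ^- n / h (2 ^- n)).
  move=> P0 kP.
  have w0 : 0 < 4 ^+ n / M n by rewrite divr_gt0 // exprn_gt0.
  have := hits n (lev full c n) _ Lam (lev_uniq _ _ _) (fun z i zn => lev_lt i zn) w0 Lam0
    (fun sw f s al be phi bf => hext n sw f s al be phi bf) P P0 kP.
  move=> /le_trans; apply.
  have e4 : 4 ^+ n = 2 ^+ n * 2 ^+ n :> R by rewrite -exprMn -natrM.
  have -> : 2 ^+ n * (Lam / (4 ^+ n / M n)) = Lam * (M n / 2 ^+ n).
    rewrite e4; have := M0 n; have := n0 n; move: (2 ^+ n) (M n) => a b a0 b0.
    by field; rewrite !gt_eqF.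
  have m1 : 1 <= S ^+ 2 * (M n / 2 ^+ n) by rewrite mulrA ler_pdivlMr // mul1r.
  have m2 : M n / 2 ^+ n <= c2 * (2 ^- n / h (2 ^- n)).
    rewrite mulrCA [leRHS]mulrC ler_pM2r // ler_pdivlMr //; by have /andP[] := hf n.
  have m0 : 0 <= M n / 2 ^+ n by rewrite divr_ge0 // ltW.
  have g0 : 0 <= 2 ^- n / h (2 ^- n) by rewrite divr_ge0 // ltW.
  rewrite /X -!mulrA; apply: ler_pM => //; first by rewrite addr_ge0 // mulr_ge0 // ltW.
    by rewrite ler_nat.
  apply: (@le_trans _ _ ((S ^+ 2 + Lam) * (M n / 2 ^+ n))); first by rewrite mulrDl lerD2r.
  by rewrite ler_pM2l //; apply: le_trans m2 _; rewrite /c2 expr2 -!mulrA.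
(* For r >= 1 the level 1 is used, with pieces of length 2 / 2 = 1. *)
pose Y : R := X * (2 ^- 1 / h (2 ^- 1)).
have Y0 : 0 < Y by rewrite mulr_gt0 // divr_gt0.
have hitY (P : {poly {poly R}}) : P != 0 -> bideg k P ->
  (size (seq.filter (hit 1 P) (lev full c 1)))%:R <= Y by exact: hitn.
clearbody Y; clearbody X.
have X80 : 0 < 8 * X by rewrite mulr_gt0.
have Yh0 : 0 < Y * h 1 by rewrite mulr_gt0.
(* The three terms serve r < 1, r > 1 and r = 1 respectively. *)
exists (8 * X + Y + Y * h 1); first by lra.
move=> P P0 kP r r0.
have [r1|r1] := ltP r 1.
  have [m /andP[rm mr]] := dyadic_scale r0 r1.
  (* Pieces of level m + 2 have length 2^-(m+1) <= r. Two doublings give h r <= 16 h(2^-(m+2)), and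
     2^-(m+2) <= r / 2, whence the factor 8. *)
  exists m.+2; split; first by rewrite -half in rm; rewrite half in rm; rewrite half.
  apply: le_trans (hitn _ _ P0 kP) _; rewrite /fibre_scale (ltW r1).
  have hr : h r <= 16 * h (2 ^- m.+2).
    apply: (@le_trans _ _ (h (2 ^- m))); first exact: (gauge_nondecreasing gh) (ltW mr).
    have f1 := hd _ (i0 m.+1); have f2 := hd _ (i0 m.+2).
    have e22 : 2 ^+ 2 = 4 :> R by rewrite -natrX.
    rewrite !half !e22 in f1 f2.
    by lra.
  have hr0 := gauge_gt0 gh r0.
  apply: (@le_trans _ _ (8 * X * (r / h r))); last first.
    by rewrite ler_wpM2r ?divr_ge0 ?(ltW r0) ?(ltW hr0) //; lra.
  rewrite [8 * X]mulrC -mulrA ler_pM2l // mulrA ler_pdivlMr // mulrAC ler_pdivrMr //.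
  rewrite -half in rm; have := i0 m.+2; move: (H0 m.+2) hr rm hr0.
  by move: (h r) (h (2 ^- m.+2)) (2 ^- m.+2) => a b e; clear; nra.
exists 1%N; split; first by rewrite expr1 divff.
apply: le_trans (hitY _ P0 kP) _; rewrite /fibre_scale; case: ifP => r1'.
  have -> : r = 1 by apply/eqP; rewrite eq_le r1 r1'.
  by rewrite mulrA mulr1 ler_pdivlMr //; nra.
apply: (@le_trans _ _ ((8 * X + Y + Y * h 1) * 1)); first by lra.
by rewrite ler_wpM2l ?le_max ?lexx //; lra.
Qed.

Lemma cube_in_cell (R : realType) (n : nat) (z : idx 2) (x : 'rV[R]_2) : cube n z x -> in_cell n z x.
Proof. by move=> zx; apply/andP; split; exact: zx. Qed.

Lemma line_cover_cell (R : realType) (g : set 'rV[R]_2) (r : R) (n : nat) (z : idx 2) :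
  is_line g -> 0 < r -> 2 / 2 ^+ n <= r ->
  exists2 N, (N <= 2)%N & covered_by_intervals (line_interval g r) N (g `&` in_cell n z).
Proof.
move=> lg r0 nr; apply: line_cover => // x y [_ /andP[/andP[x1 x2] /andP[x3 x4]]] [_ /andP[/andP[y1 y2] /andP[y3 y4]]].
rewrite mul1r; apply: le_trans nr; rewrite (ptE x) (ptE y).
apply: le_trans (enorm_pt_le _ _ _ _) _; rewrite -[_.+1%:R]natr1 mulrDl mul1r in x2 x4 y2 y4.
have -> : 2 / 2 ^+ n = 2 ^- n + 2 ^- n :> R by rewrite mulrDl mul1r.
by rewrite lerD // ler_norml; apply/andP; split; lra.
Qed.

Lemma planar_lines (R : realType) (h : R -> R) : gauge_function h ->
  (forall t, 0 < t -> h (2 * t) <= 2 ^+ 2 * h t) ->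
  (exists B : R, forall N, \sum_(n < N) Num.sqrt (n%:R * 2 ^+ (n * 1) * h (2 ^- n.+1)) <= B) ->
  exists A : set 'rV[R]_2,
    [/\ compact A, (0 < hausdorff_measure h A)%E, (hausdorff_measure h A < +oo)%E &
      exists2 C : R, 0 < C & forall (g : set 'rV[R]_2) (r : R), is_line g -> 0 < r ->
        exists2 N : nat, N%:R <= C * fibre_scale h r &
          covered_by_intervals (line_interval g r) N (A `&` g)].
Proof.
move=> gh hd hB; have [full [c [m0 moo [C C0 hits]]]] := planar_hits (ltnSn 0) gh hd hB.
exists (cantor full c); split => //; first exact: compact_cantor.
exists (2 * C) => [|g r lg r0]; first by rewrite mulr_gt0.
have [P [P0 kP gP]] := line_zeros lg; have [n [nr nh]] := hits P P0 kP r r0.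
have [N Nle cN] := covered_bigcup (l := seq.filter (hit n P) (lev full c n))
  (fun z _ => line_cover_cell z lg r0 nr).
exists N.
  apply: (@le_trans _ _ (2 * (size (seq.filter (hit n P) (lev full c n)))%:R)).
    by rewrite -natrM ler_nat.
  by rewrite -mulrA ler_pM2l.
apply: covered_sub cN => // x [/(_ n)[z zn zx] gx].
have zc := cube_in_cell zx; exists z => //; rewrite mem_filter zn andbT.
by apply/asboolP; exists (x 0 ord0), (x 0 ord_max); split => //; exact: gP.
Qed.

Lemma planar_curves (R : realType) (k : nat) (h : R -> R) : gauge_function h ->
  (forall t, 0 < t -> h (2 * t) <= 2 ^+ 2 * h t) ->
  (exists B : R, forall N, \sum_(n < N) Num.sqrt (n%:R * 2 ^+ (n * 1) * h (2 ^- n.+1)) <= B) ->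
  exists A : set 'rV[R]_2,
    [/\ compact A, (0 < hausdorff_measure h A)%E, (hausdorff_measure h A < +oo)%E &
      exists2 C : R, 0 < C & forall (g : set 'rV[R]_2) (r : R), algebraic_curve k g -> 0 < r ->
        exists2 N : nat, N%:R <= C * fibre_scale h r &
          covered_by_intervals (curve_interval g r) N (A `&` g)].
Proof.
(* The set is built for degree k + 1, which is positive also when k = 0, so that horizontal lines
   belong to the controlled branches. *)
move=> gh hd hB; have [full [c [m0 moo [C C0 hits]]]] := planar_hits (ltn0Sn k) gh hd hB.
have [D hD] := curve_cover R k.+1.
exists (cantor full c); split => //; first exact: compact_cantor.
exists (D.+1%:R * C) => [|g r cg r0]; first by rewrite mulr_gt0.
have [P [P0 kP gP]] := curve_zeros cg.
have kP' : bideg k.+1 P by case/andP: kP => h1 h2; apply/andP; split; exact: leqW.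
have [n [nr nh]] := hits P P0 kP' r r0.
have [N Nle cN] := hD P n (lev full c n) P0 kP' (fun z i zn => lev_lt i zn).
exists N.
  apply: (@le_trans _ _ (D.+1%:R * (size (seq.filter (hit n P) (lev full c n)))%:R)).
    by rewrite -natrM ler_nat (leq_trans Nle) // leq_mul2r leqnSn orbT.
  by rewrite -mulrA ler_pM2l.
apply: covered_sub cN; first by move=> J; rewrite gP; exact: curve_interval_le.
move=> x [/(_ n)[z zn zx] gx]; split; first by rewrite -gP.
by exists z => //; exact: cube_in_cell.
Qed.

(* In dimension at least 3, convergence of the integral forces [h r = O(r^2)], so that [r / h r] is at
   least of the order of the number of intervals of length [r] in a bounded segment. *)
Lemma gauge_quadratic (R : realType) (d : nat) (h : R -> R) (B : R) : (2 <= d)%N -> gauge_function h ->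
  (forall N, \sum_(n < N) Num.sqrt (n%:R * 2 ^+ (n * d) * h (2 ^- n.+1)) <= B) ->
  exists2 Q : R, 0 < Q & forall r, 0 < r -> r <= 1 -> h r <= Q * r ^+ 2.
Proof.
move=> d2 gh hB; have n0 (m : nat) : 0 < 2 ^+ m :> R by rewrite exprn_gt0.
have i0 (m : nat) : 0 < 2 ^- m :> R by rewrite invr_gt0.
have h1 : 0 < h 1 by exact: (gauge_gt0 gh).
have B0 : 0 <= B by have := hB 0%N; rewrite big_ord0.
have half n : 2 * 2 ^- n.+1 = 2 ^- n :> R by rewrite exprS invfM mulrA divff // mul1r.
(* A single term of the series is at most [B]; here [d] is the dimension minus one, and at least
   2. *)
have small n : h (2 ^- n.+2) <= B ^+ 2 * (2 ^- n.+1) ^+ 2.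
  have hn : 0 < h (2 ^- n.+2) by exact: (gauge_gt0 gh).
  have s0 : 0 <= n.+1%:R * 2 ^+ (n.+1 * d) * h (2 ^- n.+2) by rewrite !mulr_ge0 // ltW.
  have : Num.sqrt (n.+1%:R * 2 ^+ (n.+1 * d) * h (2 ^- n.+2)) <= B.
    have := hB n.+2; rewrite big_ord_recr /=; apply: le_trans.
    by rewrite lerDr sumr_ge0 // => i _; exact: sqrtr_ge0.
  move=> hq; have hb : n.+1%:R * 2 ^+ (n.+1 * d) * h (2 ^- n.+2) <= B ^+ 2.
    by rewrite -(sqr_sqrtr s0) ler_sqr // nnegrE ?sqrtr_ge0.
  have -> : (2 ^- n.+1) ^+ 2 = 2 ^- (n.+1 * 2) :> R by rewrite exprVn exprM.
  rewrite ler_pdivlMr // mulrC; apply: le_trans hb.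
  rewrite ler_pM2r // -[leLHS]mul1r; apply: ler_pM => //; rewrite ?exprn_ge0 ?ler1n //.
  by rewrite ler_eXn2l ?ltr1n // leq_mul2l d2 orbT.
(* For r < 1/4 the scale used in [small] is at most 4 r, and 16 is the square of 4; for r >= 1/4, h
   r <= h 1 <= 16 h(1) r^2. *)
exists (16 * (B ^+ 2 + h 1)); first by rewrite mulr_gt0 // ltr_wpDl ?sqr_ge0.
move=> r r0; rewrite le_eqVlt => /orP[/eqP ->|r1].
  have := sqr_ge0 B; rewrite expr1n mulr1; lra.
have [[|[|m]] /andP[rm mr]] := dyadic_scale r0 r1.
- have hr : h r <= h 1 by exact: (gauge_nondecreasing gh) (ltW r1).
  apply: (le_trans hr); have := sqr_ge0 B; rewrite expr1 in rm.
  have : 1 / 4 <= r ^+ 2 by nra.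
  by move: (r ^+ 2) (B ^+ 2) => u v; nra.
- have hr : h r <= h 1 by exact: (gauge_nondecreasing gh) (ltW r1).
  apply: (le_trans hr); have := sqr_ge0 B.
  have e4 : 2 ^- 2 = 1 / 4 :> R by rewrite -natrX div1r.
  rewrite e4 in rm; have : 1 / 16 <= r ^+ 2 by nra.
  by move: (r ^+ 2) (B ^+ 2) => u v; nra.
have hr : h r <= h (2 ^- m.+2) by exact: (gauge_nondecreasing gh) (ltW mr).
apply: (le_trans hr); apply: (le_trans (small m)).
have := half m.+1; have := half m.+2; move: rm (i0 m.+3) (sqr_ge0 B).
move: (2 ^- m.+3) (2 ^- m.+2) (2 ^- m.+1) (B ^+ 2) => a b e v ar a0 v0 ab be.
have -> : e ^+ 2 = 16 * a ^+ 2 by rewrite -be -ab; ring.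
have : a ^+ 2 <= r ^+ 2 by rewrite ler_sqr ?nnegrE // ltW.
have := sqr_ge0 a; move: (a ^+ 2) (r ^+ 2) => u w; nra.
Qed.

(** The set lies in the unit cube, of diameter at most d, so d / r + 2 intervals always suffice; for
    r <= 1 this is at most (d + 2) / r, while r / h r >= 1 / (Q r). The single children can
    therefore all be the same corner. *)
Lemma spatial_lines (R : realType) (d : nat) (h : R -> R) (Q : R) : (0 < d)%N -> gauge_function h ->
  (forall t, 0 < t -> h (2 * t) <= 2 ^+ d * h t) ->
  0 < Q -> (forall r, 0 < r -> r <= 1 -> h r <= Q * r ^+ 2) ->
  exists A : set 'rV[R]_d,
    [/\ compact A, (0 < hausdorff_measure h A)%E, (hausdorff_measure h A < +oo)%E &
      exists2 C : R, 0 < C & forall (g : set 'rV[R]_d) (r : R), is_line g -> 0 < r ->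
        exists2 N : nat, N%:R <= C * fibre_scale h r &
          covered_by_intervals (line_interval g r) N (A `&` g)].
Proof.
move=> d0 gh hd Q0 hQ; have [full hf] := gauge_levels gh hd.
have h1 : 0 < h 1 by exact: (gauge_gt0 gh).
pose c (n : nat) (Z : seq (idx d)) (z : idx d) : {ffun 'I_d -> bool} := [ffun=> false].
exists (cantor full c); split; first exact: compact_cantor.
- apply: (@hausdorff_cantor_gt0 _ _ _ _ _ (h 1 / 2 ^+ d) gh hd); first by rewrite divr_gt0 ?exprn_gt0.
  by move=> n; have /andP[] := hf n.
- by apply: (@hausdorff_cantor_lty _ _ _ _ _ (2 ^+ d * h 1) gh hd) => n; have /andP[] := hf n.
have K0 : 0 < (d + 2)%:R :> R by rewrite ltr0n addn2.
exists ((d + 2)%:R * (Q + 1)) => [|g r lg r0]; first by rewrite mulr_gt0 // addr_gt0.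
have dA (x y : 'rV[R]_d) : cantor full c x -> cantor full c y -> enorm (x - y) <= d%:R.
  move=> /(_ 0%N)[z + zx] /(_ 0%N)[z' + zy]; rewrite !inE => /eqP ze /eqP ze'; subst z z'.
  apply: le_trans (enorm_le_sum _) _; rewrite -[d in d%:R]card_ord -sum1_card natr_sum.
  apply: ler_sum => i _; have := zx i; have := zy i.
  rewrite !ffunE expr0 !divr1 => /andP[y1 y2] /andP[x1 x2].
  by rewrite !mxE ler_norml; apply/andP; split; lra.
have q0 : 0 <= d%:R / r by rewrite divr_ge0 // ltW.
have /andP[t1 t2] := truncn_itv q0.
have [|x y [Ax _] [Ay _]|N Nle cN] := @line_cover R d g (cantor full c `&` g) r (Num.trunc (d%:R / r)).+1 lg r0.
- by move=> x [].
- apply: le_trans (dA x y Ax Ay) _; rewrite -ler_pdivrMr //; exact: ltW.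
exists N => //.
have Nr : N%:R <= d%:R / r + 2.
  apply: (@le_trans _ _ ((Num.trunc (d%:R / r)) + 2)%:R); first by rewrite ler_nat addn2.
  by rewrite natrD lerD2r.
apply: (le_trans Nr); rewrite /fibre_scale; case: ifP => r1.
  have hr := gauge_gt0 gh r0.
  have : Q^-1 <= r ^+ 2 / h r by rewrite ler_pdivlMr // ler_pdivrMl // hQ.
  rewrite -(ler_pM2l Q0) divff ?gt_eqF // => hq.
  have -> : d%:R / r + 2 = (d%:R + 2 * r) / r by rewrite mulrDl mulfK // gt_eqF.
  rewrite ler_pdivrMr // natrD.
  have -> : (d%:R + 2) * (Q + 1) * (r / h r) * r = (d%:R + 2) * ((Q + 1) * (r ^+ 2 / h r)) by ring.
  have u0 : 0 <= r ^+ 2 / h r by rewrite divr_ge0 ?sqr_ge0 // ltW.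
  apply: (@le_trans _ _ (d%:R + 2)); first by rewrite lerD2l; lra.
  by rewrite ler_peMr // mulrDl mul1r ler_wpDr.
have r1' : 1 < r by rewrite ltNge r1.
apply: (@le_trans _ _ (d + 2)%:R).
  by rewrite natrD lerD2r ler_pdivrMr // ler_peMr // ltW.
rewrite -mulrA ler_peMr //.
rewrite -[leLHS]mulr1; by apply: ler_pM => //; [rewrite lerDr ltW|rewrite le_max lexx].
Qed.

Unset Implicit Arguments.

Theorem theorem1p6 (R : realType) :
  (forall (d : nat) (h : R -> R), (2 <= d)%N ->
    gauge_function h ->
    (forall t : R, 0 < t -> h (2 * t) <= 2 ^+ d * h t) ->
    (\int[lebesgue_measure]_(t in `]0%R, 1%R[)
       (t^-1 * Num.sqrt (t ^ (1 - d%:Z) * `|ln t| * h t))%:E < +oo)%E ->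
    exists A : set 'rV[R]_d,
      [/\ compact A,
          (0 < hausdorff_measure h A)%E, (hausdorff_measure h A < +oo)%E &
          exists2 C : R, 0 < C &
            forall (g : set 'rV[R]_d) (r : R), is_line g -> 0 < r ->
              exists2 N : nat, N%:R <= C * fibre_scale h r &
                covered_by_intervals (line_interval g r) N (A `&` g)])
  /\
  (forall (k : nat) (h : R -> R),
    gauge_function h ->
    (forall t : R, 0 < t -> h (2 * t) <= 4 * h t) ->
    (\int[lebesgue_measure]_(t in `]0%R, 1%R[)
       (t^-1 * `|ln t| * Num.sqrt (t^-1 * h t))%:E < +oo)%E ->
    exists A : set 'rV[R]_2,
      [/\ compact A,
          (0 < hausdorff_measure h A)%E, (hausdorff_measure h A < +oo)%E &
          exists2 C : R, 0 < C &
            forall (g : set 'rV[R]_2) (r : R), algebraic_curve k g -> 0 < r ->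
              exists2 N : nat, N%:R <= C * fibre_scale h r &
                covered_by_intervals (curve_interval g r) N (A `&` g)]).
Proof.
split=> [d h d2 gh hd fin|k h gh hd fin].
  case: d d2 hd fin => [//|[//|[|d]]] _ hd fin.
    apply: planar_lines => //; exact: dyadic_sum_a fin.
  have [B hB] := dyadic_sum_a (d := d.+2) gh fin.
  have [Q Q0 hQ] := gauge_quadratic (isT : (2 <= d.+2)%N) gh hB.
  exact: spatial_lines Q0 hQ.
apply: planar_curves => //; last exact: dyadic_sum_b.
by move=> t /hd; rewrite -natrX.
Qed.
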